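(* Let $\Gamma\subset\mathbb{R}^2$ be a lattice with basis $v_1,v_2$, let $v_1^*,v_2^*$ be the dual basis of the dual lattice $\Gamma^*$, let $T^2=\mathbb{R}^2/\Gamma$ with its flat metric $g_o$, and let $(M^2,g)$ be a two-dimensional Riemannian manifold conformally equivalent to the flat torus $(T^2,g_o)$, i.e. $M^2=T^2$ and $g=h^4g_o$ with $h:T^2\to\mathbb{R}$ a smooth positive function. Suppose the spin structure $(\varepsilon_1,\varepsilon_2)\neq(0,0)$ is non-trivial. Then the Dirac operator $D$ on $(M^2,g)$ has trivial kernel, and the first eigenvalue $\lambda_1^2(D)$ of $D^2$ is bounded by $$\lambda_1^2(D) \le \pi^2\, |\varepsilon_1 v_1^* + \varepsilon_2 v_2^*|^2\; \frac{\displaystyle\int_{T^2}\frac{1}{h^2}\,dT^2}{\displaystyle\int_{T^2} h^2\, dT^2}.$$ Moreover, the inequality $$\lambda_1^2(D)\,\mathrm{vol}(M^2,g) \le \lambda_1^2(g_o)\,\mathrm{vol}(T^2,g_o) + \int_{T^2}\frac{|\mathrm{grad}(h)|^2}{h^2}\,dT^2$$ holds, with $$\lambda_1^2(g_o)\,\mathrm{vol}(T^2,g_o) = \pi^2\,\frac{|\varepsilon_1v_1^*+\varepsilon_2v_2^*|^2}{\sqrt{|v_1^*|^2|v_2^*|^2 - \langle v_1^*,v_2^*\rangle^2}},$$ where $\lambda_1^2(g_o)$ is the first eigenvalue of the square of the Dirac operator of the flat torus $(T^2,g_o)$ with spin structure $(\varepsilon_1,\varepsilon_2)$.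
   Context: The dual basis is defined by $\langle v_i^*, v_j\rangle = \delta_{ij}$, and $\Gamma^*=\mathbb{Z}v_1^*\oplus\mathbb{Z}v_2^*$. The spin structures of $T^2=\mathbb{R}^2/\Gamma$ are described, relative to the basis $v_1,v_2$, by pairs $(\varepsilon_1,\varepsilon_2)$ with $\varepsilon_i\in\{0,1\}$: spinor fields on the flat torus for $(\varepsilon_1,\varepsilon_2)$ correspond to functions $\psi:\mathbb{R}^2\to\mathbb{C}^2$ with $\psi(x+v_j)=(-1)^{\varepsilon_j}\psi(x)$; the trivial spin structure is $(0,0)$. The gradient, its norm and the area element $dT^2$ are taken with respect to the flat metric $g_o$; $\mathrm{vol}$ denotes area.
   Formalization: The final formula for λ_1^2(g_o)vol(T^2,g_o) is false for some bases; it is stated only when ε_1v_1^*+ε_2v_2^* is a shortest vector in its class modulo 2Γ^*, which is exactly when it holds; all other claims are for every basis. *)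

(* Defs.v *)
(* Stdlib real numbers with Coquelicot. *)
From Stdlib Require Import Reals ZArith.
From Coquelicot Require Import Coquelicot.
Open Scope R_scope.

(** * The plane *)

Definition plane : Type := (R * R)%type.

Inductive idx : Set := i1 | i2.

Definition sum2 (F : idx -> R) : R := F i1 + F i2.
Definition kron (i j : idx) : R :=
  match i, j with i1, i1 | i2, i2 => 1 | _, _ => 0 end.

Definition vadd (x y : plane) : plane := (fst x + fst y, snd x + snd y).
Definition vscal (a : R) (x : plane) : plane := (a * fst x, a * snd x).
Definition dot (x y : plane) : R := fst x * fst y + snd x * snd y.
Definition normsq (x : plane) : R := dot x x.

Definition basis (v1 v2 : plane) : Prop :=
  forall a b : R, vadd (vscal a v1) (vscal b v2) = (0, 0) -> a = 0 /\ b = 0.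

Definition dual_basis (v1 v2 w1 w2 : plane) : Prop :=
  dot w1 v1 = 1 /\ dot w1 v2 = 0 /\ dot w2 v1 = 0 /\ dot w2 v2 = 1.

(** * Partial derivatives and smoothness *)

Definition slice {T : Type} (i : idx) (f : plane -> T) (x : plane) : R -> T :=
  match i with
  | i1 => fun t => f (t, snd x)
  | i2 => fun t => f (fst x, t)
  end.
Definition coord (i : idx) (x : plane) : R :=
  match i with i1 => fst x | i2 => snd x end.

Definition ex_pd (i : idx) (f : plane -> R) (x : plane) : Prop :=
  ex_derive (slice i f x) (coord i x).
Definition pd (i : idx) (f : plane -> R) (x : plane) : R :=
  Derive (slice i f x) (coord i x).

Fixpoint class_C (n : nat) (f : plane -> R) : Prop :=
  (forall x, continuous f x) /\
  match n with
  | O => True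
  | S m => forall i, (forall x, ex_pd i f x) /\ class_C m (pd i f)
  end.
Definition smooth (f : plane -> R) : Prop := forall n, class_C n f.

(** * The torus [R^2 / (Z v1 + Z v2)]

    Functions on the torus are the doubly periodic functions on the plane. *)

Definition periodic (v1 v2 : plane) (f : plane -> R) : Prop :=
  forall x, f (vadd x v1) = f x /\ f (vadd x v2) = f x.

(* Integral over the fundamental parallelogram, parametrised by
   (s, t) |-> s v1 + t v2, whose Jacobian is det (v1, v2). *)
Definition torus_int (v1 v2 : plane) (f : plane -> R) : R :=
  Rabs (fst v1 * snd v2 - snd v1 * fst v2) *
  RInt (fun s => RInt (fun t => f (vadd (vscal s v1) (vscal t v2))) 0 1) 0 1.

(** * Riemannian metrics

    A metric is given by its coefficients [g i j] in the Cartesian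
    coordinates of the plane, a frame by [E a k], the [k]-th component of
    its [a]-th vector field. *)

Definition metric : Type := idx -> idx -> plane -> R.
Definition frame : Type := idx -> idx -> plane -> R.

Definition det_metric (g : metric) (x : plane) : R :=
  g i1 i1 x * g i2 i2 x - g i1 i2 x * g i2 i1 x.
Definition inv_metric (g : metric) (k l : idx) (x : plane) : R :=
  match k, l with
  | i1, i1 => g i2 i2 x
  | i2, i2 => g i1 i1 x
  | _, _ => - g k l x
  end / det_metric g x.

Definition volume (v1 v2 : plane) (g : metric) : R :=
  torus_int v1 v2 (fun x => sqrt (det_metric g x)).

Definition christoffel (g : metric) (k i j : idx) (x : plane) : R :=
  / 2 * sum2 (fun l => inv_metric g k l x *
                       (pd i (g j l) x + pd j (g i l) x - pd l (g i j) x)).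

(* [levi_civita g i X k]: the k-th component of nabla_{d/dx_i} X. *)
Definition levi_civita (g : metric) (i : idx) (X : idx -> plane -> R)
    (k : idx) (x : plane) : R :=
  pd i (X k) x + sum2 (fun j => christoffel g k i j x * X j x).

(* g (nabla_{d/dx_i} E_1, E_2). *)
Definition connection_form (g : metric) (E : frame) (i : idx) (x : plane) : R :=
  sum2 (fun k => sum2 (fun l =>
    g k l x * levi_civita g i (E i1) k x * E i2 l x)).

Definition flat_metric : metric := fun i j _ => kron i j.
Definition flat_frame : frame := fun a k _ => kron a k.

Definition conf_metric (h : plane -> R) : metric :=
  fun i j x => h x ^ 4 * flat_metric i j x.
Definition conf_frame (h : plane -> R) : frame :=
  fun a k x => / h x ^ 2 * flat_frame a k x.

Definition grad_normsq (h : plane -> R) (x : plane) : R :=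
  pd i1 h x ^ 2 + pd i2 h x ^ 2.

(** * Spinors and the Dirac operator *)

Definition spinor : Type := (C * C)%type.
Definition spinor0 : spinor := (RtoC 0, RtoC 0).
Definition splus (p q : spinor) : spinor :=
  (Cplus (fst p) (fst q), Cplus (snd p) (snd q)).
Definition sscal (a : R) (p : spinor) : spinor :=
  (Cmult (RtoC a) (fst p), Cmult (RtoC a) (snd p)).

(* Clifford multiplication by the vectors of an orthonormal frame, with
   e_a e_b + e_b e_a = - 2 delta_ab. *)
Definition clifford (a : idx) (p : spinor) : spinor :=
  match a with
  | i1 => (Cmult Ci (snd p), Cmult Ci (fst p))
  | i2 => (Copp (snd p), fst p)
  end.

Definition cpd (i : idx) (f : plane -> C) (x : plane) : C :=
  (pd i (fun y => Re (f y)) x, pd i (fun y => Im (f y)) x).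
Definition spd (i : idx) (psi : plane -> spinor) (x : plane) : spinor :=
  (cpd i (fun y => fst (psi y)) x, cpd i (fun y => snd (psi y)) x).

(* Spinor fields are written in the trivialisation of the spinor bundle of
   the plane given by an orthonormal frame [E].  The spin connection is
   nabla_X psi = X(psi) + 1/2 g (nabla_X E_1, E_2) E_1 E_2 psi. *)
Definition spin_connection (g : metric) (E : frame) (i : idx)
    (psi : plane -> spinor) (x : plane) : spinor :=
  splus (spd i psi x)
        (sscal (/ 2 * connection_form g E i x)
               (clifford i1 (clifford i2 (psi x)))).

(* D psi = sum_a E_a . nabla_{E_a} psi. *)
Definition dirac (g : metric) (E : frame) (psi : plane -> spinor)
    (x : plane) : spinor :=
  let term a :=
    clifford a (splus (sscal (E a i1 x) (spin_connection g E i1 psi x))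
                      (sscal (E a i2 x) (spin_connection g E i2 psi x)))
  in splus (term i1) (term i2).

Definition dirac_flat : (plane -> spinor) -> plane -> spinor :=
  dirac flat_metric flat_frame.
Definition dirac_conf (h : plane -> R) : (plane -> spinor) -> plane -> spinor :=
  dirac (conf_metric h) (conf_frame h).

Definition smooth_spinor (psi : plane -> spinor) : Prop :=
  smooth (fun x => Re (fst (psi x))) /\ smooth (fun x => Im (fst (psi x))) /\
  smooth (fun x => Re (snd (psi x))) /\ smooth (fun x => Im (snd (psi x))).

(* A spin structure is (eps1, eps2) with [false] for 0 and [true] for 1.
   The frame [conf_frame h] is a positive periodic multiple of [flat_frame],
   so the same boundary conditions describe the spinor fields of the flat
   and of the conformally changed torus. *)
Definition eps (e : bool) : R := if e then 1 else 0.
Definition spin_sign (e : bool) : R := if e then -1 else 1.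

Definition spinor_field (v1 v2 : plane) (e1 e2 : bool)
    (psi : plane -> spinor) : Prop :=
  smooth_spinor psi /\
  forall x, psi (vadd x v1) = sscal (spin_sign e1) (psi x) /\
            psi (vadd x v2) = sscal (spin_sign e2) (psi x).

(** * Kernel and spectrum of an operator on spinor fields *)

Definition trivial_kernel (v1 v2 : plane) (e1 e2 : bool)
    (D : (plane -> spinor) -> plane -> spinor) : Prop :=
  forall psi, spinor_field v1 v2 e1 e2 psi ->
    (forall x, D psi x = spinor0) -> forall x, psi x = spinor0.

Definition eigenvalue (v1 v2 : plane) (e1 e2 : bool)
    (D : (plane -> spinor) -> plane -> spinor)
    (lam : R) : Prop :=
  exists psi, spinor_field v1 v2 e1 e2 psi /\
    (exists x, psi x <> spinor0) /\
    forall x, D psi x = sscal lam (psi x).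

Definition first_eigenvalue (v1 v2 : plane) (e1 e2 : bool)
    (D : (plane -> spinor) -> plane -> spinor)
    (lam : R) : Prop :=
  eigenvalue v1 v2 e1 e2 D lam /\
  forall mu, eigenvalue v1 v2 e1 e2 D mu -> lam <= mu.

Definition square (D : (plane -> spinor) -> plane -> spinor)
    (psi : plane -> spinor) : plane -> spinor := D (D psi).

(** * The dual vector of a spin structure *)

Definition spin_covector (e1 e2 : bool) (w1 w2 : plane) : plane :=
  vadd (vscal (eps e1) w1) (vscal (eps e2) w2).

(* eps1 w1 + eps2 w2 is a shortest vector in its class modulo
   2 (Z w1 + Z w2).  The eigenvalues of the square of the flat Dirac
   operator are pi^2 |v|^2 for v in this class; for an arbitrary basis
   eps1 w1 + eps2 w2 need not realise the smallest one. *)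
Definition shortest_spin_covector (e1 e2 : bool) (w1 w2 : plane) : Prop :=
  forall m n : Z,
    normsq (spin_covector e1 e2 w1 w2) <=
    normsq (vadd (spin_covector e1 e2 w1 w2)
                 (vscal 2 (vadd (vscal (IZR m) w1) (vscal (IZR n) w2)))).

(* Main.v *)
Require Import Defs.
From Stdlib Require Import Reals ZArith Lra Lia FunctionalExtensionality.
From Stdlib Require Import ClassicalEpsilon Classical.
From Stdlib Require Import Nsatz.
From Stdlib Require Cantor.
From Coquelicot Require Import Coquelicot.
Open Scope R_scope.

(** Put [rho = h^2], [dz = i d/dx1 + d/dx2] and let [dzbar] be minus the conjugate
    of [dz] by complex conjugation. In the conformal frame the Dirac operator of
    [h^4 g_o] is [h^-3 D0 h], where the flat operator [D0] maps [(a, b)] to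
    [(dzbar b, dz a)] ([dirac_conf_eq]). The squared operator therefore decouples:
    [D^2 psi = mu psi] means that [a = h psi_1] and the conjugate of [h psi_2]
    both solve [dzbar (rho^-1 dz a) = mu rho a], an equation for scalar functions
    with the signs of the spin structure. Its Rayleigh quotient is the integral of
    [rho^-1 |dz a|^2] over that of [rho |a|^2].

    For a non-trivial spin structure the eigenvalues of [dz] on the characters
    never vanish and tend to infinity, so [dz] has a compact inverse on twisted
    functions, given by Fourier series ([dz_inv], which rests on the completeness
    theorem [coef_complete] and on [parseval]). This yields the trivial kernel
    ([dirac_conf_kernel]).

    That the Rayleigh quotient attains its infimum at a smooth function is the
    heart of the matter ([twist_inv_maximiser]). Let [T f] be the conjugate of
    [dz^-1 (rho f)]. It is bounded, real linear and antisymmetric for the weighted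
    product, the real part of the integral of [rho f conj(g)]. Let [L] be the
    supremum of [|T f|^2 / |f|^2] and [a_n] a maximising sequence of unit vectors.
    Antisymmetry gives [T^2 a_n + L a_n -> 0] ([defect_small]). Along a subsequence
    every Fourier coefficient of [a_n] converges. To see that the limits are the
    coefficients of a smooth function, the approximate equation is used [p] times:
    up to small errors [L^p <a_n, g> = +- <a_n, T^(2p) g>], and for [g] a character
    times a smooth amplitude the norm of [T^(2p) g] decays like the power [-2p] of
    the frequency ([iter_inv_decay], a recursion obtained from
    [dz (q e) = (dz q) e + s q e] for a character [e] with eigenvalue [s]). Thus
    regularity is proved before passing to the limit, and all operators act on
    smooth functions only. Compactness of [dz^-1] shows that the limit [u] is not
    zero, and [T^2 u = - L u]; then [dz^-1 (rho u)] solves the scalar equation with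
    [mu = 1 / L]. Applying [|T f|^2 <= L |f|^2] to [f = rho^-1 dz a] shows that
    [1 / L] is a lower bound of the Rayleigh quotient, hence the first eigenvalue.

    Both estimates come from test functions: a character gives the first one
    ([rayleigh_character]); for the second, [h] times a character and [h] times its
    conjugate, for the frequency of the first flat eigenvalue, have energies whose
    average contains no cross term ([rayleigh_factor]). On the flat torus the
    characters are themselves eigenfunctions, and by Parseval the smallest
    [|frequency|^2] is the first eigenvalue; the frequencies are [pi] times the
    vectors [eps1 w1 + eps2 w2 + 2 w], [w] in the dual lattice. *)

(** * Calculus of smooth functions on the plane *)

Ltac fun_ext x := apply functional_extensionality; intros x.

Definition cont (f : plane -> R) : Prop := forall x : plane, continuous f x.

Lemma cont_const c : cont (fun _ => c).
Proof. intros x. apply continuous_const. Qed.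

Lemma cont_plus f g : cont f -> cont g -> cont (fun x => f x + g x).
Proof.
  intros Hf Hg x.
  exact (continuous_plus (V := R_NormedModule) f g x (Hf x) (Hg x)).
Qed.

Lemma cont_mult f g : cont f -> cont g -> cont (fun x => f x * g x).
Proof.
  intros Hf Hg x.
  exact (continuous_mult (K := R_AbsRing) f g x (Hf x) (Hg x)).
Qed.

Lemma cont_comp (g : R -> R) f :
  cont f -> (forall x, continuous g (f x)) -> cont (fun x => g (f x)).
Proof. intros Hf Hg x. apply (continuous_comp f g); auto. Qed.

Lemma cont_inv f : cont f -> (forall x, f x <> 0) -> cont (fun x => / f x).
Proof.
  intros Hf Hn. apply cont_comp; [exact Hf|].
  intros x. apply (continuous_Rinv (f x)), Hn.
Qed.

Lemma class_C_cont n f : class_C n f -> cont f.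
Proof. destruct n; intros [H _]; exact H. Qed.

Lemma class_C_S n f : class_C (S n) f -> class_C n f.
Proof.
  revert f; induction n as [|n IH]; intros f H.
  - split; [apply H|exact I].
  - split; [apply H|]. intros i. destruct H as [_ H]. destruct (H i) as [He Hc].
    split; [exact He|]. apply IH, Hc.
Qed.

Lemma pd_const c i : pd i (fun _ => c) = fun _ => 0.
Proof.
  fun_ext x. unfold pd.
  destruct i; simpl; apply Derive_const.
Qed.

Lemma class_C_const n c : class_C n (fun _ => c).
Proof.
  revert c; induction n as [|n IH]; intros c; split; try exact I;
    try apply cont_const.
  intros i. rewrite pd_const. split; [|apply IH].
  intros x. destruct i; apply ex_derive_const.
Qed.

Lemma pd_plus f g i :
  (forall x, ex_pd i f x) -> (forall x, ex_pd i g x) ->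
  pd i (fun x => f x + g x) = fun x => pd i f x + pd i g x.
Proof.
  intros Hf Hg. fun_ext x.
  specialize (Hf x); specialize (Hg x); unfold pd, ex_pd in *.
  destruct i; simpl in *; apply Derive_plus; assumption.
Qed.

Lemma class_C_plus n f g :
  class_C n f -> class_C n g -> class_C n (fun x => f x + g x).
Proof.
  revert f g; induction n as [|n IH]; intros f g [Hf Hf'] [Hg Hg'];
    (split; [apply cont_plus; assumption|]); [exact I|].
  intros i. destruct (Hf' i) as [Ef Cf], (Hg' i) as [Eg Cg].
  rewrite pd_plus; auto. split; [|auto].
  intros x. specialize (Ef x); specialize (Eg x); unfold ex_pd in *.
  destruct i; apply (ex_derive_plus (V := R_NormedModule)); assumption.
Qed.

Lemma pd_mult f g i :
  (forall x, ex_pd i f x) -> (forall x, ex_pd i g x) ->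
  pd i (fun x => f x * g x) = fun x => pd i f x * g x + f x * pd i g x.
Proof.
  intros Hf Hg. fun_ext x.
  specialize (Hf x); specialize (Hg x); unfold pd, ex_pd in *.
  destruct x as [x1 x2].
  destruct i; simpl in *.
  - rewrite (Derive_mult (fun t => f (t, x2)) (fun t => g (t, x2)));
      [reflexivity|assumption|assumption].
  - rewrite (Derive_mult (fun t => f (x1, t)) (fun t => g (x1, t)));
      [reflexivity|assumption|assumption].
Qed.

Lemma class_C_mult n f g :
  class_C n f -> class_C n g -> class_C n (fun x => f x * g x).
Proof.
  revert f g; induction n as [|n IH]; intros f g Hf0 Hg0;
    pose proof Hf0 as [Hf Hf']; pose proof Hg0 as [Hg Hg'];
    (split; [apply cont_mult; assumption|]); [exact I|].
  intros i. destruct (Hf' i) as [Ef Cf], (Hg' i) as [Eg Cg].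
  rewrite pd_mult; auto. split.
  - intros x. specialize (Ef x); specialize (Eg x); unfold ex_pd in *.
    destruct x as [x1 x2]; destruct i; simpl in *.
    + apply (ex_derive_mult (fun t => f (t, x2)) (fun t => g (t, x2))); auto.
    + apply (ex_derive_mult (fun t => f (x1, t)) (fun t => g (x1, t))); auto.
  - apply class_C_plus; apply IH; auto using class_C_S.
Qed.

Lemma pd_inv f i :
  (forall x, ex_pd i f x) -> (forall x, f x <> 0) ->
  pd i (fun x => / f x) = fun x => - 1 * (pd i f x * (/ f x * / f x)).
Proof.
  intros Hf Hn. fun_ext x.
  specialize (Hf x); specialize (Hn x); unfold pd, ex_pd in *.
  destruct x as [x1 x2].
  destruct i; simpl in *.
  - rewrite (Derive_inv (fun t => f (t, x2))); [|assumption|assumption].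
    field. assumption.
  - rewrite (Derive_inv (fun t => f (x1, t))); [|assumption|assumption].
    field. assumption.
Qed.

Lemma class_C_inv n f :
  class_C n f -> (forall x, f x <> 0) -> class_C n (fun x => / f x).
Proof.
  intros Hf0 Hn. revert Hf0; induction n as [|n IH]; intros Hf0;
    pose proof Hf0 as [Hf Hf'];
    (split; [apply cont_inv; assumption|]); [exact I|].
  intros i. destruct (Hf' i) as [Ef Cf].
  rewrite pd_inv; auto. split.
  - intros x. specialize (Ef x); unfold ex_pd in *. destruct x as [x1 x2].
    destruct i; simpl in *.
    + apply (ex_derive_inv (fun t => f (t, x2))); auto.
    + apply (ex_derive_inv (fun t => f (x1, t))); auto.
  - pose proof (IH (class_C_S _ _ Hf0)) as IH'.
    apply class_C_mult; [apply class_C_const|].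
    apply class_C_mult; [exact Cf|]. apply class_C_mult; exact IH'.
Qed.

Lemma smooth_cont f : smooth f -> cont f.
Proof. intros H. exact (class_C_cont 0 f (H 0%nat)). Qed.

Lemma smooth_ex_pd f i : smooth f -> forall x, ex_pd i f x.
Proof. intros H. exact (proj1 (proj2 (H 1%nat) i)). Qed.

Lemma smooth_pd f i : smooth f -> smooth (pd i f).
Proof. intros H n. exact (proj2 (proj2 (H (S n)) i)). Qed.

Lemma smooth_const c : smooth (fun _ => c).
Proof. intros n. apply class_C_const. Qed.

Lemma smooth_plus f g : smooth f -> smooth g -> smooth (fun x => f x + g x).
Proof. intros Hf Hg n. apply class_C_plus; auto. Qed.

Lemma smooth_mult f g : smooth f -> smooth g -> smooth (fun x => f x * g x).
Proof. intros Hf Hg n. apply class_C_mult; auto. Qed.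

Lemma smooth_inv f :
  smooth f -> (forall x, f x <> 0) -> smooth (fun x => / f x).
Proof. intros Hf Hn n. apply class_C_inv; auto. Qed.

Lemma smooth_eq f g : smooth f -> (forall x, f x = g x) -> smooth g.
Proof.
  intros Hf H. replace g with f; [exact Hf|].
  now apply functional_extensionality.
Qed.

Lemma smooth_scal c f : smooth f -> smooth (fun x => c * f x).
Proof. intros Hf. apply smooth_mult; [apply smooth_const|exact Hf]. Qed.

Lemma smooth_opp f : smooth f -> smooth (fun x => - f x).
Proof.
  intros Hf. apply smooth_eq with (fun x => - 1 * f x).
  - now apply smooth_scal.
  - intros x. ring.
Qed.

Lemma smooth_minus f g : smooth f -> smooth g -> smooth (fun x => f x - g x).
Proof. intros Hf Hg. apply smooth_plus; [|apply smooth_opp]; assumption. Qed.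

Lemma pd_opp f i : pd i (fun x => - f x) = fun x => - pd i f x.
Proof.
  fun_ext x. unfold pd.
  destruct i; simpl; apply Derive_opp.
Qed.

Lemma pd_minus f g i : smooth f -> smooth g ->
  pd i (fun x => f x - g x) = fun x => pd i f x - pd i g x.
Proof.
  intros Hf Hg. unfold Rminus. rewrite pd_plus, pd_opp; auto using smooth_ex_pd.
  now apply smooth_ex_pd, smooth_opp.
Qed.

(** Taken with [c = 1] or [c = -1] and a period [v], this passes periodicity and
    antiperiodicity on to derivatives. *)
Lemma pd_translate f i c v :
  (forall x, f (vadd x v) = c * f x) ->
  (forall x, ex_pd i f x) ->
  forall x, pd i f (vadd x v) = c * pd i f x.
Proof.
  intros Hf He [x1 x2]. destruct v as [a b].
  specialize (He (vadd (x1, x2) (a, b))).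
  unfold pd, ex_pd, vadd in *. destruct i; simpl in *.
  - rewrite <- (Derive_scal (fun t => f (t, x2))).
    rewrite (Derive_ext (fun t => c * f (t, x2)) (fun t => f (t + a, x2 + b)))
      by (intros t; symmetry; apply (Hf (t, x2))).
    symmetry. apply is_derive_unique.
    rewrite <- (Rmult_1_l (Derive _ (x1 + a))).
    apply (is_derive_comp (V := R_NormedModule) (fun t => f (t, x2 + b)) (fun t => t + a)).
    + apply Derive_correct. exact He.
    + auto_derive; auto.
  - rewrite <- (Derive_scal (fun t => f (x1, t))).
    rewrite (Derive_ext (fun t => c * f (x1, t)) (fun t => f (x1 + a, t + b)))
      by (intros t; symmetry; apply (Hf (x1, t))).
    symmetry. apply is_derive_unique.
    rewrite <- (Rmult_1_l (Derive _ (x2 + b))).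
    apply (is_derive_comp (V := R_NormedModule) (fun t => f (x1 + a, t)) (fun t => t + b)).
    + apply Derive_correct. exact He.
    + auto_derive; auto.
Qed.

(** Continuous partial derivatives make [f] differentiable, whence the chain
    rule along lines. *)
Lemma is_derive_line f (p v : plane) (t : R) :
  smooth f ->
  is_derive (fun t => f (vadd p (vscal t v))) t
    (fst v * pd i1 f (vadd p (vscal t v)) + snd v * pd i2 f (vadd p (vscal t v))).
Proof.
  intros Hf. destruct p as [p1 p2], v as [a b]. unfold vadd, vscal; simpl.
  set (y1 := p1 + t * a). set (y2 := p2 + t * b).
  pose proof (is_derive_filterdiff (fun u w => f (u, w)) y1 y2
    (fun u w => pd i1 f (u, w)) (pd i2 f (y1, y2))) as H.
  assert (D : filterdiff (fun u : R * R => f (fst u, snd u)) (locally (y1, y2))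
      (fun u : R * R => plus (scal (fst u) (pd i1 f (y1, y2)))
                             (scal (snd u) (pd i2 f (y1, y2))))).
  { apply H.
    - apply filter_forall. intros [u w]. simpl.
      apply (Derive_correct (fun z => f (z, w))).
      exact (smooth_ex_pd f i1 Hf (u, w)).
    - apply (Derive_correct (fun z => f (y1, z))).
      exact (smooth_ex_pd f i2 Hf (y1, y2)).
    - apply continuous_ext with (f := pd i1 f); [now intros []|].
      apply (smooth_cont _ (smooth_pd f i1 Hf)). }
  assert (Dp : differentiable_pt_lim (fun u w => f (u, w)) y1 y2
                (pd i1 f (y1, y2)) (pd i2 f (y1, y2))).
  { apply filterdiff_differentiable_pt_lim. exact D. }
  apply is_derive_Reals.
  replace (a * pd i1 f (y1, y2) + b * pd i2 f (y1, y2)) with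
    (pd i1 f (y1, y2) * a + pd i2 f (y1, y2) * b) by ring.
  apply (derivable_pt_lim_comp_2d (fun u w => f (u, w))
           (fun t => p1 + t * a) (fun t => p2 + t * b)).
  - exact Dp.
  - apply is_derive_Reals. auto_derive; auto; ring.
  - apply is_derive_Reals. auto_derive; auto; ring.
Qed.

(** Real plane waves [a cos(k.x) + b sin(k.x)] form a family stable under
    differentiation, whence smoothness. *)
Definition wave (k : plane) (a b : R) (x : plane) : R :=
  a * cos (dot k x) + b * sin (dot k x).

Lemma cont_dot k : cont (dot k).
Proof.
  unfold dot. apply cont_plus; apply cont_mult; try apply cont_const.
  - intros x. apply continuous_fst.
  - intros x. apply continuous_snd.
Qed.

Lemma cont_wave k a b : cont (wave k a b).
Proof.
  apply cont_plus; apply cont_mult; try apply cont_const;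
    (apply cont_comp; [apply cont_dot|]); intros x.
  - apply continuous_cos.
  - apply continuous_sin.
Qed.

Lemma is_derive_wave i k a b x :
  is_derive (slice i (wave k a b) x) (coord i x)
    (wave k (coord i k * b) (- (coord i k * a)) x).
Proof.
  destruct x as [x1 x2], k as [k1 k2].
  unfold wave, dot; destruct i; simpl; auto_derive; auto; ring.
Qed.

Lemma pd_wave i k a b :
  pd i (wave k a b) = wave k (coord i k * b) (- (coord i k * a)).
Proof.
  fun_ext x.
  apply is_derive_unique, is_derive_wave.
Qed.

Lemma smooth_wave k a b : smooth (wave k a b).
Proof.
  intros n. revert a b. induction n as [|n IH]; intros a b;
    (split; [apply cont_wave|]); [exact I|].
  intros i. rewrite pd_wave. split; [|apply IH].
  intros x. eexists. apply is_derive_wave.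
Qed.

(** * Averages over the torus *)

Lemma Rint_unit_ex (g : R -> R) :
  (forall t, continuous g t) -> forall a b, ex_RInt g a b.
Proof.
  intros H a b. apply (ex_RInt_continuous (V := R_CompleteNormedModule)). auto.
Qed.

Lemma RInt_abs_le (g : R -> R) (M : R) :
  (forall t, continuous g t) -> (forall t, 0 <= t <= 1 -> Rabs (g t) <= M) ->
  Rabs (RInt g 0 1) <= M.
Proof.
  intros Hc HM.
  assert (H : Rabs (RInt g 0 1) <= (1 - 0) * M); [|lra].
  apply abs_RInt_le_const; [lra| |assumption].
  now apply Rint_unit_ex.
Qed.

(** Uniform continuity on a compact strip. *)
Lemma RInt_param_continuous (F : R -> R -> R) :
  (forall s t, continuity_2d_pt F s t) ->
  forall s, continuous (fun s => RInt (F s) 0 1) s.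
Proof.
  intros HF s.
  assert (Hc : forall u t, continuous (F u) t).
  { intros u t. pose proof (proj1 (continuity_2d_pt_filterlim F u t) (HF u t)) as H.
    apply (continuous_comp (fun t => (u, t)) (fun z => F (fst z) (snd z))).
    - apply (continuous_comp_2 (fun _ => u) (fun t => t) (fun a b => (a, b))).
      + apply continuous_const.
      + apply continuous_id.
      + apply continuous_ext with (f := fun z => z); [now intros []|].
        apply continuous_id.
    - exact H. }
  apply (proj2 (filterlim_locally _ _)). intros eps.
  destruct (uniform_continuity_2d F (s - 1) (s + 1) 0 1
              ltac:(intros; apply HF) (pos_div_2 eps)) as [d Hd].
  assert (Hm : 0 < Rmin d 1) by (apply Rmin_pos; [apply d|lra]).
  exists (mkposreal _ Hm). intros u Hu.
  change (Rabs (minus u s) < Rmin d 1) in Hu.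
  unfold minus, plus, opp in Hu; simpl in Hu.
  pose proof (Rmin_l d 1); pose proof (Rmin_r d 1).
  assert (Hu' : u + - s < 1 /\ - 1 < u + - s) by (apply Rabs_def2; lra).
  change (Rabs (minus (RInt (F u) 0 1) (RInt (F s) 0 1)) < eps).
  rewrite <- (RInt_minus (V := R_CompleteNormedModule)); try now apply Rint_unit_ex.
  apply Rle_lt_trans with (eps / 2); [|destruct eps; simpl; lra].
  apply RInt_abs_le.
  - intros t. apply (continuous_minus (V := R_NormedModule)); apply Hc.
  - intros t Ht. left. apply (Hd s t u t); try lra.
    + unfold Rminus in *. lra.
    + rewrite Rminus_eq_0, Rabs_R0. apply d.
Qed.

Lemma continuity_2d_pt_comp_plane (f : plane -> R) (p q r : plane) s t :
  cont f ->
  continuity_2d_pt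
    (fun s t => f (vadd p (vadd (vscal s q) (vscal t r)))) s t.
Proof.
  intros Hf. apply continuity_2d_pt_filterlim.
  apply (continuous_comp
    (fun z : R * R => vadd p (vadd (vscal (fst z) q) (vscal (snd z) r))) f);
    [|apply Hf].
  assert (A : forall a b c : R, forall z : R * R,
     continuous (fun z : R * R => a + (fst z * b + snd z * c)) z).
  { intros a b c. apply (cont_plus (fun _ => a)); [apply cont_const|].
    apply cont_plus; apply cont_mult; try apply cont_const; intros z;
      [apply continuous_fst|apply continuous_snd]. }
  apply (continuous_comp_2
    (fun z : R * R => fst p + (fst z * fst q + snd z * fst r))
    (fun z : R * R => snd p + (fst z * snd q + snd z * snd r))
    (fun a b => (a, b))); try apply A.
  apply continuous_ext with (f := fun z => z); [now intros []|].
  apply continuous_id.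
Qed.

(** Being a class, the torus with its spin structure is an implicit argument of
    everything below. *)
Class spin_torus : Type := SpinTorus {
  per1 : plane; per2 : plane; dual1 : plane; dual2 : plane;
  spin1 : bool; spin2 : bool;
  torus_dual : dual_basis per1 per2 dual1 dual2;
  torus_nontrivial : (spin1, spin2) <> (false, false) }.

Section Mean.
Context {X : spin_torus}.

Definition point (s t : R) : plane := vadd (vscal s per1) (vscal t per2).

(** The average over the fundamental parallelogram: [torus_int] without the
    area factor. *)
Definition mean (f : plane -> R) : R :=
  RInt (fun s => RInt (fun t => f (point s t)) 0 1) 0 1.

Lemma point_continuity f s t :
  cont f -> continuity_2d_pt (fun s t => f (point s t)) s t.
Proof.
  intros Hf.
  apply continuity_2d_pt_ext with
    (f := fun s t => f (vadd (0, 0) (point s t))).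
  - intros a b. apply (f_equal f). unfold point, vadd; simpl. f_equal; ring.
  - now apply continuity_2d_pt_comp_plane.
Qed.

Lemma continuity_2d_snd (F : R -> R -> R) s t :
  continuity_2d_pt F s t -> continuous (F s) t.
Proof.
  intros H. apply continuity_2d_pt_filterlim in H.
  apply (continuous_comp (fun t => (s, t)) (fun z => F (fst z) (snd z)));
    [|exact H].
  apply (continuous_comp_2 (fun _ => s) (fun t => t) (fun a b => (a, b))).
  - apply continuous_const.
  - apply continuous_id.
  - apply continuous_ext with (f := fun z => z); [now intros []|].
    apply continuous_id.
Qed.

Lemma mean_inner_cont f s t : cont f -> continuous (fun t => f (point s t)) t.
Proof.
  intros Hf. apply (continuity_2d_snd (fun s t => f (point s t))).
  now apply point_continuity.
Qed.

Lemma mean_outer_cont f s :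
  cont f -> continuous (fun s => RInt (fun t => f (point s t)) 0 1) s.
Proof.
  intros Hf. apply (RInt_param_continuous (fun s t => f (point s t))).
  intros; now apply point_continuity.
Qed.

Lemma mean_plus f g : cont f -> cont g ->
  mean (fun x => f x + g x) = mean f + mean g.
Proof.
  intros Hf Hg. unfold mean.
  rewrite <- (RInt_plus (V := R_CompleteNormedModule)).
  2, 3: apply Rint_unit_ex; intros; now apply mean_outer_cont.
  apply RInt_ext. intros s _.
  rewrite <- (RInt_plus (V := R_CompleteNormedModule)); [reflexivity| |];
    apply Rint_unit_ex; intros; now apply mean_inner_cont.
Qed.

Lemma mean_scal c f : cont f -> mean (fun x => c * f x) = c * mean f.
Proof.
  intros Hf. unfold mean.
  rewrite <- (RInt_scal (V := R_CompleteNormedModule)).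
  2: apply Rint_unit_ex; intros; now apply mean_outer_cont.
  apply RInt_ext. intros s _.
  rewrite <- (RInt_scal (V := R_CompleteNormedModule)); [reflexivity|];
    apply Rint_unit_ex; intros; now apply mean_inner_cont.
Qed.

Lemma mean_const c : mean (fun _ => c) = c.
Proof.
  unfold mean. rewrite (RInt_ext _ (fun _ => c)).
  - rewrite RInt_const. unfold scal; simpl; unfold mult; simpl. ring.
  - intros s _. rewrite RInt_const. unfold scal; simpl; unfold mult; simpl. ring.
Qed.

Lemma mean_opp f : cont f -> mean (fun x => - f x) = - mean f.
Proof.
  intros Hf. replace (- mean f) with (-1 * mean f) by ring.
  rewrite <- mean_scal by assumption. f_equal.
  fun_ext x; ring.
Qed.

Lemma mean_minus f g : cont f -> cont g ->
  mean (fun x => f x - g x) = mean f - mean g.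
Proof.
  intros Hf Hg. unfold Rminus. rewrite <- (mean_opp g) by assumption.
  apply mean_plus; [assumption|].
  apply (cont_comp Ropp); [assumption|].
  intros. apply (continuous_opp (V := R_NormedModule)), continuous_id.
Qed.

Lemma mean_ext f g : (forall x, f x = g x) -> mean f = mean g.
Proof.
  intros H. now replace g with f by now apply functional_extensionality.
Qed.

Lemma mean_le f g : cont f -> cont g -> (forall x, f x <= g x) ->
  mean f <= mean g.
Proof.
  intros Hf Hg H. unfold mean. apply RInt_le; [lra| | |].
  1, 2: apply Rint_unit_ex; intros; now apply mean_outer_cont.
  intros s _. apply RInt_le; [lra| | |auto].
  1, 2: apply Rint_unit_ex; intros; now apply mean_inner_cont.
Qed.

Lemma mean_ge0 f : cont f -> (forall x, 0 <= f x) -> 0 <= mean f.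
Proof.
  intros Hf H. rewrite <- (mean_const 0).
  apply mean_le; auto. apply cont_const.
Qed.

Lemma mean_pos f : cont f -> (forall x, 0 < f x) -> 0 < mean f.
Proof.
  intros Hf H. unfold mean. apply RInt_gt_0; [lra| |].
  - intros s _. apply RInt_gt_0; [lra|auto|].
    intros; now apply mean_inner_cont.
  - intros; now apply mean_outer_cont.
Qed.

(** ** Stokes' theorem *)

Lemma is_derive_point_fst f s t : smooth f ->
  is_derive (fun s => f (point s t)) s
    (fst per1 * pd i1 f (point s t) + snd per1 * pd i2 f (point s t)).
Proof.
  intros Hf.
  assert (E : forall s, vadd (vscal t per2) (vscal s per1) = point s t).
  { intros u. unfold point, vadd; simpl. f_equal; ring. }
  pose proof (is_derive_line f (vscal t per2) per1 s Hf) as H.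
  rewrite E in H. eapply is_derive_ext; [|exact H].
  intros u. simpl. now rewrite E.
Qed.

Lemma is_derive_point_snd f s t : smooth f ->
  is_derive (fun t => f (point s t)) t
    (fst per2 * pd i1 f (point s t) + snd per2 * pd i2 f (point s t)).
Proof. intros Hf. exact (is_derive_line f (vscal s per1) per2 t Hf). Qed.

Lemma cont_lin a b f g : cont f -> cont g -> cont (fun x => a * f x + b * g x).
Proof.
  intros Hf Hg. apply cont_plus; apply cont_mult; auto using cont_const.
Qed.

Lemma mean_derive_per2 f : smooth f -> periodic per1 per2 f ->
  mean (fun x => fst per2 * pd i1 f x + snd per2 * pd i2 f x) = 0.
Proof.
  intros Hf Hp. unfold mean.
  rewrite (RInt_ext _ (fun _ => 0)).
  { rewrite RInt_const. apply Rmult_0_r. }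
  intros s _.
  assert (C : cont (fun x => fst per2 * pd i1 f x + snd per2 * pd i2 f x)).
  { apply cont_lin; apply smooth_cont, smooth_pd, Hf. }
  rewrite (RInt_ext _ (Derive (fun t => f (point s t)))).
  2: { intros t _. symmetry. now apply is_derive_unique, is_derive_point_snd. }
  rewrite RInt_Derive.
  - replace (point s 1) with (vadd (point s 0) per2).
    + rewrite (proj2 (Hp _)). apply Rminus_eq_0.
    + unfold point, vadd; simpl. f_equal; ring.
  - intros t _. eexists. now apply is_derive_point_snd.
  - intros t _. apply continuous_ext with
      (f := fun t => fst per2 * pd i1 f (point s t) + snd per2 * pd i2 f (point s t)).
    + intros u. symmetry. now apply is_derive_unique, is_derive_point_snd.
    + now apply (mean_inner_cont _ s t C).
Qed.

(** Differentiating the inner integral under the integral sign avoids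
    exchanging the two integrations. *)
Lemma mean_derive_per1 f : smooth f -> periodic per1 per2 f ->
  mean (fun x => fst per1 * pd i1 f x + snd per1 * pd i2 f x) = 0.
Proof.
  intros Hf Hp. unfold mean.
  set (g := fun x => fst per1 * pd i1 f x + snd per1 * pd i2 f x).
  assert (C : cont g).
  { apply cont_lin; apply smooth_cont, smooth_pd, Hf. }
  assert (E : forall s t, Derive (fun s => f (point s t)) s = g (point s t)).
  { intros s t. now apply is_derive_unique, is_derive_point_fst. }
  assert (D : forall s, is_derive (fun s => RInt (fun t => f (point s t)) 0 1) s
                 (RInt (fun t => g (point s t)) 0 1)).
  { intros s.
    rewrite (RInt_ext _ (fun t => Derive (fun u => f (point u t)) s)).
    2: { intros t _. now rewrite E. }
    apply (is_derive_RInt_param (fun s t => f (point s t))).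
    - apply filter_forall. intros u t _. eexists. now apply is_derive_point_fst.
    - intros t _. apply continuity_2d_pt_ext with (f := fun u v => g (point u v)).
      + intros u v. now rewrite E.
      + now apply point_continuity.
    - apply filter_forall. intros u. apply Rint_unit_ex. intros t.
      now apply mean_inner_cont, smooth_cont. }
  rewrite (RInt_ext _ (Derive (fun s => RInt (fun t => f (point s t)) 0 1))).
  2: { intros s _. symmetry. apply is_derive_unique, D. }
  rewrite RInt_Derive.
  - apply Rminus_diag_eq, RInt_ext. intros t _.
    replace (point 1 t) with (vadd (point 0 t) per1).
    + apply Hp.
    + unfold point, vadd; simpl. f_equal; ring.
  - intros s _. eexists. apply D.
  - intros s _. apply continuous_ext with
      (f := fun s => RInt (fun t => g (point s t)) 0 1).
    + intros u. symmetry. apply is_derive_unique, D.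
    + now apply mean_outer_cont.
Qed.

Lemma det_periods :
  (fst per1 * snd per2 - snd per1 * fst per2) *
  (fst dual1 * snd dual2 - snd dual1 * fst dual2) = 1.
Proof.
  destruct torus_dual as (H11 & H12 & H21 & H22). unfold dot in *.
  replace 1 with (1 * 1 - 0 * 0) by ring.
  rewrite <- H11 at 1. rewrite <- H22 at 1. rewrite <- H12 at 1.
  rewrite <- H21 at 1. ring.
Qed.

(** The derivatives along the two periods have mean zero, and the periods span
    the plane. *)
Theorem mean_pd f i : smooth f -> periodic per1 per2 f -> mean (pd i f) = 0.
Proof.
  intros Hf Hp.
  pose proof (mean_derive_per1 f Hf Hp) as H1.
  pose proof (mean_derive_per2 f Hf Hp) as H2.
  pose proof (smooth_cont _ (smooth_pd f i1 Hf)).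
  pose proof (smooth_cont _ (smooth_pd f i2 Hf)).
  rewrite mean_plus in H1, H2 by (apply cont_mult; auto using cont_const).
  rewrite !mean_scal in H1, H2 by assumption.
  pose proof det_periods as Hd.
  set (A := mean (pd i1 f)) in *. set (B := mean (pd i2 f)) in *.
  set (d := fst per1 * snd per2 - snd per1 * fst per2) in *.
  assert (d <> 0) by (intros E; rewrite E in Hd; lra).
  destruct i; [change (A = 0)|change (B = 0)];
    apply Rmult_eq_reg_l with d; try assumption; unfold d.
  - transitivity (snd per2 * (fst per1 * A + snd per1 * B) -
                  snd per1 * (fst per2 * A + snd per2 * B)); [ring|].
    rewrite H1, H2. ring.
  - transitivity (fst per1 * (fst per2 * A + snd per2 * B) -
                  fst per2 * (fst per1 * A + snd per1 * B)); [ring|].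
    rewrite H1, H2. ring.
Qed.
End Mean.

(** * Complex functions and the operator [dz] *)

Ltac csolve := unfold Re, Im in *; apply injective_projections; simpl; ring.

Definition csmooth (f : plane -> C) : Prop :=
  smooth (fun x => Re (f x)) /\ smooth (fun x => Im (f x)).

(** The Cauchy-Riemann operator [i d/dx1 + d/dx2], that is [2i d/dz]: the flat
    Dirac operator maps [(a, b)] to [(- conj (dz (conj b)), dz a)]. *)
Definition dz (f : plane -> C) (x : plane) : C :=
  (Ci * cpd i1 f x + cpd i2 f x)%C.

Lemma csmooth_const c : csmooth (fun _ => c).
Proof. split; apply smooth_const. Qed.

Lemma csmooth_real f : smooth f -> csmooth (fun x => RtoC (f x)).
Proof. intros Hf; split; [exact Hf|exact (smooth_const 0)]. Qed.

Lemma csmooth_plus f g :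
  csmooth f -> csmooth g -> csmooth (fun x => (f x + g x)%C).
Proof. intros [] []; split; now apply smooth_plus. Qed.

Lemma csmooth_mult f g :
  csmooth f -> csmooth g -> csmooth (fun x => (f x * g x)%C).
Proof.
  intros [] []; split; simpl.
  - now apply smooth_minus; apply smooth_mult.
  - now apply smooth_plus; apply smooth_mult.
Qed.

Lemma csmooth_conj f : csmooth f -> csmooth (fun x => Cconj (f x)).
Proof. intros []; split; [assumption|now apply smooth_opp]. Qed.

Lemma csmooth_scal c f : csmooth f -> csmooth (fun x => (c * f x)%C).
Proof. intros H. apply csmooth_mult; [apply csmooth_const|exact H]. Qed.

Lemma cpd_plus i f g : csmooth f -> csmooth g ->
  cpd i (fun x => (f x + g x)%C) = fun x => (cpd i f x + cpd i g x)%C.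
Proof.
  intros [] []. fun_ext x.
  unfold cpd, Cplus, Re, Im; simpl.
  rewrite !pd_plus by (apply smooth_ex_pd; assumption). reflexivity.
Qed.

Lemma cpd_mult i f g : csmooth f -> csmooth g ->
  cpd i (fun x => (f x * g x)%C) =
  fun x => (cpd i f x * g x + f x * cpd i g x)%C.
Proof.
  intros [F1 F2] [G1 G2]. fun_ext x.
  unfold cpd, Cmult, Cplus, Re, Im in *; simpl.
  rewrite pd_minus by now apply smooth_mult.
  rewrite pd_plus by (apply smooth_ex_pd; now apply smooth_mult).
  rewrite !pd_mult by now apply smooth_ex_pd. csolve.
Qed.

Lemma csmooth_cpd i f : csmooth f -> csmooth (cpd i f).
Proof. intros []; split; now apply smooth_pd. Qed.

Lemma csmooth_dz f : csmooth f -> csmooth (dz f).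
Proof.
  intros H. apply csmooth_plus; [apply csmooth_scal|]; now apply csmooth_cpd.
Qed.

Lemma dz_plus f g : csmooth f -> csmooth g ->
  dz (fun x => (f x + g x)%C) = fun x => (dz f x + dz g x)%C.
Proof.
  intros Hf Hg. fun_ext x. unfold dz.
  rewrite !cpd_plus by assumption. ring.
Qed.

Lemma dz_mult f g : csmooth f -> csmooth g ->
  dz (fun x => (f x * g x)%C) =
  fun x => (dz f x * g x + f x * dz g x)%C.
Proof.
  intros Hf Hg. fun_ext x. unfold dz.
  rewrite !cpd_mult by assumption. ring.
Qed.

Lemma dz_const c : dz (fun _ => c) = fun _ => RtoC 0.
Proof.
  fun_ext x. unfold dz, cpd, Re, Im.
  rewrite !pd_const. csolve.
Qed.

Lemma dz_scal c f : csmooth f ->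
  dz (fun x => (c * f x)%C) = fun x => (c * dz f x)%C.
Proof.
  intros Hf. rewrite dz_mult by (try apply csmooth_const; exact Hf).
  fun_ext x. rewrite dz_const. ring.
Qed.

Section Twisted.
Context {X : spin_torus}.

Definition cperiodic (f : plane -> C) : Prop :=
  csmooth f /\ forall x, f (vadd x per1) = f x /\ f (vadd x per2) = f x.

(** The components of the spinor fields of the given spin structure. *)
Definition twisted (f : plane -> C) : Prop :=
  csmooth f /\
  forall x, f (vadd x per1) = (RtoC (spin_sign spin1) * f x)%C /\
            f (vadd x per2) = (RtoC (spin_sign spin2) * f x)%C.

Lemma twisted_plus f g :
  twisted f -> twisted g -> twisted (fun x => (f x + g x)%C).
Proof.
  intros [Sf Pf] [Sg Pg]; split; [now apply csmooth_plus|].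
  intros x. destruct (Pf x) as [-> ->], (Pg x) as [-> ->]. split; ring.
Qed.

Lemma twisted_scal c f : twisted f -> twisted (fun x => (c * f x)%C).
Proof.
  intros [Sf Pf]; split; [now apply csmooth_scal|].
  intros x. destruct (Pf x) as [-> ->]. split; ring.
Qed.

Lemma twisted_opp f : twisted f -> twisted (fun x => (- f x)%C).
Proof.
  intros H. replace (fun x => (- f x)%C) with (fun x => (RtoC (-1) * f x)%C).
  - now apply twisted_scal.
  - fun_ext x; csolve.
Qed.

Lemma twisted_minus f g :
  twisted f -> twisted g -> twisted (fun x => (f x - g x)%C).
Proof. intros Hf Hg. apply twisted_plus; [|apply twisted_opp]; assumption. Qed.

Lemma twisted_conj f : twisted f -> twisted (fun x => Cconj (f x)).
Proof.
  intros [Sf Pf]; split; [now apply csmooth_conj|].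
  intros x. destruct (Pf x) as [-> ->].
  split; csolve.
Qed.

Lemma twisted_mult g f :
  cperiodic g -> twisted f -> twisted (fun x => (g x * f x)%C).
Proof.
  intros [Sg Pg] [Sf Pf]; split; [now apply csmooth_mult|].
  intros x. destruct (Pf x) as [-> ->], (Pg x) as [-> ->]. split; ring.
Qed.

Lemma spin_sign_sq e : (RtoC (spin_sign e) * RtoC (spin_sign e))%C = RtoC 1.
Proof. destruct e; csolve. Qed.

Lemma twisted_mult_twisted f g :
  twisted f -> twisted g -> cperiodic (fun x => (f x * g x)%C).
Proof.
  intros [Sf Pf] [Sg Pg]; split; [now apply csmooth_mult|].
  intros x. destruct (Pf x) as [-> ->], (Pg x) as [-> ->].
  assert (E : forall s a b : C,
    (s * a * (s * b))%C = (s * s * (a * b))%C)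
    by (intros; ring).
  rewrite !E, !spin_sign_sq. split; ring.
Qed.

Lemma cperiodic_const c : cperiodic (fun _ => c).
Proof. split; [apply csmooth_const|auto]. Qed.

Lemma cperiodic_mult f g :
  cperiodic f -> cperiodic g -> cperiodic (fun x => (f x * g x)%C).
Proof.
  intros [Sf Pf] [Sg Pg]; split; [now apply csmooth_mult|].
  intros x. destruct (Pf x) as [-> ->], (Pg x) as [-> ->]. auto.
Qed.

Lemma cperiodic_conj f : cperiodic f -> cperiodic (fun x => Cconj (f x)).
Proof.
  intros [Sf Pf]; split; [now apply csmooth_conj|].
  intros x. destruct (Pf x) as [-> ->]. auto.
Qed.

Lemma cperiodic_real f :
  smooth f -> periodic per1 per2 f -> cperiodic (fun x => RtoC (f x)).
Proof.
  intros Hs Hp; split; [now apply csmooth_real|].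
  intros x. destruct (Hp x) as [-> ->]. auto.
Qed.

Lemma cpd_translate f i c v : csmooth f ->
  (forall x, f (vadd x v) = (RtoC c * f x)%C) ->
  forall x, cpd i f (vadd x v) = (RtoC c * cpd i f x)%C.
Proof.
  intros [S1 S2] H x. unfold cpd.
  rewrite (pd_translate (fun y => Re (f y)) i c v),
          (pd_translate (fun y => Im (f y)) i c v); try now apply smooth_ex_pd.
  - csolve.
  - intros y. rewrite H. unfold Re, Im; simpl. ring.
  - intros y. rewrite H. unfold Re, Im; simpl. ring.
Qed.

Lemma dz_translate f c v : csmooth f ->
  (forall x, f (vadd x v) = (RtoC c * f x)%C) ->
  forall x, dz f (vadd x v) = (RtoC c * dz f x)%C.
Proof.
  intros Hs H x. unfold dz. rewrite !(cpd_translate f _ c v) by assumption. ring.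
Qed.

Lemma twisted_dz f : twisted f -> twisted (dz f).
Proof.
  intros [Sf Pf]; split; [now apply csmooth_dz|].
  intros x; split; apply dz_translate; try assumption; intros; apply Pf.
Qed.

Lemma cperiodic_dz f : cperiodic f -> cperiodic (dz f).
Proof.
  intros [Sf Pf]; split; [now apply csmooth_dz|].
  intros x; split; rewrite (dz_translate f 1); [csolve|assumption| |csolve|assumption|];
    intros y; destruct (Pf y) as [E1 E2]; rewrite ?E1, ?E2; ring.
Qed.

(** ** The real inner product of twisted functions *)

Definition ccont (f : plane -> C) : Prop :=
  cont (fun x => Re (f x)) /\ cont (fun x => Im (f x)).

Lemma csmooth_ccont f : csmooth f -> ccont f.
Proof. intros []; split; now apply smooth_cont. Qed.

Lemma twisted_ccont f : twisted f -> ccont f.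
Proof. intros []; now apply csmooth_ccont. Qed.

Lemma cont_minus f g : cont f -> cont g -> cont (fun x => f x - g x).
Proof.
  intros Hf Hg. apply cont_plus; [exact Hf|].
  apply (cont_comp Ropp); [exact Hg|]. intros x.
  apply (continuous_opp (V := R_NormedModule)), continuous_id.
Qed.

Lemma cont_Re_mult f g : ccont f -> ccont g -> cont (fun x => Re (f x * g x)%C).
Proof.
  intros [] []. simpl. now apply cont_minus; apply cont_mult.
Qed.

Definition bil (f g : plane -> C) : R := mean (fun x => Re (f x * g x)%C).

(** The real part of the [L^2] product; working over the reals keeps every form
    symmetric, and makes complex conjugation a linear isometry. *)
Definition ip (f g : plane -> C) : R := bil f (fun x => Cconj (g x)).

Lemma ccont_conj f : ccont f -> ccont (fun x => Cconj (f x)).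
Proof.
  intros []; split; [assumption|]. simpl.
  apply (cont_comp Ropp); [assumption|]. intros x.
  apply (continuous_opp (V := R_NormedModule)), continuous_id.
Qed.

Lemma ccont_plus f g : ccont f -> ccont g -> ccont (fun x => (f x + g x)%C).
Proof. intros [] []; split; now apply cont_plus. Qed.

Lemma ccont_mult f g : ccont f -> ccont g -> ccont (fun x => (f x * g x)%C).
Proof.
  intros [] []; split; simpl.
  - now apply cont_minus; apply cont_mult.
  - now apply cont_plus; apply cont_mult.
Qed.

Lemma ccont_const c : ccont (fun _ => c).
Proof. split; apply cont_const. Qed.

Lemma ccont_scal c f : ccont f -> ccont (fun x => (c * f x)%C).
Proof. apply ccont_mult, ccont_const. Qed.

Lemma bil_sym f g : bil f g = bil g f.
Proof. apply mean_ext. intros x. unfold Re, Im; simpl. ring. Qed.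

Lemma ip_sym f g : ip f g = ip g f.
Proof. apply mean_ext. intros x. unfold Re, Im; simpl. ring. Qed.

Lemma bil_plus_l f g k : ccont f -> ccont g -> ccont k ->
  bil (fun x => (f x + g x)%C) k = bil f k + bil g k.
Proof.
  intros Hf Hg Hk. unfold bil. rewrite <- mean_plus by now apply cont_Re_mult.
  apply mean_ext. intros x. unfold Re, Im; simpl. ring.
Qed.

Lemma bil_scal_l a f k : ccont f -> ccont k ->
  bil (fun x => (RtoC a * f x)%C) k = a * bil f k.
Proof.
  intros Hf Hk. unfold bil. rewrite <- mean_scal by now apply cont_Re_mult.
  apply mean_ext. intros x. unfold Re, Im; simpl. ring.
Qed.

Lemma ip_plus_l f g k : ccont f -> ccont g -> ccont k ->
  ip (fun x => (f x + g x)%C) k = ip f k + ip g k.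
Proof. intros; apply bil_plus_l; auto using ccont_conj. Qed.

Lemma ip_scal_l a f k : ccont f -> ccont k ->
  ip (fun x => (RtoC a * f x)%C) k = a * ip f k.
Proof. intros; apply bil_scal_l; auto using ccont_conj. Qed.

Lemma ip_plus_r f g k : ccont f -> ccont g -> ccont k ->
  ip k (fun x => (f x + g x)%C) = ip k f + ip k g.
Proof. intros. rewrite !(ip_sym k). now apply ip_plus_l. Qed.

Lemma ip_scal_r a f k : ccont f -> ccont k ->
  ip k (fun x => (RtoC a * f x)%C) = a * ip k f.
Proof. intros. rewrite !(ip_sym k). now apply ip_scal_l. Qed.

Lemma ip_ge0 f : ccont f -> 0 <= ip f f.
Proof.
  intros Hf. apply mean_ge0.
  - apply cont_Re_mult; [|apply ccont_conj]; exact Hf.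
  - intros x. unfold Re, Im; simpl. nra.
Qed.

(** The signs of [f] and [g] cancel in the product, so that [dz (f * g)] has mean
    zero by Stokes' theorem. *)
Lemma bil_dz f g : twisted f -> twisted g -> bil (dz f) g = - bil f (dz g).
Proof.
  intros Hf Hg. pose proof (twisted_mult_twisted f g Hf Hg) as [[S1 S2] P].
  pose proof Hf as [Sf _]; pose proof Hg as [Sg _].
  apply Rplus_opp_r_uniq. unfold bil.
  rewrite <- mean_plus.
  2, 3: apply cont_Re_mult; apply csmooth_ccont; auto using csmooth_dz.
  rewrite (mean_ext _ (fun x => pd i2 (fun y => Re (f y * g y)%C) x
                        - pd i1 (fun y => Im (f y * g y)%C) x)).
  2: { intros x. pose proof (dz_mult f g Sf Sg) as E.
       apply (f_equal (fun F => Re (F x))) in E.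
       unfold dz at 1 in E. unfold cpd in E. simpl in E |- *.
       lra. }
  rewrite mean_minus by (apply smooth_cont, smooth_pd; assumption).
  rewrite !mean_pd; try assumption; [ring| |]; intros x;
    destruct (P x) as [E1 E2]; rewrite E1, E2; auto.
Qed.

(** ** Characters *)

(** [0, -1, 1, -2, 2, ...] *)
Definition nat_to_Z (i : nat) : Z :=
  if Nat.even i then Z.of_nat (Nat.div2 i) else (- Z.of_nat (Nat.div2 i) - 1)%Z.

Lemma nat_to_Z_cases i :
  (exists m, i = (2 * m)%nat /\ nat_to_Z i = Z.of_nat m) \/
  (exists m, i = (2 * m + 1)%nat /\ nat_to_Z i = (- Z.of_nat m - 1)%Z).
Proof.
  unfold nat_to_Z. destruct (Nat.even i) eqn:E.
  - left. exists (Nat.div2 i). split; [|reflexivity].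
    apply Nat.even_spec in E. destruct E as [m ->].
    now rewrite Nat.div2_double.
  - right. exists (Nat.div2 i). split; [|reflexivity].
    assert (O : Nat.odd i = true) by (unfold Nat.odd; now rewrite E).
    apply Nat.odd_spec in O. destruct O as [m ->].
    rewrite (Nat.add_1_r (2 * m)), Nat.div2_succ_double. lia.
Qed.

Lemma nat_to_Z_inj i j : nat_to_Z i = nat_to_Z j -> i = j.
Proof.
  destruct (nat_to_Z_cases i) as [[m [? E]]|[m [? E]]],
           (nat_to_Z_cases j) as [[p [? F]]|[p [? F]]];
    rewrite E, F; lia.
Qed.

Lemma nat_to_Z_surj k : exists i, nat_to_Z i = k.
Proof.
  destruct (Z_le_dec 0 k).
  - exists (2 * Z.to_nat k)%nat.
    destruct (nat_to_Z_cases (2 * Z.to_nat k)) as [[m [? E]]|[m [? E]]]; lia.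
  - exists (2 * Z.to_nat (- k - 1) + 1)%nat.
    destruct (nat_to_Z_cases (2 * Z.to_nat (- k - 1) + 1)) as [[m [? E]]|[m [? E]]]; lia.
Qed.

Lemma nat_to_Z_bounds i :
  (Z.of_nat i <= 2 * Z.abs (nat_to_Z i))%Z /\ (Z.abs (nat_to_Z i) <= Z.of_nat i)%Z.
Proof. destruct (nat_to_Z_cases i) as [[m [? E]]|[m [? E]]]; lia. Qed.

Definition odd_part (e : bool) (k : Z) : Z := (2 * k + (if e then 1 else 0))%Z.

Lemma odd_part_IZR e k : IZR (odd_part e k) = 2 * IZR k + eps e.
Proof. unfold odd_part. rewrite plus_IZR, mult_IZR. destruct e; simpl; ring. Qed.

(** The frequencies whose characters change sign along the periods as the spin
    structure prescribes. *)
Definition freqZ (k1 k2 : Z) : plane :=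
  vscal PI (vadd (vscal (IZR (odd_part spin1 k1)) dual1)
                 (vscal (IZR (odd_part spin2 k2)) dual2)).

(** A single index [n] for all characters lets Fourier series be ordinary series. *)
Definition index1 (n : nat) : Z := nat_to_Z (fst (Cantor.of_nat n)).
Definition index2 (n : nat) : Z := nat_to_Z (snd (Cantor.of_nat n)).
Definition freq (n : nat) : plane := freqZ (index1 n) (index2 n).

Lemma index_surj k1 k2 : exists n, index1 n = k1 /\ index2 n = k2.
Proof.
  destruct (nat_to_Z_surj k1) as [i Hi], (nat_to_Z_surj k2) as [j Hj].
  exists (Cantor.to_nat (i, j)). unfold index1, index2.
  rewrite Cantor.cancel_of_to. auto.
Qed.

Definition charac (k : plane) (x : plane) : C := (wave k 1 0 x, wave k 0 1 x).

Lemma csmooth_charac k : csmooth (charac k).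
Proof. split; apply smooth_wave. Qed.

(** The eigenvalue of [dz] on the character of frequency [k]. *)
Definition symbol (k : plane) : C := (- fst k, snd k).

Lemma dz_charac k x : dz (charac k) x = (symbol k * charac k x)%C.
Proof.
  unfold dz, cpd.
  change (fun y => Re (charac k y)) with (wave k 1 0).
  change (fun y => Im (charac k y)) with (wave k 0 1).
  rewrite !pd_wave. destruct k as [a b]. unfold charac, symbol, wave. csolve.
Qed.

Lemma charac_add k l x :
  charac (vadd k l) x = (charac k x * charac l x)%C.
Proof.
  unfold charac, wave.
  replace (dot (vadd k l) x) with (dot k x + dot l x)
    by (unfold dot, vadd; simpl; ring).
  rewrite cos_plus, sin_plus. csolve.
Qed.

Lemma charac_translate k x v :
  charac k (vadd x v) = (charac k v * charac k x)%C.
Proof.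
  unfold charac, wave.
  replace (dot k (vadd x v)) with (dot k x + dot k v)
    by (unfold dot, vadd; simpl; ring).
  rewrite cos_plus, sin_plus. csolve.
Qed.

Lemma charac_norm k x : (charac k x * Cconj (charac k x))%C = RtoC 1.
Proof.
  pose proof (sin2_cos2 (dot k x)) as H. unfold Rsqr in H.
  unfold charac, wave. apply injective_projections; simpl; [nra|ring].
Qed.

Lemma dot_freq1 k1 k2 : dot (freqZ k1 k2) per1 = PI * IZR (odd_part spin1 k1).
Proof.
  destruct torus_dual as (H11 & H12 & H21 & H22).
  unfold freqZ, dot, vscal, vadd in *; simpl.
  set (a := IZR (odd_part spin1 k1)). set (b := IZR (odd_part spin2 k2)).
  transitivity (PI * (a * (fst dual1 * fst per1 + snd dual1 * snd per1) +
                b * (fst dual2 * fst per1 + snd dual2 * snd per1))); [ring|].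
  rewrite H11, H21. ring.
Qed.

Lemma dot_freq2 k1 k2 : dot (freqZ k1 k2) per2 = PI * IZR (odd_part spin2 k2).
Proof.
  destruct torus_dual as (H11 & H12 & H21 & H22).
  unfold freqZ, dot, vscal, vadd in *; simpl.
  set (a := IZR (odd_part spin1 k1)). set (b := IZR (odd_part spin2 k2)).
  transitivity (PI * (a * (fst dual1 * fst per2 + snd dual1 * snd per2) +
                b * (fst dual2 * fst per2 + snd dual2 * snd per2))); [ring|].
  rewrite H12, H22. ring.
Qed.

Lemma cos_sin_odd_part e k :
  cos (PI * IZR (odd_part e k)) = spin_sign e /\
  sin (PI * IZR (odd_part e k)) = 0.
Proof.
  assert (S : sin (PI * IZR (odd_part e k)) = 0).
  { apply sin_eq_0_1. exists (odd_part e k). ring. }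
  split; [|exact S].
  assert (A : sin (PI * IZR k) = 0) by (apply sin_eq_0_1; exists k; ring).
  pose proof (sin2_cos2 (PI * IZR k)) as B. unfold Rsqr in B. rewrite A in B.
  rewrite odd_part_IZR.
  replace (PI * (2 * IZR k + eps e)) with (2 * (PI * IZR k) + PI * eps e) by ring.
  rewrite cos_plus, cos_2a, sin_2a, A.
  unfold eps, spin_sign; destruct e.
  - replace (PI * 1) with PI by ring. rewrite cos_PI, sin_PI. nra.
  - replace (PI * 0) with 0 by ring. rewrite cos_0, sin_0. nra.
Qed.

Lemma twisted_characZ k1 k2 : twisted (charac (freqZ k1 k2)).
Proof.
  split; [apply csmooth_charac|]. intros x. rewrite !charac_translate.
  destruct (cos_sin_odd_part spin1 k1) as [C1 S1].
  destruct (cos_sin_odd_part spin2 k2) as [C2 S2].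
  unfold charac at 1 4, wave. rewrite dot_freq1, dot_freq2, C1, C2, S1, S2.
  split; csolve.
Qed.

Definition chr (n : nat) : plane -> C := charac (freq n).
Definition sym (n : nat) : C := symbol (freq n).
Definition sym2 (n : nat) : R := normsq (freq n).

Lemma sym_sq n : (sym n * Cconj (sym n))%C = RtoC (sym2 n).
Proof. unfold sym, symbol, sym2, normsq, dot. csolve. Qed.

Lemma twisted_chr n : twisted (chr n).
Proof. apply twisted_characZ. Qed.

Lemma dz_chr n x : dz (chr n) x = (sym n * chr n x)%C.
Proof. apply dz_charac. Qed.

Lemma dot_sq_le x y : dot x y ^ 2 <= normsq x * normsq y.
Proof.
  unfold normsq, dot. destruct x as [a b], y as [c d]; simpl.
  pose proof (pow2_ge_0 (a * d - b * c)). nra.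
Qed.

Lemma freq_lower k1 k2 :
  PI ^ 2 * (IZR (odd_part spin1 k1) ^ 2 + IZR (odd_part spin2 k2) ^ 2) <=
  normsq (freqZ k1 k2) * (normsq per1 + normsq per2).
Proof.
  pose proof (dot_sq_le (freqZ k1 k2) per1) as H1.
  pose proof (dot_sq_le (freqZ k1 k2) per2) as H2.
  rewrite dot_freq1 in H1. rewrite dot_freq2 in H2. nra.
Qed.

(** A non-trivial spin structure makes one of the two integers odd, so that the
    frequency never vanishes; along the Cantor enumeration its square grows at
    least linearly. *)
Lemma odd_part_lower n :
  INR (S n) <= 50 * (IZR (odd_part spin1 (index1 n)) ^ 2 +
                     IZR (odd_part spin2 (index2 n)) ^ 2).
Proof.
  rewrite INR_IZR_INZ, !pow_IZR, <- plus_IZR, <- mult_IZR. apply IZR_le.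
  unfold index1, index2.
  pose proof (Cantor.cancel_to_of n) as En.
  destruct (Cantor.of_nat n) as [i j]. simpl fst; simpl snd.
  pose proof (Cantor.to_nat_spec i j) as Es. rewrite En in Es.
  destruct (nat_to_Z_bounds i) as [Bi _], (nat_to_Z_bounds j) as [Bj _].
  set (a := nat_to_Z i) in *. set (b := nat_to_Z j) in *.
  set (p := odd_part spin1 a). set (q := odd_part spin2 b).
  assert (Hp : (Z.of_nat i <= Z.abs p + 1)%Z)
    by (unfold p, odd_part; destruct spin1; lia).
  assert (Hq : (Z.of_nat j <= Z.abs q + 1)%Z)
    by (unfold q, odd_part; destruct spin2; lia).
  assert (H1 : (1 <= Z.abs p + Z.abs q)%Z).
  { pose proof torus_nontrivial as Hs.
    unfold p, q, odd_part. destruct spin1, spin2; try lia. now elim Hs. }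
  (* n is at most (i + j + 1)^2, with i <= |p| + 1, j <= |q| + 1 and
     |p| + |q| >= 1; the factor 50 leaves ample room. *)
  apply (f_equal Z.of_nat) in Es.
  rewrite Nat2Z.inj_add, !Nat2Z.inj_mul, (Nat2Z.inj_succ (j + i)), !Nat2Z.inj_add in Es.
  rewrite Nat2Z.inj_succ.
  replace (p ^ Z.of_nat 2)%Z with (Z.abs p * Z.abs p)%Z
    by (rewrite Z.abs_square; symmetry; apply Z.pow_2_r).
  replace (q ^ Z.of_nat 2)%Z with (Z.abs q * Z.abs q)%Z
    by (rewrite Z.abs_square; symmetry; apply Z.pow_2_r).
  set (u := Z.abs p) in *. set (w := Z.abs q) in *.
  set (m := (Z.of_nat j + Z.of_nat i)%Z) in *.
  assert (Hm : (0 <= m <= u + w + 2)%Z) by lia.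
  assert (Hw : (0 <= u /\ 0 <= w /\ Z.of_nat j <= w + 1)%Z) by lia.
  clearbody u w. clearbody m. clear Bi Bj Hp Hq a b p q En i.
  assert (Hn : (m * Z.succ m <= (u + w + 2) * (u + w + 3))%Z)
    by (apply Z.mul_le_mono_nonneg; lia).
  assert (Hs : (2 * (u * w) <= u * u + w * w)%Z)
    by (pose proof (Z.square_nonneg (u - w)); lia).
  assert (H0 : (0 <= (u + w - 1) * (u + w))%Z) by (apply Z.mul_nonneg_nonneg; lia).
  ring_simplify in Hn. ring_simplify in H0. ring_simplify.
  nia.
Qed.

Lemma normsq_ge0 x : 0 <= normsq x.
Proof. unfold normsq, dot. nra. Qed.

Lemma sym2_lower : exists c, 0 < c /\ forall n, c * INR (S n) <= sym2 n.
Proof.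
  pose proof PI_RGT_0 as HPI.
  assert (Hv : 0 < normsq per1 + normsq per2).
  { pose proof (freq_lower (index1 0) (index2 0)) as H.
    pose proof (odd_part_lower 0) as H0. simpl INR in H0.
    pose proof (normsq_ge0 per1). pose proof (normsq_ge0 per2).
    assert (0 < PI ^ 2) by now apply pow_lt.
    destruct (Rle_lt_or_eq_dec 0 (normsq per1 + normsq per2)) as [?|E];
      [lra|assumption|]. rewrite <- E in H. nra. }
  exists (PI ^ 2 / (50 * (normsq per1 + normsq per2))).
  split; [apply Rdiv_lt_0_compat; [now apply pow_lt|lra]|].
  intros n. pose proof (freq_lower (index1 n) (index2 n)) as H.
  pose proof (odd_part_lower n) as H0. fold (freq n) in H. fold (sym2 n) in H.
  set (Q := IZR (odd_part spin1 (index1 n)) ^ 2 +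
            IZR (odd_part spin2 (index2 n)) ^ 2) in *.
  apply Rmult_le_reg_r with (50 * (normsq per1 + normsq per2)); [lra|].
  replace (PI ^ 2 / (50 * (normsq per1 + normsq per2)) * INR (S n) *
    (50 * (normsq per1 + normsq per2))) with (PI ^ 2 * INR (S n))
    by (field; lra).
  assert (0 < PI ^ 2) by now apply pow_lt.
  nra.
Qed.

Lemma sym2_pos n : 0 < sym2 n.
Proof.
  destruct sym2_lower as [c [Hc H]]. eapply Rlt_le_trans; [|apply H].
  apply Rmult_lt_0_compat; [assumption|]. apply lt_0_INR. lia.
Qed.

Lemma sym_neq0 n : sym n <> RtoC 0.
Proof.
  intros E. pose proof (sym_sq n) as H. rewrite E in H.
  pose proof (sym2_pos n). apply (f_equal Re) in H. simpl in H. lra.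
Qed.

Lemma index_upper n :
  Rabs (IZR (odd_part spin1 (index1 n))) <= 3 * INR (S n) /\
  Rabs (IZR (odd_part spin2 (index2 n))) <= 3 * INR (S n).
Proof.
  rewrite INR_IZR_INZ, <- !abs_IZR, <- !mult_IZR.
  unfold index1, index2.
  pose proof (Cantor.cancel_to_of n) as En.
  destruct (Cantor.of_nat n) as [i j]. simpl fst; simpl snd.
  pose proof (Cantor.to_nat_non_decreasing i j) as Es. rewrite En in Es.
  destruct (nat_to_Z_bounds i) as [_ Bi], (nat_to_Z_bounds j) as [_ Bj].
  split; apply IZR_le; unfold odd_part; [destruct spin1|destruct spin2]; lia.
Qed.

Lemma freq_upper : exists M, 0 <= M /\ forall n i, Rabs (coord i (freq n)) <= M * INR (S n).
Proof.
  exists (PI * (3 * (Rabs (fst dual1) + Rabs (fst dual2) +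
                     Rabs (snd dual1) + Rabs (snd dual2)))).
  pose proof PI_RGT_0 as HPI.
  pose proof (Rabs_pos (fst dual1)); pose proof (Rabs_pos (fst dual2)).
  pose proof (Rabs_pos (snd dual1)); pose proof (Rabs_pos (snd dual2)).
  split; [nra|].
  intros n i. destruct (index_upper n) as [Ha Hb].
  unfold freq, freqZ.
  set (a := IZR (odd_part spin1 (index1 n))) in *.
  set (b := IZR (odd_part spin2 (index2 n))) in *.
  assert (A : forall u w U W : R, Rabs u <= U -> Rabs w <= W ->
    Rabs (PI * (a * u + b * w)) <= PI * (3 * (U + W)) * INR (S n)).
  { intros u w U W Hu Hw. rewrite Rabs_mult, (Rabs_right PI) by lra.
    rewrite !Rmult_assoc. apply Rmult_le_compat_l; [lra|].
    eapply Rle_trans; [apply Rabs_triang|]. rewrite !Rabs_mult.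
    pose proof (Rabs_pos u); pose proof (Rabs_pos w).
    pose proof (Rabs_pos a); pose proof (Rabs_pos b).
    assert (Rabs a * Rabs u <= 3 * INR (S n) * U) by (apply Rmult_le_compat; lra).
    assert (Rabs b * Rabs w <= 3 * INR (S n) * W) by (apply Rmult_le_compat; lra).
    lra. }
  destruct i; simpl coord.
  - replace (Rabs (fst dual1) + Rabs (fst dual2) + Rabs (snd dual1) +
       Rabs (snd dual2)) with ((Rabs (fst dual1) + Rabs (snd dual1)) +
       (Rabs (fst dual2) + Rabs (snd dual2))) by ring.
    apply A; lra.
  - replace (Rabs (fst dual1) + Rabs (fst dual2) + Rabs (snd dual1) +
       Rabs (snd dual2)) with ((Rabs (fst dual1) + Rabs (snd dual1)) +
       (Rabs (fst dual2) + Rabs (snd dual2))) by ring.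
    apply A; lra.
Qed.

(** Distinct characters have distinct eigenvalues under [dz], which will make
    them orthogonal. *)
Lemma sym_inj n m : sym n = sym m -> n = m.
Proof.
  intros E. unfold sym, symbol in E.
  pose proof (f_equal fst E) as E1. pose proof (f_equal snd E) as E2.
  cbn [fst snd] in E1, E2.
  assert (F : freq n = freq m).
  { apply injective_projections; [|exact E2].
    rewrite <- (Ropp_involutive (fst (freq n))), E1. apply Ropp_involutive. }
  pose proof (f_equal (fun k => dot k per1) F) as F1.
  pose proof (f_equal (fun k => dot k per2) F) as F2.
  cbn beta in F1, F2. unfold freq in F1, F2.
  rewrite !dot_freq1 in F1. rewrite !dot_freq2 in F2.
  pose proof PI_RGT_0.
  apply Rmult_eq_reg_l in F1; [|lra]. apply Rmult_eq_reg_l in F2; [|lra].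
  apply eq_IZR in F1. apply eq_IZR in F2. unfold odd_part in F1, F2.
  assert (G1 : index1 n = index1 m) by lia.
  assert (G2 : index2 n = index2 m) by lia.
  unfold index1, index2 in G1, G2.
  apply nat_to_Z_inj in G1. apply nat_to_Z_inj in G2.
  rewrite <- (Cantor.cancel_to_of n), <- (Cantor.cancel_to_of m).
  f_equal. now apply injective_projections.
Qed.
End Twisted.

(** * Fourier series *)

(** ** Series with terms of order [1/n^2] *)

Lemma Rplus_minus_telescope a b c : a - b + (b - c) = a - c.
Proof. ring. Qed.

Lemma is_series_telescope m :
  is_series (fun k => / INR (S (m + k)) - / INR (S (S (m + k)))) (/ INR (S m)).
Proof.
  assert (E : forall N, sum_n (fun k => / INR (S (m + k)) - / INR (S (S (m + k)))) N
              = / INR (S m) - / INR (S (S (m + N)))).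
  { induction N as [|N IH].
    - rewrite sum_O, Nat.add_0_r. reflexivity.
    - rewrite sum_Sn, IH, Nat.add_succ_r. apply Rplus_minus_telescope. }
  unfold is_series.
  apply (filterlim_ext (fun N => / INR (S m) - / INR (S (S (m + N))))).
  { intros N. now rewrite E. }
  change (is_lim_seq (fun N => / INR (S m) - / INR (S (S (m + N)))) (/ INR (S m))).
  replace (Finite (/ INR (S m))) with (Finite (/ INR (S m) - 0)) by (f_equal; ring).
  apply is_lim_seq_minus'; [apply is_lim_seq_const|].
  apply is_lim_seq_ext with (fun N => / INR (N + (m + 2))).
  { intros N. do 2 f_equal. lia. }
  apply (is_lim_seq_incr_n (fun N => / INR N) (m + 2)).
  apply (is_lim_seq_inv _ p_infty); [apply is_lim_seq_INR|discriminate].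
Qed.

Lemma ex_series_telescope c m :
  ex_series (fun k => c * (/ INR (S (m + k)) - / INR (S (S (m + k))))).
Proof.
  apply (ex_series_scal_l (V := R_NormedModule) c
    (fun k => / INR (S (m + k)) - / INR (S (S (m + k))))).
  eexists. apply is_series_telescope.
Qed.

(** Comparison with a telescoping series gives tails of explicit size. *)
Lemma inv_sq_le_telescope n :
  / INR (S n) ^ 2 <= 2 * (/ INR (S n) - / INR (S (S n))).
Proof.
  rewrite (S_INR (S n)). pose proof (lt_0_INR (S n) (Nat.lt_0_succ n)) as H.
  assert (H1 : 1 <= INR (S n)) by (apply (le_INR 1); lia).
  set (x := INR (S n)) in *.
  replace (2 * (/ x - / (x + 1))) with (/ x ^ 2 * (2 * x / (x + 1))) by (field; lra).
  rewrite <- (Rmult_1_r (/ x ^ 2)) at 1.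
  apply Rmult_le_compat_l.
  - left. apply Rinv_0_lt_compat, pow_lt; lra.
  - apply Rmult_le_reg_r with (x + 1); [lra|].
    replace (2 * x / (x + 1) * (x + 1)) with (2 * x) by (field; lra). lra.
Qed.

Section QuadraticDecay.
Variables (u : nat -> R) (M : R).
Hypothesis Hu : forall n, Rabs (u n) * INR (S n) ^ 2 <= M.

Lemma decay_le_telescope n :
  Rabs (u n) <= 2 * M * (/ INR (S n) - / INR (S (S n))).
Proof.
  pose proof (Hu n) as H. pose proof (Rabs_pos (u n)) as H0.
  pose proof (lt_0_INR (S n) (Nat.lt_0_succ n)) as Hp.
  assert (Hq : 0 < INR (S n) ^ 2) by now apply pow_lt.
  assert (HM : 0 <= M) by (eapply Rle_trans; [|exact H]; nra).
  apply Rle_trans with (M * / INR (S n) ^ 2).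
  - apply Rmult_le_reg_r with (INR (S n) ^ 2); [assumption|].
    rewrite Rmult_assoc, Rinv_l; lra.
  - rewrite (Rmult_comm 2 M), Rmult_assoc.
    apply Rmult_le_compat_l; [assumption|]. apply inv_sq_le_telescope.
Qed.

Lemma ex_series_shift m : ex_series (fun k => Rabs (u (m + k))).
Proof.
  apply (ex_series_le (V := R_CompleteNormedModule) _
    (fun k => 2 * M * (/ INR (S (m + k)) - / INR (S (S (m + k)))))).
  - intros k. unfold norm; simpl. unfold abs; simpl. rewrite Rabs_Rabsolu.
    apply decay_le_telescope.
  - apply ex_series_telescope.
Qed.

Lemma ex_series_decay : ex_series u.
Proof. apply ex_series_Rabs, (ex_series_shift 0). Qed.

Lemma series_tail_decay N :
  Rabs (Series u - sum_n u N) <= 2 * M * / INR (S (S N)).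
Proof.
  rewrite (Series_incr_n u (S N)); [|lia|apply ex_series_decay].
  simpl pred. rewrite <- sum_n_Reals.
  replace (sum_n u N + Series (fun k => u (S N + k)%nat) - sum_n u N)
    with (Series (fun k => u (S N + k)%nat)) by ring.
  eapply Rle_trans; [apply Series_Rabs, ex_series_shift|].
  rewrite <- (is_series_unique _ _ (is_series_telescope (S N))), <- Series_scal_l.
  apply Series_le.
  - intros k. split; [apply Rabs_pos|]. apply decay_le_telescope.
  - apply ex_series_telescope.
Qed.
End QuadraticDecay.

(** ** Smoothness of Fourier series *)

Lemma cont_uniform_limit F :
  (forall e, 0 < e -> exists G, cont G /\ forall x, Rabs (F x - G x) <= e) ->
  cont F.
Proof.
  intros H x. apply (proj2 (filterlim_locally _ _)). intros eps.
  destruct (H (eps / 4)) as [G [HG HF]].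
  { apply Rdiv_lt_0_compat; [apply eps|lra]. }
  assert (He : 0 < eps / 4) by (apply Rdiv_lt_0_compat; [apply eps|lra]).
  pose proof (proj1 (filterlim_locally _ _) (HG x) (mkposreal _ He)) as L.
  revert L. apply filter_imp. intros y Hy.
  change (Rabs (G y - G x) < eps / 4) in Hy.
  change (Rabs (F y - F x) < eps).
  pose proof (HF x) as H1. pose proof (HF y) as H2.
  apply Rabs_def2 in Hy. apply Rabs_le_between in H1. apply Rabs_le_between in H2.
  pose proof (cond_pos eps). apply Rabs_def1; lra.
Qed.

(** Faster decay than any power: the property that characterises the Fourier
    coefficients of smooth functions. *)
Definition rapid (a : nat -> R) : Prop :=
  forall p : nat, exists M, forall n, Rabs (a n) * INR (S n) ^ p <= M.

Lemma rapid_opp a : rapid a -> rapid (fun n => - a n).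
Proof.
  intros H p. destruct (H p) as [M HM]. exists M. intros n.
  now rewrite Rabs_Ropp.
Qed.

(** A multiplier of polynomial growth preserves rapid decay. *)
Lemma rapid_mult q M a :
  (forall n, Rabs (q n) <= M * INR (S n)) -> rapid a -> rapid (fun n => q n * a n).
Proof.
  intros Hq Ha p. destruct (Ha (S p)) as [N HN].
  exists (M * N). intros n. specialize (HN n). specialize (Hq n).
  rewrite Rabs_mult. simpl in HN.
  pose proof (lt_0_INR (S n) (Nat.lt_0_succ n)) as Hp.
  assert (HM : 0 <= M).
  { apply Rmult_le_reg_r with (INR (S n)); [assumption|].
    rewrite Rmult_0_l. eapply Rle_trans; [apply Rabs_pos|eassumption]. }
  assert (0 <= INR (S n) ^ p) by (apply pow_le; lra).
  apply Rle_trans with (M * INR (S n) * Rabs (a n) * INR (S n) ^ p).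
  - apply Rmult_le_compat_r; [assumption|].
    apply Rmult_le_compat_r; [apply Rabs_pos|assumption].
  - replace (M * INR (S n) * Rabs (a n) * INR (S n) ^ p) with
      (M * (Rabs (a n) * (INR (S n) * INR (S n) ^ p))) by ring.
    now apply Rmult_le_compat_l.
Qed.

Lemma wave_bound k a b x : Rabs (wave k a b x) <= Rabs a + Rabs b.
Proof.
  unfold wave. eapply Rle_trans; [apply Rabs_triang|]. rewrite !Rabs_mult.
  pose proof (COS_bound (dot k x)). pose proof (SIN_bound (dot k x)).
  assert (Rabs (cos (dot k x)) <= 1) by (apply Rabs_le; lra).
  assert (Rabs (sin (dot k x)) <= 1) by (apply Rabs_le; lra).
  pose proof (Rabs_pos a). pose proof (Rabs_pos b). nra.
Qed.

Section Fourier.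
Context {X : spin_torus}.

Definition wave_sum (a b : nat -> R) (n : nat) (x : plane) : R :=
  sum_n (fun k => wave (freq k) (a k) (b k) x) n.

Definition wave_series (a b : nat -> R) (x : plane) : R :=
  Series (fun n => wave (freq n) (a n) (b n) x).

Lemma wave_decay a b : rapid a -> rapid b ->
  exists M, forall x n, Rabs (wave (freq n) (a n) (b n) x) * INR (S n) ^ 2 <= M.
Proof.
  intros Ha Hb. destruct (Ha 2%nat) as [M HM], (Hb 2%nat) as [N HN].
  exists (M + N). intros x n. specialize (HM n). specialize (HN n).
  pose proof (wave_bound (freq n) (a n) (b n) x).
  assert (0 <= INR (S n) ^ 2) by apply pow_le, pos_INR. nra.
Qed.

Lemma inv_INR_small M e : 0 < e -> exists N, forall n, (N <= n)%nat ->
  M * / INR (S n) <= e.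
Proof.
  intros He. destruct (nfloor_ex (Rabs M / e)) as [N HN].
  { apply Rdiv_le_0_compat; [apply Rabs_pos|assumption]. }
  exists N. intros n Hn.
  pose proof (lt_0_INR (S n) (Nat.lt_0_succ n)) as Hp.
  apply Rmult_le_reg_r with (INR (S n)); [assumption|].
  rewrite Rmult_assoc, Rinv_l, Rmult_1_r by lra.
  assert (HN' : INR N + 1 <= INR (S n)) by (rewrite <- S_INR; apply le_INR; lia).
  assert (Rabs M <= e * INR (S n)).
  { apply Rmult_le_reg_r with (/ e); [now apply Rinv_0_lt_compat|].
    replace (e * INR (S n) * / e) with (INR (S n)) by (field; lra).
    unfold Rdiv in HN. lra. }
  pose proof (Rle_abs M). lra.
Qed.

Lemma wave_series_uniform a b e : rapid a -> rapid b -> 0 < e ->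
  exists N, forall n, (N <= n)%nat -> forall x,
    Rabs (wave_series a b x - wave_sum a b n x) <= e.
Proof.
  intros Ha Hb He. destruct (wave_decay a b Ha Hb) as [M HM].
  destruct (inv_INR_small (2 * M) e He) as [N HN].
  exists N. intros n Hn x. eapply Rle_trans.
  - apply (series_tail_decay _ M). intros k. apply HM.
  - apply HN. lia.
Qed.

Lemma cont_wave_sum a b n : cont (wave_sum a b n).
Proof.
  unfold wave_sum. induction n as [|n IH]; intros x.
  - apply continuous_ext with (f := wave (freq 0) (a 0%nat) (b 0%nat)).
    + intros y. now rewrite sum_O.
    + apply cont_wave.
  - apply continuous_ext with
      (f := fun x => wave_sum a b n x + wave (freq (S n)) (a (S n)) (b (S n)) x).
    + intros y. unfold wave_sum. now rewrite sum_Sn.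
    + apply cont_plus; [exact IH|apply cont_wave].
Qed.

Lemma cont_wave_series a b : rapid a -> rapid b -> cont (wave_series a b).
Proof.
  intros Ha Hb. apply cont_uniform_limit. intros e He.
  destruct (wave_series_uniform a b e Ha Hb He) as [N HN].
  exists (wave_sum a b N). split; [apply cont_wave_sum|]. intros x. now apply HN.
Qed.

Definition at_coord (i : idx) (x : plane) (t : R) : plane :=
  match i with i1 => (t, snd x) | i2 => (fst x, t) end.

Lemma slice_at_coord {T} i (f : plane -> T) x : slice i f x = fun t => f (at_coord i x t).
Proof. destruct i; reflexivity. Qed.

Lemma at_coord_self i x : at_coord i x (coord i x) = x.
Proof. destruct x, i; reflexivity. Qed.

Definition times_freq (i : idx) (a : nat -> R) (n : nat) : R := coord i (freq n) * a n.
Definition times_freq_opp (i : idx) (a : nat -> R) (n : nat) : R := - times_freq i a n.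

Lemma rapid_times_freq i a : rapid a -> rapid (times_freq i a).
Proof.
  destruct freq_upper as [M [_ HM]]. apply (rapid_mult _ M). intros; apply HM.
Qed.

Lemma rapid_times_freq_opp i a : rapid a -> rapid (times_freq_opp i a).
Proof. intros Ha. now apply rapid_opp, rapid_times_freq. Qed.

Lemma is_derive_wave_sum i a b x n t :
  is_derive (fun t => wave_sum a b n (at_coord i x t)) t
    (wave_sum (times_freq i b) (times_freq_opp i a) n (at_coord i x t)).
Proof.
  apply (is_derive_sum_n (V := R_NormedModule)
     (fun k t => wave (freq k) (a k) (b k) (at_coord i x t))).
  intros k _. pose proof (is_derive_wave i (freq k) (a k) (b k) (at_coord i x t)) as H.
  rewrite slice_at_coord in H.
  replace (coord i (at_coord i x t)) with t in H by now destruct i.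
  eapply is_derive_ext; [|exact H]. intros s. now destruct i.
Qed.

(** The differentiated series again has rapidly decaying coefficients, so it
    converges uniformly and termwise differentiation is legitimate. *)
Lemma is_derive_wave_series i a b x : rapid a -> rapid b ->
  is_derive (slice i (wave_series a b) x) (coord i x)
   (wave_series (times_freq i b) (times_freq_opp i a) x).
Proof.
  intros Ha Hb.
  pose proof (rapid_times_freq i b Hb) as Ha'.
  pose proof (rapid_times_freq_opp i a Ha) as Hb'.
  set (fn := fun n t => wave_sum a b n (at_coord i x t)).
  assert (E : forall n t, Derive (fn n) t =
    wave_sum (times_freq i b) (times_freq_opp i a) n (at_coord i x t)).
  { intros n t. apply is_derive_unique, is_derive_wave_sum. }
  rewrite slice_at_coord.
  assert (L : real (Lim_seq (fun n => Derive (fn n) (coord i x))) =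
    wave_series (times_freq i b) (times_freq_opp i a) x).
  { unfold wave_series, Series. f_equal. apply Lim_seq_ext. intros n.
    rewrite E, at_coord_self. reflexivity. }
  rewrite <- L.
  assert (U : forall c d, rapid c -> rapid d ->
    CVU_dom (fun n t => wave_sum c d n (at_coord i x t)) (fun _ => True)).
  { intros c d Hc Hd eps.
    assert (He : 0 < eps / 2) by (apply Rdiv_lt_0_compat; [apply eps|lra]).
    destruct (wave_series_uniform c d (eps / 2) Hc Hd He) as [N HN].
    exists N. intros n Hn t _. specialize (HN n Hn (at_coord i x t)).
    rewrite Rabs_minus_sym. eapply Rle_lt_trans; [exact HN|].
    pose proof (cond_pos eps). lra. }
  apply (CVU_Derive fn (fun _ => True)).
  - apply open_true.
  - intros ?; auto.
  - now apply U.
  - intros n t _. eexists. apply is_derive_wave_sum.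
  - intros n t _. apply continuity_pt_filterlim.
    set (dfn := fun t => wave_sum (times_freq i b) (times_freq_opp i a) n (at_coord i x t)).
    apply (filterlim_ext dfn); [intros s; now rewrite E|].
    rewrite E. apply (ex_derive_continuous (V := R_NormedModule) dfn).
    eexists. apply is_derive_wave_sum.
  - intros eps. destruct (U _ _ Ha' Hb' eps) as [N HN]. exists N.
    intros n Hn t _. specialize (HN n Hn t I).
    rewrite E. rewrite (Lim_seq_ext _ _ (fun n => E n t)). exact HN.
  - exact I.
Qed.

Lemma smooth_wave_series a b : rapid a -> rapid b -> smooth (wave_series a b).
Proof.
  intros Ha Hb n. revert a b Ha Hb. induction n as [|n IH]; intros a b Ha Hb;
    (split; [now apply cont_wave_series|]); [exact I|].
  intros i.
  replace (pd i (wave_series a b)) with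
    (wave_series (times_freq i b) (times_freq_opp i a)).
  - split; [|apply IH; auto using rapid_times_freq, rapid_times_freq_opp].
    intros x. eexists. now apply is_derive_wave_series.
  - fun_ext x. symmetry. now apply is_derive_unique, is_derive_wave_series.
Qed.
End Fourier.

(** ** Approximate identities *)

(** Powers of this trigonometric polynomial concentrate at the integers. *)
Definition bump (t : R) : R := (1 + cos (2 * PI * t)) / 2.

Lemma bump_ge0 t : 0 <= bump t.
Proof. unfold bump. pose proof (COS_bound (2 * PI * t)). lra. Qed.

Lemma bump_abs t : bump (Rabs t) = bump t.
Proof.
  unfold bump, Rabs. destruct (Rcase_abs t); [|reflexivity].
  replace (2 * PI * - t) with (- (2 * PI * t)) by ring. now rewrite cos_neg.
Qed.

Lemma bump_decr s t : 0 <= s -> s <= t -> t <= / 2 -> bump t <= bump s.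
Proof.
  intros H1 H2 H3. pose proof PI_RGT_0. unfold bump.
  assert (cos (2 * PI * t) <= cos (2 * PI * s)); [|lra].
  apply cos_decr_1; nra.
Qed.

Lemma bump_decr_strict s t : 0 <= s -> s < t -> t <= / 2 -> bump t < bump s.
Proof.
  intros H1 H2 H3. pose proof PI_RGT_0. unfold bump.
  assert (cos (2 * PI * t) < cos (2 * PI * s)); [|lra].
  apply cos_decreasing_1; nra.
Qed.

Lemma bump_periodic t : bump (t + 1) = bump t.
Proof.
  unfold bump. replace (2 * PI * (t + 1)) with (2 * PI * t + 2 * PI) by ring.
  now rewrite cos_plus, cos_2PI, sin_2PI, Rmult_0_r, Rmult_1_r, Rminus_0_r.
Qed.

Lemma continuous_pow (g : R -> R) n t :
  continuous g t -> continuous (fun t => g t ^ n) t.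
Proof.
  intros H. induction n as [|n IH]; simpl; [apply continuous_const|].
  now apply (continuous_mult (K := R_AbsRing)).
Qed.

Lemma continuous_bump_pow t0 n t : continuous (fun t => bump (t - t0) ^ n) t.
Proof.
  apply continuous_pow. apply (ex_derive_continuous (V := R_NormedModule)).
  unfold bump. auto_derive. exact I.
Qed.

Lemma RInt_periodic_shift (g : R -> R) b :
  (forall t, continuous g t) -> (forall t, g (t + 1) = g t) ->
  RInt g b (b + 1) = RInt g 0 1.
Proof.
  intros Hc Hp.
  pose proof (Rint_unit_ex g Hc) as He.
  assert (E : RInt g 1 (b + 1) = RInt g 0 b).
  { pose proof (RInt_comp_lin (V := R_CompleteNormedModule) g 1 1 0 b) as H.
    replace (1 * 0 + 1) with 1 in H by ring.
    replace (1 * b + 1) with (b + 1) in H by ring.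
    rewrite <- H by apply He. apply RInt_ext. intros t _.
    unfold scal; simpl; unfold mult; simpl.
    rewrite !Rmult_1_l. apply Hp. }
  pose proof (RInt_Chasles (V := R_CompleteNormedModule) g 0 b (b + 1)
    (He _ _) (He _ _)) as C1.
  pose proof (RInt_Chasles (V := R_CompleteNormedModule) g 0 1 (b + 1)
    (He _ _) (He _ _)) as C2.
  unfold plus in *; simpl in *. lra.
Qed.

(** Were [g t0] positive, the integral near [t0] would be of order [q^n], with
    [q] the value of the bump halfway to the edge of a neighbourhood where [g]
    is positive, and would beat the rest, of order [r^n] with [r < q]. *)
Lemma bump_concentrates_pos (g : R -> R) t0 :
  (forall t, continuous g t) -> (forall t, g (t + 1) = g t) ->
  (forall n, RInt (fun t => bump (t - t0) ^ n * g t) 0 1 = 0) ->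
  g t0 <= 0.
Proof.
  intros Hc Hp Hn. apply Rnot_lt_le. intros Ha. set (a := g t0) in *.
  assert (Ha2 : 0 < a / 2) by lra.
  destruct (proj1 (filterlim_locally _ _) (Hc t0) (mkposreal _ Ha2)) as [d0 Hd0].
  set (d := Rmin (d0 / 2) (/ 2)).
  assert (Hd : 0 < d) by (apply Rmin_pos; [destruct d0; simpl; lra|lra]).
  assert (Hdl : d <= d0 / 2) by apply Rmin_l.
  assert (Hdr : d <= / 2) by apply Rmin_r.
  assert (Hg : forall t, Rabs (t - t0) <= d -> a / 2 <= g t).
  { intros t Ht. assert (B : Rabs (g t - a) < a / 2).
    { apply (Hd0 t). change (Rabs (t - t0) < d0). destruct d0; simpl in *; lra. }
    apply Rabs_def2 in B. lra. }
  destruct (continuity_ab_min g (t0 - / 2) (t0 - / 2 + 1)) as [m [Hm _]].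
  { lra. }
  { intros t _. apply continuity_pt_filterlim, Hc. }
  set (M := Rabs (g m)).
  assert (HM : forall t, t0 - / 2 <= t <= t0 - / 2 + 1 -> - M <= g t).
  { intros t Ht. specialize (Hm t Ht). pose proof (Rabs_maj2 (g m)). unfold M. lra. }
  assert (HM0 : 0 <= M) by apply Rabs_pos.
  set (r := bump d). set (q := bump (d / 2)).
  assert (Hr : 0 <= r) by apply bump_ge0.
  assert (Hq : r < q) by (apply bump_decr_strict; lra).
  (* Far from t0 the integrand is at least - M r^n, near t0 at least
     (a/2) bump^n; both are bounded below by one expression. *)
  assert (K : forall n, (d / 2) * q ^ n * (a / 2) <= (a / 2 + M) * r ^ n).
  { intros n. set (Q := fun t => bump (t - t0) ^ n).
    assert (CQ : forall t, continuous Q t) by apply continuous_bump_pow.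
    assert (EQ : forall x y, ex_RInt Q x y) by now apply Rint_unit_ex.
    assert (Z : RInt (fun t => Q t * g t) (t0 - / 2) (t0 - / 2 + 1) = 0).
    { rewrite RInt_periodic_shift; [apply Hn| |].
      - intros t. now apply (continuous_mult (K := R_AbsRing)).
      - intros t. unfold Q. rewrite Hp.
        replace (t + 1 - t0) with (t - t0 + 1) by ring. now rewrite bump_periodic. }
    assert (L : (a / 2) * RInt Q (t0 - / 2) (t0 - / 2 + 1) - (a / 2 + M) * r ^ n <= 0).
    { rewrite <- Z.
      replace ((a / 2) * RInt Q (t0 - / 2) (t0 - / 2 + 1) - (a / 2 + M) * r ^ n)
        with (RInt (fun t => (a / 2) * Q t - (a / 2 + M) * r ^ n) (t0 - / 2) (t0 - / 2 + 1)).
      2: { rewrite (RInt_minus (V := R_CompleteNormedModule) (fun t => (a / 2) * Q t)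
             (fun _ => (a / 2 + M) * r ^ n)).
           - rewrite RInt_const.
             rewrite (RInt_scal (V := R_CompleteNormedModule) Q); [|apply EQ].
             unfold minus, plus, opp, scal; simpl; unfold mult; simpl. ring.
           - apply (ex_RInt_scal (V := R_NormedModule) Q), EQ.
           - apply ex_RInt_const. }
      apply RInt_le; [lra| | |].
      - apply (ex_RInt_minus (V := R_NormedModule) (fun t => (a / 2) * Q t)).
        + apply (ex_RInt_scal (V := R_NormedModule) Q), EQ.
        + apply ex_RInt_const.
      - apply Rint_unit_ex. intros t. now apply (continuous_mult (K := R_AbsRing)).
      - intros t Ht. specialize (HM t ltac:(lra)).
        assert (P : 0 <= Q t) by apply pow_le, bump_ge0.
        assert (Rn : 0 <= r ^ n) by now apply pow_le.
        destruct (Rle_dec (Rabs (t - t0)) d) as [Hin|Hout].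
        + specialize (Hg t Hin). nra.
        + assert (Q t <= r ^ n).
          { apply pow_incr. split; [apply bump_ge0|]. rewrite <- bump_abs.
            apply bump_decr; [lra|lra|]. apply Rabs_le. lra. }
          nra. }
    assert (I : (d / 2) * q ^ n <= RInt Q (t0 - / 2) (t0 - / 2 + 1)).
    { rewrite <- (RInt_Chasles (V := R_CompleteNormedModule) Q (t0 - / 2) t0) by apply EQ.
      rewrite <- (RInt_Chasles (V := R_CompleteNormedModule) Q t0 (t0 + d / 2)) by apply EQ.
      assert (N : forall x y, x <= y -> 0 <= RInt Q x y).
      { intros x y Hxy. apply RInt_ge_0; [assumption|apply EQ|].
        intros t _. apply pow_le, bump_ge0. }
      pose proof (N (t0 - / 2) t0 ltac:(lra)).
      pose proof (N (t0 + d / 2) (t0 - / 2 + 1) ltac:(lra)).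
      assert ((d / 2) * q ^ n <= RInt Q t0 (t0 + d / 2)).
      { replace ((d / 2) * q ^ n) with (RInt (fun _ => q ^ n) t0 (t0 + d / 2)).
        2: { rewrite RInt_const. unfold scal; simpl; unfold mult; simpl. ring. }
        apply RInt_le; [lra|apply ex_RInt_const|apply EQ|].
        intros t Ht. apply pow_incr. split; [apply bump_ge0|].
        apply bump_decr; lra. }
      unfold plus; simpl. lra. }
    nra. }
  assert (Hqp : 0 < q) by lra.
  assert (Hx : Rabs (r / q) < 1).
  { rewrite Rabs_right.
    - apply Rmult_lt_reg_r with q; [assumption|].
      unfold Rdiv. rewrite Rmult_assoc, Rinv_l by lra. lra.
    - apply Rle_ge, Rdiv_le_0_compat; assumption. }
  set (y := (d / 2) * (a / 2) / (a / 2 + M)).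
  assert (Hy : 0 < y) by (apply Rdiv_lt_0_compat; nra).
  destruct (pow_lt_1_zero (r / q) Hx y Hy) as [N HN].
  specialize (HN N (le_n N)). specialize (K N).
  assert (Hqn : 0 < q ^ N) by now apply pow_lt.
  rewrite Rabs_right in HN.
  2: { apply Rle_ge, pow_le, Rdiv_le_0_compat; assumption. }
  unfold Rdiv in HN at 1. rewrite Rpow_mult_distr, pow_inv in HN.
  apply (Rmult_lt_compat_r (q ^ N)) in HN; [|assumption].
  rewrite Rmult_assoc, Rinv_l, Rmult_1_r in HN by lra.
  apply (Rmult_lt_compat_l (a / 2 + M)) in HN; [|lra].
  replace ((a / 2 + M) * (y * q ^ N)) with ((d / 2) * q ^ N * (a / 2)) in HN
    by (unfold y; field; lra).
  lra.
Qed.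

Lemma bump_concentrates (g : R -> R) t0 :
  (forall t, continuous g t) -> (forall t, g (t + 1) = g t) ->
  (forall n, RInt (fun t => bump (t - t0) ^ n * g t) 0 1 = 0) ->
  g t0 = 0.
Proof.
  intros Hc Hp Hn. apply Rle_antisym; [now apply bump_concentrates_pos|].
  apply Ropp_le_cancel. rewrite Ropp_0.
  apply (bump_concentrates_pos (fun t => - g t)).
  - intros t. apply (continuous_opp (V := R_NormedModule)), Hc.
  - intros t. now rewrite Hp.
  - intros n. rewrite (RInt_ext _ (fun t => opp (bump (t - t0) ^ n * g t))).
    + rewrite (RInt_opp (V := R_CompleteNormedModule)).
      * rewrite Hn. apply Ropp_0.
      * apply Rint_unit_ex. intros t.
        apply (continuous_mult (K := R_AbsRing)); [apply continuous_bump_pow|apply Hc].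
    + intros t _. unfold opp; simpl. ring.
Qed.

Section Coefficients.
Context {X : spin_torus}.

(** ** Fourier coefficients *)

Definition cmean (f : plane -> C) : C :=
  (mean (fun x => Re (f x)), mean (fun x => Im (f x))).

Lemma cmean_plus f g : ccont f -> ccont g ->
  cmean (fun x => (f x + g x)%C) = (cmean f + cmean g)%C.
Proof. intros [] []. unfold cmean, Cplus; simpl. now rewrite <- !mean_plus. Qed.

Lemma cmean_scal c f : ccont f ->
  cmean (fun x => (c * f x)%C) = (c * cmean f)%C.
Proof.
  intros [F1 F2]. destruct c as [a b]. unfold cmean, Cmult; simpl.
  assert (S : forall (d : R) (k : plane -> R), cont k -> cont (fun x => d * k x)).
  { intros d k Hk. apply cont_mult; [apply cont_const|exact Hk]. }
  f_equal; rewrite <- !mean_scal by assumption.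
  - rewrite <- mean_minus by now apply S. apply mean_ext. reflexivity.
  - rewrite <- mean_plus by now apply S. apply mean_ext. reflexivity.
Qed.

Lemma cmean_ext f g : (forall x, f x = g x) -> cmean f = cmean g.
Proof.
  intros H. now replace g with f by now apply functional_extensionality.
Qed.

Lemma ip_cmean f g : ip f g = Re (cmean (fun x => (f x * Cconj (g x))%C)).
Proof. reflexivity. Qed.

Lemma cmean_dz f g : twisted f -> twisted g ->
  cmean (fun x => (dz f x * g x)%C) =
  (- cmean (fun x => (f x * dz g x)%C))%C.
Proof.
  intros Hf Hg. pose proof (twisted_scal (- Ci)%C f Hf) as Hi.
  pose proof (bil_dz _ _ Hf Hg) as H1. pose proof (bil_dz _ _ Hi Hg) as H2.
  rewrite (dz_scal (- Ci)%C f (proj1 Hf)) in H2.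
  apply injective_projections.
  - exact H1.
  - transitivity (bil (fun x => ((- Ci) * dz f x)%C) g).
    + apply mean_ext. intros x. generalize (dz f x) (g x).
      intros u w. unfold Re, Im; simpl. ring.
    + rewrite H2. change (snd (Copp ?z)) with (- snd z).
      apply Ropp_eq_compat, mean_ext. intros x. cbn beta.
      generalize (f x) (dz g x). intros u w. unfold Re, Im; simpl. ring.
Qed.

Definition coef (f : plane -> C) (n : nat) : C :=
  cmean (fun x => (f x * Cconj (chr n x))%C).

Lemma ccont_chr n : ccont (chr n).
Proof. apply twisted_ccont, twisted_chr. Qed.

Lemma ccont_pair f n : ccont f -> ccont (fun x => (f x * Cconj (chr n x))%C).
Proof. intros H. apply ccont_mult; [exact H|apply ccont_conj, ccont_chr]. Qed.

Lemma coef_plus f g n : ccont f -> ccont g ->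
  coef (fun x => (f x + g x)%C) n = (coef f n + coef g n)%C.
Proof.
  intros Hf Hg. unfold coef. rewrite <- cmean_plus by now apply ccont_pair.
  apply cmean_ext. intros x. ring.
Qed.

Lemma coef_scal c f n : ccont f ->
  coef (fun x => (c * f x)%C) n = (c * coef f n)%C.
Proof.
  intros Hf. unfold coef. rewrite <- cmean_scal by now apply ccont_pair.
  apply cmean_ext. intros x. ring.
Qed.

Lemma coef_minus f g n : ccont f -> ccont g ->
  coef (fun x => (f x - g x)%C) n = (coef f n - coef g n)%C.
Proof.
  intros Hf Hg. transitivity (coef (fun x => (f x + RtoC (-1) * g x)%C) n).
  - unfold coef. apply cmean_ext. intros x. csolve.
  - rewrite coef_plus, coef_scal; auto using ccont_scal. csolve.
Qed.

Lemma dz_conj_chr n :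
  dz (fun x => Cconj (chr n x)) = fun x => ((- sym n) * Cconj (chr n x))%C.
Proof.
  assert (E : (fun x => Cconj (chr n x)) = charac (vscal (-1) (freq n))).
  { fun_ext x. unfold chr, charac, wave.
    replace (dot (vscal (-1) (freq n)) x) with (- dot (freq n) x)
      by (unfold dot, vscal; simpl; ring).
    rewrite cos_neg, sin_neg. csolve. }
  rewrite E. fun_ext x. rewrite dz_charac.
  rewrite <- (equal_f E x). apply (f_equal (fun z => (z * _)%C)).
  unfold sym, symbol, vscal. csolve.
Qed.

Lemma coef_dz f n : twisted f -> coef (dz f) n = (sym n * coef f n)%C.
Proof.
  intros Hf. unfold coef.
  rewrite (cmean_dz f (fun x => Cconj (chr n x))) by auto using twisted_conj, twisted_chr.
  rewrite dz_conj_chr.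
  rewrite (cmean_ext _ (fun x => ((- sym n) * (f x * Cconj (chr n x)))%C))
    by (intros x; ring).
  rewrite cmean_scal by now apply ccont_pair, twisted_ccont. ring.
Qed.

(** Eigenfunctions of the skew operator [dz] for distinct eigenvalues are
    orthogonal. *)
Lemma coef_chr n m : coef (chr n) m = if Nat.eq_dec n m then RtoC 1 else RtoC 0.
Proof.
  destruct (Nat.eq_dec n m) as [<-|Hne].
  - unfold coef. rewrite (cmean_ext _ (fun _ => RtoC 1)) by (intros; apply charac_norm).
    unfold cmean; simpl. now rewrite !mean_const.
  - pose proof (coef_dz (chr n) m (twisted_chr n)) as H.
    replace (dz (chr n)) with (fun x => (sym n * chr n x)%C) in H
      by (fun_ext x; now rewrite dz_chr).
    rewrite coef_scal in H by apply ccont_chr.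
    assert (H' : ((sym n - sym m) * coef (chr n) m)%C = RtoC 0).
    { transitivity (sym n * coef (chr n) m - sym m * coef (chr n) m)%C; [ring|].
      rewrite H. ring. }
    assert (Hd : (sym n - sym m)%C <> RtoC 0).
    { intros Hd. apply Hne, sym_inj.
      transitivity (sym n - sym m + sym m)%C; [ring|].
      rewrite Hd. ring. }
    transitivity (Cinv ((sym n - sym m)%C) * ((sym n - sym m) * coef (chr n) m))%C.
    + now field.
    + rewrite H'. ring.
Qed.

(** ** Completeness *)

Definition orthogonal (f : plane -> C) : Prop :=
  ccont f /\ forall k1 k2,
    cmean (fun x => (f x * Cconj (charac (freqZ k1 k2) x))%C) = RtoC 0.

Definition frequency_shift (d : plane) : Prop :=
  forall k1 k2 (sg : bool), exists j1 j2,
    vadd (freqZ k1 k2) (vscal (if sg then 1 else -1) (vscal (2 * PI) d)) = freqZ j1 j2.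

Definition bump_along (d : plane) (s : R) (x : plane) : R := bump (dot d x - s).

Lemma charac_conj k x : charac (vscal (-1) k) x = Cconj (charac k x).
Proof.
  unfold charac, wave.
  replace (dot (vscal (-1) k) x) with (- dot k x)
    by (unfold dot, vscal; simpl; ring).
  rewrite cos_neg, sin_neg. csolve.
Qed.

(** Multiplication by a trigonometric polynomial only shifts frequencies, so it
    preserves orthogonality to all characters. *)
Lemma orthogonal_bump f d s :
  frequency_shift d -> orthogonal f ->
  orthogonal (fun x => (RtoC (bump_along d s x) * f x)%C).
Proof.
  intros Hd [Cf Of].
  set (k := vscal (2 * PI) d).
  set (z := (cos (2 * PI * s), sin (2 * PI * s)) : C).
  assert (E : forall x, RtoC (bump_along d s x) =
    (RtoC (/ 2) + RtoC (/ 4) * (Cconj z * charac k x + z * Cconj (charac k x)))%C).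
  { intros x. unfold bump_along, bump, charac, wave, z.
    replace (2 * PI * (dot d x - s)) with (dot k x - 2 * PI * s)
      by (unfold k, dot, vscal; simpl; ring).
    rewrite cos_minus. unfold Re, Im in *; apply injective_projections; simpl; field. }
  assert (Cb : ccont (fun x => RtoC (bump_along d s x))).
  { replace (fun x => RtoC (bump_along d s x)) with (fun x =>
      (RtoC (/ 2) + RtoC (/ 4) * (Cconj z * charac k x + z * Cconj (charac k x)))%C).
    2: { fun_ext x; now rewrite E. }
    pose proof (csmooth_ccont _ (csmooth_charac k)).
    apply ccont_plus; [apply ccont_const|]. apply ccont_scal, ccont_plus;
      apply ccont_scal; auto using ccont_conj. }
  split; [now apply ccont_mult|].
  intros k1 k2.
  destruct (Hd k1 k2 true) as [p1 [p2 Hp]], (Hd k1 k2 false) as [m1 [m2 Hm]].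
  fold k in Hp, Hm.
  assert (Ep : forall x, charac (freqZ p1 p2) x =
                (charac (freqZ k1 k2) x * charac k x)%C).
  { intros x. rewrite <- Hp, charac_add. do 2 f_equal.
    unfold vscal; destruct k; simpl; f_equal; ring. }
  assert (Em : forall x, charac (freqZ m1 m2) x =
                (charac (freqZ k1 k2) x * Cconj (charac k x))%C).
  { intros x. now rewrite <- Hm, charac_add, charac_conj. }
  assert (CC : forall a b, ccont (fun x => (f x * Cconj (charac (freqZ a b) x))%C)).
  { intros a b. apply ccont_mult; [assumption|].
    apply ccont_conj, csmooth_ccont, csmooth_charac. }
  rewrite (cmean_ext _ (fun x =>
    (RtoC (/ 2) * (f x * Cconj (charac (freqZ k1 k2) x)) +
     (RtoC (/ 4) * Cconj z * (f x * Cconj (charac (freqZ m1 m2) x)) +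
      RtoC (/ 4) * z * (f x * Cconj (charac (freqZ p1 p2) x))))%C)).
  2: { intros x. rewrite E, Ep, Em, !Cmult_conj, Cconj_conj. ring. }
  rewrite !cmean_plus; auto using ccont_scal, ccont_plus.
  rewrite !cmean_scal by apply CC. rewrite !Of. ring.
Qed.

Lemma frequency_shift_dual1 : frequency_shift dual1.
Proof.
  intros k1 k2 sg. exists (if sg then k1 + 1 else k1 - 1)%Z, k2.
  unfold freqZ. rewrite !odd_part_IZR.
  destruct sg; rewrite ?plus_IZR, ?minus_IZR; unfold vadd, vscal; simpl;
    f_equal; ring.
Qed.

Lemma frequency_shift_dual2 : frequency_shift dual2.
Proof.
  intros k1 k2 sg. exists k1, (if sg then k2 + 1 else k2 - 1)%Z.
  unfold freqZ. rewrite !odd_part_IZR.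
  destruct sg; rewrite ?plus_IZR, ?minus_IZR; unfold vadd, vscal; simpl;
    f_equal; ring.
Qed.

Lemma orthogonal_bump_pow f d s n : frequency_shift d -> orthogonal f ->
  orthogonal (fun x => (RtoC (bump_along d s x ^ n) * f x)%C).
Proof.
  intros Hd Hf. induction n as [|n IH].
  - replace (fun x => (RtoC (bump_along d s x ^ 0) * f x)%C) with f; [exact Hf|].
    fun_ext x. simpl. ring.
  - replace (fun x => (RtoC (bump_along d s x ^ S n) * f x)%C) with
      (fun x => (RtoC (bump_along d s x) * (RtoC (bump_along d s x ^ n) * f x))%C).
    + now apply orthogonal_bump.
    + fun_ext x. simpl. rewrite RtoC_mult. ring.
Qed.

Lemma dot_dual1_point s t : dot dual1 (point s t) = s.
Proof.
  destruct torus_dual as (H11 & H12 & _). unfold dot, point, vadd, vscal in *; simpl.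
  transitivity (s * (fst dual1 * fst per1 + snd dual1 * snd per1) +
                t * (fst dual1 * fst per2 + snd dual1 * snd per2)); [ring|].
  rewrite H11, H12. ring.
Qed.

Lemma dot_dual2_point s t : dot dual2 (point s t) = t.
Proof.
  destruct torus_dual as (_ & _ & H21 & H22). unfold dot, point, vadd, vscal in *; simpl.
  transitivity (s * (fst dual2 * fst per1 + snd dual2 * snd per1) +
                t * (fst dual2 * fst per2 + snd dual2 * snd per2)); [ring|].
  rewrite H21, H22. ring.
Qed.

Lemma point_surj x : exists s t, x = point s t.
Proof.
  exists (dot dual1 x), (dot dual2 x).
  pose proof det_periods as D. destruct torus_dual as (H11 & H12 & H21 & H22).
  unfold dot, point, vadd, vscal in *. destruct x as [x1 x2]; simpl.
  destruct per1 as [a b], per2 as [c d], dual1 as [p q], dual2 as [r u].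
  cbn [fst snd] in *. f_equal; nsatz.
Qed.

(** If [f x0] is non-zero, then [f] times a suitable conjugate character is a
    periodic function whose real part [G] is positive at [x0], yet [G] is
    orthogonal to all products of bumps in the two coordinates; concentration is
    then used in one coordinate after the other. *)
Lemma orthogonal_zero f :
  orthogonal f -> twisted f -> forall x, f x = RtoC 0.
Proof.
  intros Of Tf x0.
  set (c := (Cconj (f x0) * charac (freqZ 0 0) x0)%C).
  set (G := fun x => Re ((c * (f x * Cconj (charac (freqZ 0 0) x)))%C)).
  assert (CG : cont G).
  { apply (ccont_mult (fun _ => c)); [apply ccont_const|].
    apply ccont_mult; [apply twisted_ccont, Tf|].
    apply ccont_conj, twisted_ccont, twisted_characZ. }
  assert (PG : forall x, G (vadd x per1) = G x /\ G (vadd x per2) = G x).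
  { pose proof (twisted_mult_twisted _ _ Tf
      (twisted_conj _ (twisted_characZ 0 0))) as [_ P].
    intros x. unfold G. destruct (P x) as [-> ->]. auto. }
  destruct (point_surj x0) as [s0 [t0 Hx0]].
  assert (MG : forall m n, mean (fun x => bump_along dual1 s0 x ^ m *
                 (bump_along dual2 t0 x ^ n * G x)) = 0).
  { intros m n.
    pose proof (orthogonal_bump_pow _ _ s0 m frequency_shift_dual1
      (orthogonal_bump_pow _ _ t0 n frequency_shift_dual2 Of)) as [Co Oo].
    specialize (Oo 0%Z 0%Z).
    pose proof (f_equal (fun w => Re (c * w)%C) Oo) as E. cbn beta in E.
    rewrite <- cmean_scal in E.
    2: { apply ccont_mult; [exact Co|].
         apply ccont_conj, twisted_ccont, twisted_characZ. }
    rewrite Cmult_0_r in E. transitivity (Re (RtoC 0)); [|reflexivity].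
    rewrite <- E. apply mean_ext. intros x. unfold G, Re, Im; simpl. ring. }
  assert (S1 : forall t s, point (s + 1) t = vadd (point s t) per1).
  { intros. unfold point, vadd, vscal; simpl. f_equal; ring. }
  assert (S2 : forall t s, point s (t + 1) = vadd (point s t) per2).
  { intros. unfold point, vadd, vscal; simpl. f_equal; ring. }
  assert (CB : forall n, cont (fun x => bump_along dual2 t0 x ^ n)).
  { intros n. apply (cont_comp (fun t => bump (t - t0) ^ n)); [apply cont_dot|].
    intros. apply continuous_bump_pow. }
  assert (Z : forall n, RInt (fun t => bump (t - t0) ^ n * G (point s0 t)) 0 1 = 0).
  { intros n.
    set (H := fun x => bump_along dual2 t0 x ^ n * G x).
    assert (CH : cont H) by (apply cont_mult; auto).
    transitivity (RInt (fun t => H (point s0 t)) 0 1).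
    { apply RInt_ext. intros t _. unfold H, bump_along. now rewrite dot_dual2_point. }
    apply (bump_concentrates (fun s => RInt (fun t => H (point s t)) 0 1)).
    - intros s. now apply mean_outer_cont.
    - intros s. apply RInt_ext. intros t _. unfold H, bump_along.
      rewrite !dot_dual2_point, S1. now rewrite (proj1 (PG _)).
    - intros m. etransitivity; [|exact (MG m n)]. unfold mean. apply RInt_ext. intros s _.
      rewrite <- (RInt_scal (V := R_CompleteNormedModule)).
      + apply RInt_ext. intros t _. unfold scal; simpl; unfold mult; simpl.
        unfold H. f_equal. unfold bump_along. now rewrite dot_dual1_point.
      + apply Rint_unit_ex. intros t. now apply mean_inner_cont. }
  assert (G0 : G (point s0 t0) = 0).
  { apply (bump_concentrates (fun t => G (point s0 t))).
    - intros t. now apply mean_inner_cont.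
    - intros t. rewrite S2. apply PG.
    - exact Z. }
  rewrite <- Hx0 in G0. unfold G, c in G0.
  assert (E : (Cconj (f x0) * charac (freqZ 0 0) x0 *
     (f x0 * Cconj (charac (freqZ 0 0) x0)))%C = (f x0 * Cconj (f x0))%C).
  { transitivity (f x0 * Cconj (f x0) *
      (charac (freqZ 0 0) x0 * Cconj (charac (freqZ 0 0) x0)))%C; [ring|].
    rewrite charac_norm. ring. }
  rewrite E in G0. simpl in G0.
  apply injective_projections; simpl; nra.
Qed.

Theorem coef_complete f : twisted f -> (forall n, coef f n = RtoC 0) ->
  forall x, f x = RtoC 0.
Proof.
  intros Tf H. apply orthogonal_zero; [|exact Tf].
  split; [now apply twisted_ccont|]. intros k1 k2.
  destruct (index_surj k1 k2) as [n [<- <-]]. apply H.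
Qed.
End Coefficients.

Section Expansion.
Context {X : spin_torus}.

(** ** Fourier expansion and Parseval's identity *)

Lemma Im_le_Cmod z : Rabs (Im z) <= Cmod z.
Proof. eapply Rle_trans; [apply Rmax_r|apply Rmax_Cmod]. Qed.

Lemma le_of_sq x y : 0 <= y -> x ^ 2 <= y ^ 2 -> x <= y.
Proof. intros H1 H2. apply Rnot_lt_le. intros H. nra. Qed.

Lemma Cmod_le_Re_Im z : Cmod z <= Rabs (Re z) + Rabs (Im z).
Proof.
  pose proof (Rabs_pos (Re z)); pose proof (Rabs_pos (Im z)).
  apply le_of_sq; [lra|]. rewrite Cmod2_alt.
  rewrite <- (pow2_abs (Re z)), <- (pow2_abs (Im z)). nra.
Qed.

Definition crapid (c : nat -> C) : Prop :=
  forall p : nat, exists M, forall n, Cmod (c n) * INR (S n) ^ p <= M.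

Lemma crapid_rapid_Re c : crapid c -> rapid (fun n => Re (c n)).
Proof.
  intros H p. destruct (H p) as [M HM]. exists M. intros n.
  eapply Rle_trans; [|apply HM]. apply Rmult_le_compat_r; [apply pow_le, pos_INR|].
  apply re_le_Cmod.
Qed.

Lemma crapid_rapid_Im c : crapid c -> rapid (fun n => Im (c n)).
Proof.
  intros H p. destruct (H p) as [M HM]. exists M. intros n.
  eapply Rle_trans; [|apply HM]. apply Rmult_le_compat_r; [apply pow_le, pos_INR|].
  apply Im_le_Cmod.
Qed.

Definition fourier (c : nat -> C) (x : plane) : C :=
  (wave_series (fun n => Re (c n)) (fun n => - Im (c n)) x,
   wave_series (fun n => Im (c n)) (fun n => Re (c n)) x).

Fixpoint psum (c : nat -> C) (K : nat) (x : plane) : C :=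
  match K with
  | O => RtoC 0
  | S K => (psum c K x + c K * chr K x)%C
  end.

Lemma psum_components c n x :
  psum c (S n) x =
  (wave_sum (fun k => Re (c k)) (fun k => - Im (c k)) n x,
   wave_sum (fun k => Im (c k)) (fun k => Re (c k)) n x).
Proof.
  unfold wave_sum. induction n as [|n IH].
  - rewrite !sum_O. simpl. unfold chr, charac, wave. csolve.
  - rewrite !sum_Sn.
    change (psum c (S (S n)) x) with (psum c (S n) x + c (S n) * chr (S n) x)%C.
    rewrite IH. generalize (c (S n)). intros w.
    unfold chr, charac, wave, Re, Im, plus. apply injective_projections; simpl; ring.
Qed.

Lemma fourier_uniform c e : crapid c -> 0 < e ->
  exists N, forall n, (N <= n)%nat -> forall x,
    Cmod (fourier c x - psum c n x)%C <= e.
Proof.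
  intros Hc He.
  pose proof (crapid_rapid_Re c Hc) as HR. pose proof (crapid_rapid_Im c Hc) as HI.
  destruct (wave_series_uniform _ _ (e / 2) HR (rapid_opp _ HI)) as [N1 H1]; [lra|].
  destruct (wave_series_uniform _ _ (e / 2) HI HR) as [N2 H2]; [lra|].
  exists (S (N1 + N2)). intros [|n] Hn x; [lia|].
  eapply Rle_trans; [apply Cmod_le_Re_Im|].
  specialize (H1 n ltac:(lia) x). specialize (H2 n ltac:(lia) x).
  rewrite psum_components. unfold Rminus in H1, H2. simpl. lra.
Qed.

Lemma wave_translate n v s a b x : charac (freq n) v = RtoC s ->
  wave (freq n) a b (vadd x v) = s * wave (freq n) a b x.
Proof.
  intros E. pose proof (charac_translate (freq n) x v) as H. rewrite E in H.
  pose proof (f_equal fst H) as H1. pose proof (f_equal snd H) as H2.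
  unfold charac, wave in *. cbn [fst snd Cmult RtoC] in H1, H2.
  assert (A : cos (dot (freq n) (vadd x v)) = s * cos (dot (freq n) x)) by lra.
  assert (B : sin (dot (freq n) (vadd x v)) = s * sin (dot (freq n) x)) by lra.
  rewrite A, B. ring.
Qed.

Lemma charac_per n : charac (freq n) per1 = RtoC (spin_sign spin1) /\
  charac (freq n) per2 = RtoC (spin_sign spin2).
Proof.
  unfold charac, wave, freq. rewrite dot_freq1, dot_freq2.
  destruct (cos_sin_odd_part spin1 (index1 n)) as [-> ->].
  destruct (cos_sin_odd_part spin2 (index2 n)) as [-> ->].
  split; csolve.
Qed.

Lemma twisted_fourier c : crapid c -> twisted (fourier c).
Proof.
  intros Hc.
  pose proof (crapid_rapid_Re c Hc) as HR. pose proof (crapid_rapid_Im c Hc) as HI.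
  split; [split; apply smooth_wave_series; auto using rapid_opp|].
  assert (T : forall v s, (forall n, charac (freq n) v = RtoC s) -> forall x,
     fourier c (vadd x v) = (RtoC s * fourier c x)%C).
  { intros v s Hs x.
    assert (A : forall a b, wave_series a b (vadd x v) = s * wave_series a b x).
    { intros a b. unfold wave_series. rewrite <- Series_scal_l.
      apply Series_ext. intros n. now apply wave_translate. }
    unfold fourier. rewrite !A. csolve. }
  intros x. split; apply T; intros n; apply charac_per.
Qed.

Lemma mean_abs_le f e : cont f -> (forall x, Rabs (f x) <= e) -> Rabs (mean f) <= e.
Proof.
  intros Cf H. apply Rabs_le. split.
  - rewrite <- (mean_const (- e)). apply mean_le; auto using cont_const.
    intros x. specialize (H x). apply Rabs_le_between in H. lra.
  - rewrite <- (mean_const e). apply mean_le; auto using cont_const.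
    intros x. specialize (H x). apply Rabs_le_between in H. lra.
Qed.

Lemma Cmod_chr n x : Cmod (chr n x) = 1.
Proof.
  pose proof (charac_norm (freq n) x) as H.
  change (charac (freq n) x) with (chr n x) in H.
  generalize dependent (chr n x). intros z H.
  rewrite <- Cmod2_conj in H. apply RtoC_inj in H.
  pose proof (Cmod_ge_0 z). nra.
Qed.

Lemma Cmod_pair f n x : Cmod (f x * Cconj (chr n x))%C = Cmod (f x).
Proof. rewrite Cmod_mult, Cmod_conj, Cmod_chr. ring. Qed.

Lemma coef_sup f n e : ccont f -> (forall x, Cmod (f x) <= e) ->
  Cmod (coef f n) <= 2 * e.
Proof.
  intros Cf H. destruct (ccont_pair f n Cf) as [C1 C2].
  eapply Rle_trans; [apply Cmod_le_Re_Im|].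
  assert (Rabs (Re (coef f n)) <= e).
  { apply mean_abs_le; [exact C1|]. intros x.
    eapply Rle_trans; [apply re_le_Cmod|]. now rewrite Cmod_pair. }
  assert (Rabs (Im (coef f n)) <= e).
  { apply mean_abs_le; [exact C2|]. intros x.
    eapply Rle_trans; [apply Im_le_Cmod|]. now rewrite Cmod_pair. }
  lra.
Qed.

Lemma ccont_psum c K : ccont (psum c K).
Proof.
  induction K as [|K IH]; [apply ccont_const|].
  apply ccont_plus; [exact IH|]. apply ccont_scal, ccont_chr.
Qed.

Lemma coef_psum c K n : coef (psum c K) n = if lt_dec n K then c n else RtoC 0.
Proof.
  induction K as [|K IH].
  - unfold coef. rewrite (cmean_ext _ (fun _ => RtoC 0)) by (intros; simpl; ring).
    unfold cmean; simpl. rewrite !mean_const. destruct (lt_dec n 0); [lia|reflexivity].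
  - change (psum c (S K)) with (fun x => (psum c K x + c K * chr K x)%C).
    rewrite coef_plus, coef_scal, coef_chr, IH by
      auto using ccont_psum, ccont_scal, ccont_chr.
    destruct (lt_dec n K), (lt_dec n (S K)), (Nat.eq_dec K n); try lia; subst; ring.
Qed.

Lemma ccont_minus f g : ccont f -> ccont g -> ccont (fun x => (f x - g x)%C).
Proof.
  intros Hf Hg. apply ccont_plus; [exact Hf|].
  destruct Hg. split; simpl; (apply (cont_comp Ropp); [assumption|]);
    intros x; apply (continuous_opp (V := R_NormedModule)), continuous_id.
Qed.

Lemma Cmod_eq_of_small (z w : C) : (forall e, 0 < e -> Cmod (z - w)%C <= e) -> z = w.
Proof.
  intros H. assert (E : Cmod (z - w)%C = 0).
  { apply Rle_antisym; [|apply Cmod_ge_0]. apply Rle_plus_epsilon.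
    intros e He. specialize (H e He). lra. }
  apply Cmod_eq_0 in E. transitivity (z - w + w)%C; [ring|].
  rewrite E. ring.
Qed.

Lemma coef_fourier c n : crapid c -> coef (fourier c) n = c n.
Proof.
  intros Hc. apply Cmod_eq_of_small. intros e He.
  destruct (fourier_uniform c (e / 2) Hc) as [N HN]; [lra|].
  set (K := (N + S n)%nat). specialize (HN K ltac:(lia)).
  pose proof (coef_psum c K n) as E. destruct (lt_dec n K) as [_|]; [|lia].
  rewrite <- E, <- coef_minus.
  - replace e with (2 * (e / 2)) by field. apply coef_sup; [|exact HN].
    apply ccont_minus; [|apply ccont_psum]. now apply twisted_ccont, twisted_fourier.
  - now apply twisted_ccont, twisted_fourier.
  - apply ccont_psum.
Qed.

Lemma mean_conj f : ccont f -> cmean (fun x => Cconj (f x)) = Cconj (cmean f).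
Proof.
  intros [H1 H2]. unfold cmean, Cconj; simpl. f_equal. now rewrite <- mean_opp.
Qed.

(** Pythagoras; iterated, it gives Bessel's inequality with an explicit
    remainder. *)
Lemma ip_remove_mode f n : ccont f ->
  ip (fun x => (f x - coef f n * chr n x)%C)
     (fun x => (f x - coef f n * chr n x)%C) =
  ip f f - Cmod (coef f n) ^ 2.
Proof.
  intros Cf. rewrite !ip_cmean. set (c := coef f n).
  assert (Ce : ccont (chr n)) by apply ccont_chr.
  rewrite (cmean_ext _ (fun x =>
    (f x * Cconj (f x) + (- Cconj c) * (f x * Cconj (chr n x)) +
     ((- c) * Cconj (f x * Cconj (chr n x)) + c * Cconj c * RtoC 1))%C)).
  2: { intros x. pose proof (charac_norm (freq n) x) as E. fold (chr n x) in E.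
       rewrite <- E, Cminus_conj, !Cmult_conj, Cconj_conj. ring. }
  assert (P : ccont (fun x => (f x * Cconj (chr n x))%C)) by now apply ccont_pair.
  rewrite !cmean_plus;
    auto using ccont_plus, ccont_scal, ccont_mult, ccont_conj, ccont_const.
  rewrite !cmean_scal by auto using ccont_conj, ccont_const.
  rewrite mean_conj by assumption.
  change (cmean (fun x => (f x * Cconj (chr n x))%C)) with c.
  unfold cmean at 2. cbn beta. change (Re (RtoC 1)) with 1. change (Im (RtoC 1)) with 0.
  rewrite !mean_const, Cmod2_alt.
  generalize (cmean (fun x => (f x * Cconj (f x))%C)). intros z.
  destruct c as [a b]. unfold Re, Im; simpl. ring.
Qed.

Lemma coef_bound f n : ccont f -> Cmod (coef f n) ^ 2 <= ip f f.
Proof.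
  intros Cf. pose proof (ip_remove_mode f n Cf) as E.
  assert (H : ccont (fun x => (f x - coef f n * chr n x)%C)).
  { apply ccont_minus; [exact Cf|]. apply ccont_scal, ccont_chr. }
  pose proof (ip_ge0 _ H). lra.
Qed.

Lemma Cmod_sym_sq n : Cmod (sym n) ^ 2 = sym2 n.
Proof.
  pose proof (sym_sq n) as E. rewrite <- Cmod2_conj in E. now apply RtoC_inj in E.
Qed.

Fixpoint dz_iter (p : nat) (f : plane -> C) : plane -> C :=
  match p with O => f | S p => dz (dz (dz_iter p f)) end.

Lemma twisted_dz_iter p f : twisted f -> twisted (dz_iter p f).
Proof. intros H. induction p; simpl; auto using twisted_dz. Qed.

Lemma Cmod_coef_dz_iter p f n : twisted f ->
  Cmod (coef (dz_iter p f) n) = sym2 n ^ p * Cmod (coef f n).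
Proof.
  intros H. induction p as [|p IH]; simpl; [ring|].
  pose proof (twisted_dz_iter p f H) as T.
  rewrite !coef_dz by auto using twisted_dz. rewrite !Cmod_mult, IH.
  pose proof (Cmod_sym_sq n) as E. simpl in E. rewrite <- E. ring.
Qed.

(** [dz^2] multiplies the modulus of the [n]-th coefficient by [sym2 n], which
    grows at least linearly, and every coefficient of the twisted function
    [dz^(2p) f] is at most its norm. *)
Lemma coef_crapid f : twisted f -> crapid (coef f).
Proof.
  intros Tf p. destruct sym2_lower as [c [Hc Hs]].
  pose proof (twisted_dz_iter p f Tf) as T.
  exists (/ c ^ p * sqrt (ip (dz_iter p f) (dz_iter p f))). intros n.
  pose proof (coef_bound (dz_iter p f) n (twisted_ccont _ T)) as B.
  pose proof (ip_ge0 _ (twisted_ccont _ T)) as G.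
  assert (B' : Cmod (coef (dz_iter p f) n) <= sqrt (ip (dz_iter p f) (dz_iter p f))).
  { apply le_of_sq; [apply sqrt_pos|]. rewrite pow2_sqrt; assumption. }
  rewrite Cmod_coef_dz_iter in B' by assumption.
  assert (Hcp : 0 < c ^ p) by now apply pow_lt.
  apply Rmult_le_reg_l with (c ^ p); [assumption|].
  rewrite <- (Rmult_assoc (c ^ p) (/ c ^ p)), Rinv_r, Rmult_1_l by lra.
  eapply Rle_trans; [|exact B'].
  replace (c ^ p * (Cmod (coef f n) * INR (S n) ^ p)) with
    ((c * INR (S n)) ^ p * Cmod (coef f n)) by (rewrite Rpow_mult_distr; ring).
  apply Rmult_le_compat_r; [apply Cmod_ge_0|].
  apply pow_incr. split; [|apply Hs].
  apply Rmult_le_pos; [lra|apply pos_INR].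
Qed.

Lemma eq_of_coef f g : twisted f -> twisted g ->
  (forall n, coef f n = coef g n) -> forall x, f x = g x.
Proof.
  intros Tf Tg H x.
  assert (E : (f x - g x)%C = RtoC 0).
  { apply (coef_complete (fun x => (f x - g x)%C)).
    - now apply twisted_minus.
    - intros n. rewrite coef_minus by now apply twisted_ccont. rewrite H. ring. }
  transitivity (f x - g x + g x)%C; [ring|]. rewrite E. ring.
Qed.

(** Both sides have the same coefficients, so completeness applies. *)
Theorem fourier_coef f : twisted f -> forall x, fourier (coef f) x = f x.
Proof.
  intros Tf. pose proof (coef_crapid f Tf) as R.
  apply eq_of_coef; auto using twisted_fourier. intros n. now apply coef_fourier.
Qed.

Definition resid (f : plane -> C) (K : nat) (x : plane) : C :=
  (f x - psum (coef f) K x)%C.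

Lemma ccont_resid f K : ccont f -> ccont (resid f K).
Proof. intros H. apply ccont_minus; [exact H|apply ccont_psum]. Qed.

Lemma ip_resid_S f K : ccont f ->
  ip (resid f (S K)) (resid f (S K)) = ip (resid f K) (resid f K) - Cmod (coef f K) ^ 2.
Proof.
  intros Cf. pose proof (ip_remove_mode (resid f K) K (ccont_resid f K Cf)) as E.
  assert (EK : coef (resid f K) K = coef f K).
  { unfold resid. rewrite coef_minus, coef_psum; auto using ccont_psum.
    destruct (lt_dec K K); [lia|]. csolve. }
  rewrite EK in E. rewrite <- E.
  replace (resid f (S K)) with
    (fun x => (resid f K x - coef f K * chr K x)%C); [reflexivity|].
  fun_ext x. unfold resid. simpl. ring.
Qed.

Lemma ip_sup f e : ccont f -> (forall x, Cmod (f x) <= e) -> ip f f <= e ^ 2.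
Proof.
  intros Cf H. rewrite <- (mean_const (e ^ 2)). apply mean_le.
  - apply cont_Re_mult; [|apply ccont_conj]; exact Cf.
  - apply cont_const.
  - intros x. specialize (H x). pose proof (Cmod2_alt (f x)). pose proof (Cmod_ge_0 (f x)).
    unfold Re, Im in *; simpl. nra.
Qed.

Lemma ip_resid_small f e : twisted f -> 0 < e ->
  exists N, forall n, (N <= n)%nat -> ip (resid f n) (resid f n) <= e.
Proof.
  intros Tf He. pose proof (sqrt_lt_R0 e He) as Hs.
  destruct (fourier_uniform (coef f) (sqrt e) (coef_crapid f Tf) Hs) as [N HN].
  exists N. intros n Hn. replace e with (sqrt e ^ 2) by (apply pow2_sqrt; lra).
  apply ip_sup; [now apply ccont_resid, twisted_ccont|].
  intros x. unfold resid. rewrite <- (fourier_coef f Tf x) at 1. now apply HN.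
Qed.

Lemma bessel f K : ccont f ->
  sum_n (fun n => Cmod (coef f n) ^ 2) K = ip f f - ip (resid f (S K)) (resid f (S K)).
Proof.
  intros Cf.
  assert (E0 : ip (resid f 0) (resid f 0) = ip f f).
  { f_equal; fun_ext x; unfold resid; simpl; csolve. }
  assert (A : forall a b c : R, a - b + c = a - (b - c)) by (intros; ring).
  assert (B : forall a b : R, a = b - (b - a)) by (intros; ring).
  induction K as [|K IH].
  - rewrite sum_O, ip_resid_S, E0 by assumption. apply B.
  - rewrite sum_Sn, IH, (ip_resid_S f (S K)) by assumption. apply A.
Qed.

Theorem parseval f : twisted f ->
  is_series (fun n => Cmod (coef f n) ^ 2) (ip f f).
Proof.
  intros Tf. apply (filterlim_locally (F := eventually)). intros eps.
  assert (He : 0 < eps / 2) by (apply Rdiv_lt_0_compat; [apply eps|lra]).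
  destruct (ip_resid_small f (eps / 2) Tf He) as [N HN].
  exists N. intros n Hn. specialize (HN (S n) ltac:(lia)).
  rewrite bessel by now apply twisted_ccont.
  change (Rabs (ip f f - ip (resid f (S n)) (resid f (S n)) - ip f f) < eps).
  pose proof (ip_ge0 _ (ccont_resid f (S n) (twisted_ccont f Tf))).
  pose proof (cond_pos eps).
  apply Rabs_def1; lra.
Qed.

(** ** The inverse of [dz] *)

(** This is where the spin structure matters: for the trivial one the constant
    character would have symbol zero. *)
Definition dz_inv (f : plane -> C) : plane -> C :=
  fourier (fun n => (Cinv (sym n) * coef f n)%C).

Lemma Cmod_sym_inv : exists M, 0 < M /\ forall n, Cmod (Cinv (sym n)) ^ 2 <= M /\
  Cmod (Cinv (sym n)) ^ 2 = / sym2 n.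
Proof.
  destruct sym2_lower as [c [Hc H]]. exists (/ c).
  split; [now apply Rinv_0_lt_compat|]. intros n.
  assert (E : Cmod (Cinv (sym n)) ^ 2 = / sym2 n).
  { rewrite Cmod_inv by apply sym_neq0. now rewrite pow_inv, Cmod_sym_sq. }
  split; [|exact E]. rewrite E. apply Rinv_le_contravar; [assumption|].
  eapply Rle_trans; [|apply H].
  assert (1 <= INR (S n)) by (apply (le_INR 1); lia). nra.
Qed.

Lemma crapid_inv_sym c : crapid c -> crapid (fun n => (Cinv (sym n) * c n)%C).
Proof.
  intros Hc p. destruct (Hc p) as [M HM], Cmod_sym_inv as [B [HB H]].
  exists (sqrt B * M). intros n. destruct (H n) as [H1 _]. specialize (HM n).
  rewrite Cmod_mult, Rmult_assoc.
  assert (Cmod (Cinv (sym n)) <= sqrt B).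
  { apply le_of_sq; [apply sqrt_pos|]. rewrite pow2_sqrt; lra. }
  apply Rmult_le_compat; auto using Cmod_ge_0.
  apply Rmult_le_pos; [apply Cmod_ge_0|apply pow_le, pos_INR].
Qed.

Lemma twisted_dz_inv f : twisted f -> twisted (dz_inv f).
Proof. intros H. apply twisted_fourier, crapid_inv_sym, coef_crapid, H. Qed.

Lemma coef_dz_inv f n : twisted f ->
  coef (dz_inv f) n = (Cinv (sym n) * coef f n)%C.
Proof.
  intros H. unfold dz_inv. rewrite coef_fourier; [reflexivity|].
  apply crapid_inv_sym, coef_crapid, H.
Qed.

Lemma dz_dz_inv f : twisted f -> dz (dz_inv f) = f.
Proof.
  intros H. apply functional_extensionality.
  apply eq_of_coef; auto using twisted_dz, twisted_dz_inv.
  intros n. rewrite coef_dz, coef_dz_inv by auto using twisted_dz_inv.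
  field. apply sym_neq0.
Qed.

Lemma dz_injective f g : twisted f -> twisted g -> dz f = dz g -> f = g.
Proof.
  intros Tf Tg E. apply functional_extensionality. apply eq_of_coef; auto.
  intros n. pose proof (coef_dz f n Tf) as H. rewrite E, (coef_dz g n Tg) in H.
  transitivity (Cinv (sym n) * (sym n * coef f n))%C.
  - field. apply sym_neq0.
  - rewrite <- H. field. apply sym_neq0.
Qed.

Lemma dz_inv_dz f : twisted f -> dz_inv (dz f) = f.
Proof.
  intros H. apply dz_injective; auto using twisted_dz_inv, twisted_dz.
  now apply dz_dz_inv, twisted_dz.
Qed.

(** Away from finitely many modes [dz_inv] is as small as one likes: this is its
    compactness, in the form of an inequality. *)
Lemma dz_inv_compact e : 0 < e -> exists M K, 0 < M /\ forall f, twisted f ->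
  ip (dz_inv f) (dz_inv f) <=
  e * ip f f + M * sum_n (fun n => Cmod (coef f n) ^ 2) K.
Proof.
  intros He. destruct Cmod_sym_inv as [M [HM H]].
  destruct sym2_lower as [c [Hc Hs]].
  destruct (inv_INR_small (/ c) e He) as [K HK].
  exists M, K. split; [assumption|]. intros f Tf.
  set (u := fun n => Cmod (coef (dz_inv f) n) ^ 2).
  set (w := fun n => Cmod (coef f n) ^ 2).
  assert (W : forall n, 0 <= w n) by (intros; apply pow2_ge_0).
  assert (U : forall n, u n = / sym2 n * w n).
  { intros n. unfold u, w. rewrite coef_dz_inv, Cmod_mult, Rpow_mult_distr by assumption.
    now rewrite (proj2 (H n)). }
  assert (U1 : forall n, u n <= M * w n).
  { intros n. rewrite U. destruct (H n) as [H1 <-]. now apply Rmult_le_compat_r. }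
  assert (U2 : forall n, (K <= n)%nat -> u n <= e * w n).
  { intros n Hn. rewrite U. apply Rmult_le_compat_r; [apply W|].
    eapply Rle_trans; [|apply (HK n Hn)]. rewrite <- Rinv_mult.
    apply Rinv_le_contravar; [|apply Hs].
    apply Rmult_lt_0_compat; [assumption|apply lt_0_INR; lia]. }
  assert (S0 : forall N, 0 <= sum_n w N).
  { induction N as [|N IH]; [rewrite sum_O; apply W|].
    rewrite sum_Sn. unfold plus; simpl. specialize (W (S N)). lra. }
  assert (P : forall N, sum_n u N <= e * sum_n w N + M * sum_n w (Nat.min N K)).
  { induction N as [|N IH].
    - simpl Nat.min. rewrite !sum_O. specialize (U1 0%nat). specialize (W 0%nat). nra.
    - rewrite !(sum_Sn _ N). unfold plus; simpl AbelianMonoid.plus.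
      destruct (le_lt_dec K N) as [L|L].
      + rewrite Nat.min_r in IH by lia. rewrite Nat.min_r by lia.
        specialize (U2 (S N) ltac:(lia)). unfold plus; simpl. lra.
      + rewrite Nat.min_l in IH by lia. rewrite Nat.min_l by lia.
        rewrite (sum_Sn _ N). specialize (U1 (S N)). specialize (W (S N)).
        unfold plus; simpl. nra. }
  pose proof (parseval _ (twisted_dz_inv f Tf)) as L1.
  pose proof (parseval _ Tf) as L2.
  fold u in L1. fold w in L2.
  change (is_lim_seq (sum_n u) (ip (dz_inv f) (dz_inv f))) in L1.
  change (is_lim_seq (sum_n w) (ip f f)) in L2.
  assert (L3 : is_lim_seq (fun N => e * sum_n w N + M * sum_n w K)
                 (e * ip f f + M * sum_n w K)).
  { apply is_lim_seq_plus'; [|apply is_lim_seq_const].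
    now apply (is_lim_seq_scal_l _ e (ip f f)). }
  assert (L : Rbar_le (ip (dz_inv f) (dz_inv f)) (e * ip f f + M * sum_n w K)).
  { refine (is_lim_seq_le_loc _ _ _ _ _ L1 L3).
    exists K. intros N HN. specialize (P N). now rewrite Nat.min_r in P by lia. }
  exact L.
Qed.

Lemma dz_inv_bounded : exists M, 0 < M /\ forall f, twisted f ->
  ip (dz_inv f) (dz_inv f) <= M * ip f f.
Proof.
  destruct (dz_inv_compact 1 Rlt_0_1) as [M [K [HM H]]].
  exists (1 + M). split; [lra|]. intros f Tf. specialize (H f Tf).
  rewrite bessel in H by now apply twisted_ccont.
  pose proof (ip_ge0 _ (ccont_resid f (S K) (twisted_ccont f Tf))). nra.
Qed.
End Expansion.

(** * A maximiser of a weighted Rayleigh quotient *)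

(** ** Diagonal extraction *)

Section Diagonal.
Variables (u : nat -> nat -> R) (M : R).
Hypothesis Hu : forall n k, Rabs (u n k) <= M.

(** The first [k] entries of [c] are approximated simultaneously by infinitely
    many rows of [u]. *)
Definition cluster (k : nat) (c : nat -> R) : Prop :=
  forall e N, 0 < e -> exists n, (N <= n)%nat /\
    forall i, (i < k)%nat -> Rabs (u n i - c i) < e.

Definition update (c : nat -> R) (k : nat) (x : R) (i : nat) : R :=
  if Nat.eq_dec i k then x else c i.

Lemma inv_INR_pos n : 0 < / INR (S n).
Proof. apply Rinv_0_lt_compat, lt_0_INR. lia. Qed.

(** Bolzano-Weierstrass in column [k], along rows that approximate the previous
    entries ever better. *)
Lemma cluster_extend k c : cluster k c -> exists x, cluster (S k) (update c k x).
Proof.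
  intros H.
  pose (P := fun j n => (j <= n)%nat /\
               forall i, (i < k)%nat -> Rabs (u n i - c i) < / INR (S j)).
  assert (HP : forall j, exists n, P j n).
  { intros j. apply (H (/ INR (S j)) j), inv_INR_pos. }
  pose (f := fun j => epsilon (inhabits 0%nat) (P j)).
  assert (Hf : forall j, P j (f j)) by (intros; apply epsilon_spec, HP).
  destruct (Bolzano_Weierstrass (fun j => u (f j) k) (fun x => - M <= x <= M))
    as [x Hx].
  { apply compact_P3. }
  { intros n. apply Rabs_le_between, Hu. }
  exists x. intros e N He.
  destruct (inv_INR_small 1 e He) as [K HK].
  assert (V : neighbourhood (fun y => Rabs (y - x) < e) x).
  { exists (mkposreal e He). intros y Hy. exact Hy. }
  destruct (Hx _ (N + S K)%nat V) as [p [Hp Hp']].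
  exists (f p). destruct (Hf p) as [H1 H2]. split; [lia|].
  intros i Hi. unfold update. destruct (Nat.eq_dec i k) as [->|Hne]; [exact Hp'|].
  eapply Rlt_le_trans; [apply H2; lia|].
  specialize (HK p ltac:(lia)). lra.
Qed.

Fixpoint cluster_seq (k : nat) : nat -> R :=
  match k with
  | O => fun _ => 0
  | S k => update (cluster_seq k) k
      (epsilon (inhabits 0) (fun x => cluster (S k) (update (cluster_seq k) k x)))
  end.

Lemma cluster_seq_spec k : cluster k (cluster_seq k).
Proof.
  induction k as [|k IH].
  - intros e N He. exists N. split; [lia|]. intros i Hi; lia.
  - simpl. apply (epsilon_spec (inhabits 0)
      (fun x => cluster (S k) (update (cluster_seq k) k x))).
    now apply cluster_extend.
Qed.

Lemma cluster_seq_stable m i : (i < m)%nat -> cluster_seq m i = cluster_seq (S i) i.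
Proof.
  induction m as [|m IH]; [lia|]. intros Hi.
  destruct (Nat.eq_dec i m) as [->|Hne]; [reflexivity|].
  simpl. unfold update at 1. destruct (Nat.eq_dec i m); [lia|].
  apply IH. lia.
Qed.

Lemma extraction : exists (phi : nat -> nat) (c : nat -> R),
  (forall n, (n <= phi n)%nat) /\
  forall k, is_lim_seq (fun n => u (phi n) k) (c k).
Proof.
  set (c := fun i => cluster_seq (S i) i).
  pose (P := fun j n => (j <= n)%nat /\
               forall i, (i < j)%nat -> Rabs (u n i - c i) < / INR (S j)).
  assert (HP : forall j, exists n, P j n).
  { intros j. destruct (cluster_seq_spec j (/ INR (S j)) j (inv_INR_pos j)) as [n [Hn H]].
    exists n. split; [assumption|]. intros i Hi. unfold c.
    rewrite <- (cluster_seq_stable j i Hi). now apply H. }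
  pose (f := fun j => epsilon (inhabits 0%nat) (P j)).
  assert (Hf : forall j, P j (f j)) by (intros; apply epsilon_spec, HP).
  exists f, c. split; [apply Hf|]. intros k.
  apply is_lim_seq_spec. intros eps.
  destruct (inv_INR_small 1 eps (cond_pos eps)) as [K HK].
  exists (S (K + k)). intros n Hn. destruct (Hf n) as [_ H].
  eapply Rlt_le_trans; [apply H; lia|].
  specialize (HK n ltac:(lia)). lra.
Qed.
End Diagonal.

Lemma is_lim_seq_extract (v : nat -> R) (l : R) phi :
  (forall n, (n <= phi n)%nat) -> is_lim_seq v l -> is_lim_seq (fun n => v (phi n)) l.
Proof.
  intros Hp H. apply is_lim_seq_spec. apply is_lim_seq_spec in H.
  intros eps. destruct (H eps) as [N HN]. exists N. intros n Hn.
  apply HN. specialize (Hp n). lia.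
Qed.

Section Periodic.
Context {X : spin_torus}.

(** ** Periodic functions are bounded *)

Lemma periodic_Z (f : plane -> R) v (k : Z) :
  (forall x, f (vadd x v) = f x) -> forall x, f (vadd x (vscal (IZR k) v)) = f x.
Proof.
  intros H.
  assert (N : forall n x, f (vadd x (vscal (INR n) v)) = f x).
  { induction n as [|n IH]; intros x.
    - f_equal. unfold vadd, vscal; destruct x; simpl; f_equal; ring.
    - rewrite S_INR, <- (IH x), <- (H (vadd x (vscal (INR n) v))). f_equal.
      unfold vadd, vscal; simpl; f_equal; ring. }
  intros x. destruct (Z_le_dec 0 k) as [Hk|Hk].
  - rewrite <- (N (Z.to_nat k) x), INR_IZR_INZ, Z2Nat.id by assumption. reflexivity.
  - rewrite <- (N (Z.to_nat (- k)) (vadd x (vscal (IZR k) v))).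
    rewrite INR_IZR_INZ, Z2Nat.id, opp_IZR by lia.
    f_equal. unfold vadd, vscal; destruct x; simpl; f_equal; ring.
Qed.

(** Uniform continuity bounds the variation of [f] along each of finitely many
    equal steps from a corner of the fundamental parallelogram. *)
Lemma periodic_bounded f : cont f -> periodic per1 per2 f ->
  exists M, 0 < M /\ forall x, Rabs (f x) <= M.
Proof.
  intros Cf Pf.
  destruct (uniform_continuity_2d (fun s t => f (point s t)) 0 1 0 1
     (fun s t _ _ => point_continuity f s t Cf) (mkposreal 1 Rlt_0_1)) as [d Hd].
  simpl in Hd.
  destruct (inv_INR_small 1 (d / 2)) as [N HN].
  { pose proof (cond_pos d). lra. }
  specialize (HN N (le_n N)).
  pose proof (inv_INR_pos N) as Hi.
  assert (B : forall s t, 0 <= s <= 1 -> 0 <= t <= 1 ->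
     Rabs (f (point s t)) <= Rabs (f (point 0 0)) + INR (S N)).
  { intros s t Hs Ht.
    set (q := fun k => INR k * / INR (S N)).
    assert (Hq : forall k, (k <= S N)%nat -> 0 <= q k <= 1).
    { intros k Hk. unfold q. split; [apply Rmult_le_pos; [apply pos_INR|lra]|].
      apply Rle_trans with (INR (S N) * / INR (S N)).
      - apply Rmult_le_compat_r; [lra|]. now apply le_INR.
      - rewrite Rinv_r; [lra|]. apply not_0_INR. lia. }
    assert (I : forall k, (k <= S N)%nat ->
       Rabs (f (point (q k * s) (q k * t))) <= Rabs (f (point 0 0)) + INR k).
    { induction k as [|k IH]; intros Hk.
      - unfold q. simpl INR. rewrite !Rmult_0_l. lra.
      - specialize (IH ltac:(lia)).
        pose proof (Hq k ltac:(lia)) as Q1. pose proof (Hq (S k) ltac:(lia)) as Q2.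
        assert (E : q (S k) = q k + / INR (S N)).
        { unfold q. rewrite S_INR. ring. }
        assert (D : forall r, 0 <= r <= 1 -> Rabs (q (S k) * r - q k * r) < d).
        { intros r Hr. rewrite E.
          replace ((q k + / INR (S N)) * r - q k * r) with (/ INR (S N) * r) by ring.
          rewrite Rabs_right by nra. pose proof (cond_pos d). nra. }
        assert (J : Rabs (f (point (q (S k) * s) (q (S k) * t)) -
                          f (point (q k * s) (q k * t))) < 1).
        { apply Hd; auto; nra. }
        rewrite S_INR.
        pose proof (Rabs_triang (f (point (q (S k) * s) (q (S k) * t)) -
                          f (point (q k * s) (q k * t))) (f (point (q k * s) (q k * t)))) as T.
        replace (f (point (q (S k) * s) (q (S k) * t)) -
                          f (point (q k * s) (q k * t)) + f (point (q k * s) (q k * t)))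
          with (f (point (q (S k) * s) (q (S k) * t))) in T by ring.
        lra. }
    specialize (I (S N) (le_n _)).
    replace (q (S N)) with 1 in I.
    - now rewrite !Rmult_1_l in I.
    - unfold q. rewrite Rinv_r; [reflexivity|]. apply not_0_INR. lia. }
  exists (Rabs (f (point 0 0)) + INR (S N)). split.
  { pose proof (Rabs_pos (f (point 0 0))).
    pose proof (lt_0_INR (S N) (Nat.lt_0_succ N)). lra. }
  intros x. destruct (point_surj x) as [s [t ->]].
  rewrite <- (periodic_Z f per1 (- Int_part s) (fun x => proj1 (Pf x))).
  rewrite <- (periodic_Z f per2 (- Int_part t) (fun x => proj2 (Pf x))).
  replace (vadd (vadd (point s t) (vscal (IZR (- Int_part s)) per1))
     (vscal (IZR (- Int_part t)) per2)) with (point (frac_part s) (frac_part t)).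
  - destruct (base_fp s), (base_fp t). apply B; lra.
  - unfold point, frac_part, vadd, vscal; rewrite !opp_IZR; simpl; f_equal; ring.
Qed.

Lemma cperiodic_bounded g : cperiodic g -> exists M, 0 < M /\ forall x, Cmod (g x) <= M.
Proof.
  intros [[S1 S2] P].
  destruct (periodic_bounded (fun x => Re (g x))) as [M1 [H1 B1]].
  { now apply smooth_cont. }
  { intros x. destruct (P x) as [-> ->]. auto. }
  destruct (periodic_bounded (fun x => Im (g x))) as [M2 [H2 B2]].
  { now apply smooth_cont. }
  { intros x. destruct (P x) as [-> ->]. auto. }
  exists (M1 + M2). split; [lra|]. intros x.
  eapply Rle_trans; [apply Cmod_le_Re_Im|]. specialize (B1 x). specialize (B2 x). lra.
Qed.
End Periodic.

Class conf_factor {X : spin_torus} : Type := ConfFactor {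
  factor : plane -> R;
  factor_smooth : smooth factor;
  factor_periodic : periodic per1 per2 factor;
  factor_pos : forall x, 0 < factor x }.

Section Weighted.
Context {X : spin_torus} {H : conf_factor}.

Definition rho (x : plane) : R := factor x ^ 2.
Definition weight (f : plane -> C) (x : plane) : C := (RtoC (rho x) * f x)%C.

Lemma rho_pos x : 0 < rho x.
Proof. apply pow_lt, factor_pos. Qed.

Lemma smooth_rho : smooth rho.
Proof.
  apply smooth_eq with (fun x => factor x * factor x).
  - apply smooth_mult; apply factor_smooth.
  - intros x. unfold rho. ring.
Qed.

Lemma periodic_rho : periodic per1 per2 rho.
Proof. intros x. unfold rho. destruct (factor_periodic x) as [-> ->]. auto. Qed.

Lemma cperiodic_rho : cperiodic (fun x => RtoC (rho x)).
Proof. apply cperiodic_real; [apply smooth_rho|apply periodic_rho]. Qed.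

Lemma cperiodic_inv_rho : cperiodic (fun x => RtoC (/ rho x)).
Proof.
  apply cperiodic_real.
  - apply smooth_inv; [apply smooth_rho|]. intros x. pose proof (rho_pos x). lra.
  - intros x. destruct (periodic_rho x) as [-> ->]. auto.
Qed.

Lemma twisted_weight f : twisted f -> twisted (weight f).
Proof. apply twisted_mult, cperiodic_rho. Qed.

Lemma rho_bounds : exists m M, 0 < m /\ 0 < M /\ forall x, m <= rho x <= M.
Proof.
  destruct (periodic_bounded rho (smooth_cont _ smooth_rho) periodic_rho) as [M [HM B]].
  destruct cperiodic_inv_rho as [[S _] _]. change (smooth (fun x => / rho x)) in S.
  destruct (periodic_bounded (fun x => / rho x) (smooth_cont _ S)) as [m [Hm D]].
  { intros x. destruct (periodic_rho x) as [-> ->]. auto. }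
  exists (/ m), M. split; [now apply Rinv_0_lt_compat|]. split; [assumption|].
  intros x. pose proof (rho_pos x) as P. specialize (B x). specialize (D x).
  rewrite Rabs_right in B by lra.
  rewrite Rabs_right in D by (apply Rle_ge; left; now apply Rinv_0_lt_compat).
  split; [|assumption].
  apply Rinv_le_contravar in D; [|now apply Rinv_0_lt_compat].
  now rewrite Rinv_inv in D.
Qed.

(** The [L^2] product of the conformal metric, pulled back to flat spinors. *)
Definition wip (f g : plane -> C) : R := ip (weight f) g.
Definition wnorm2 (f : plane -> C) : R := wip f f.

Lemma ccont_weight f : twisted f -> ccont (weight f).
Proof. intros Tf. now apply twisted_ccont, twisted_weight. Qed.

Lemma wip_sym f g : wip f g = wip g f.
Proof. apply mean_ext. intros x. unfold weight, Re, Im; simpl. ring. Qed.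

Lemma wip_ip f g : wip f g = ip f (weight g).
Proof. apply mean_ext. intros x. unfold weight, Re, Im; simpl. ring. Qed.

Lemma wip_plus_l f g k : twisted f -> twisted g -> twisted k ->
  wip (fun x => (f x + g x)%C) k = wip f k + wip g k.
Proof.
  intros Tf Tg Tk. unfold wip. rewrite <- ip_plus_l;
    eauto using ccont_weight, twisted_ccont.
  apply mean_ext. intros x. unfold weight, Re, Im; simpl. ring.
Qed.

Lemma wip_scal_l a f k : twisted f -> twisted k ->
  wip (fun x => (RtoC a * f x)%C) k = a * wip f k.
Proof.
  intros Tf Tk. unfold wip. rewrite <- ip_scal_l;
    eauto using ccont_weight, twisted_ccont.
  apply mean_ext. intros x. unfold weight, Re, Im; simpl. ring.
Qed.

Lemma wip_plus_r f g k : twisted f -> twisted g -> twisted k ->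
  wip k (fun x => (f x + g x)%C) = wip k f + wip k g.
Proof. intros. rewrite !(wip_sym k). now apply wip_plus_l. Qed.

Lemma wip_scal_r a f k : twisted f -> twisted k ->
  wip k (fun x => (RtoC a * f x)%C) = a * wip k f.
Proof. intros. rewrite !(wip_sym k). now apply wip_scal_l. Qed.

Lemma cont_sq f : twisted f -> cont (fun x => Re (f x * Cconj (f x))%C).
Proof.
  intros Tf. apply cont_Re_mult; [|apply ccont_conj]; now apply twisted_ccont.
Qed.

Lemma wnorm2_equiv : exists m M, 0 < m /\ 0 < M /\ forall f, twisted f ->
  m * ip f f <= wnorm2 f <= M * ip f f.
Proof.
  destruct rho_bounds as [m [M [Hm [HM B]]]]. exists m, M.
  split; [assumption|]. split; [assumption|]. intros f Tf.
  change (wnorm2 f) with (mean (fun x => Re (weight f x * Cconj (f x))%C)).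
  unfold ip, bil. rewrite <- !mean_scal by now apply cont_sq.
  assert (C1 : cont (fun x => Re (weight f x * Cconj (f x))%C)).
  { apply cont_Re_mult; [|apply ccont_conj].
    - now apply ccont_weight.
    - now apply twisted_ccont. }
  split; apply mean_le; try assumption.
  - apply cont_mult; [apply cont_const|now apply cont_sq].
  - intros x. specialize (B x). unfold weight. generalize (f x).
    intros [a b]. unfold Re; simpl. pose proof (pow2_ge_0 a). pose proof (pow2_ge_0 b). nra.
  - apply cont_mult; [apply cont_const|now apply cont_sq].
  - intros x. specialize (B x). unfold weight. generalize (f x).
    intros [a b]. unfold Re; simpl. pose proof (pow2_ge_0 a). pose proof (pow2_ge_0 b). nra.
Qed.

Lemma wnorm2_ge0 f : twisted f -> 0 <= wnorm2 f.
Proof.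
  intros Tf. destruct wnorm2_equiv as [m [M [Hm [HM B]]]].
  pose proof (ip_ge0 f (twisted_ccont f Tf)). destruct (B f Tf). nra.
Qed.

Lemma ip_zero f : twisted f -> ip f f = 0 -> f = fun _ => RtoC 0.
Proof.
  intros Tf E. apply functional_extensionality, coef_complete; [assumption|].
  intros n. pose proof (coef_bound f n (twisted_ccont f Tf)) as B.
  apply Cmod_eq_0. pose proof (Cmod_ge_0 (coef f n)). nra.
Qed.

Lemma wnorm2_zero f : twisted f -> wnorm2 f = 0 -> f = fun _ => RtoC 0.
Proof.
  intros Tf E. apply ip_zero; [assumption|].
  destruct wnorm2_equiv as [m [M [Hm [HM B]]]].
  pose proof (ip_ge0 f (twisted_ccont f Tf)). destruct (B f Tf). nra.
Qed.

Lemma wnorm2_plus f g : twisted f -> twisted g ->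
  wnorm2 (fun x => (f x + g x)%C) = wnorm2 f + 2 * wip f g + wnorm2 g.
Proof.
  intros Tf Tg. unfold wnorm2.
  rewrite wip_plus_l, !wip_plus_r by eauto using twisted_plus.
  rewrite (wip_sym g f). ring.
Qed.

Lemma wnorm2_scal a f : twisted f ->
  wnorm2 (fun x => (RtoC a * f x)%C) = a ^ 2 * wnorm2 f.
Proof.
  intros Tf. unfold wnorm2. rewrite wip_scal_l, wip_scal_r by eauto using twisted_scal.
  ring.
Qed.

Lemma wnorm2_cscal c f : twisted f ->
  wnorm2 (fun x => (c * f x)%C) = Cmod c ^ 2 * wnorm2 f.
Proof.
  intros Tf. unfold wnorm2, wip, ip, bil. rewrite <- mean_scal.
  - apply mean_ext. intros x. rewrite Cmod2_alt. unfold weight.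
    generalize (f x). intros [u w]. destruct c as [a b]. unfold Re, Im; simpl. ring.
  - apply cont_Re_mult; [|apply ccont_conj].
    + now apply ccont_weight.
    + now apply twisted_ccont.
Qed.

Lemma wnorm2_plus_le f g : twisted f -> twisted g ->
  wnorm2 (fun x => (f x + g x)%C) <= 2 * wnorm2 f + 2 * wnorm2 g.
Proof.
  intros Tf Tg.
  pose proof (wnorm2_ge0 _ (twisted_plus _ _ Tf (twisted_scal (RtoC (-1)) _ Tg))) as E.
  rewrite wnorm2_plus, wnorm2_scal, wip_scal_r in E by eauto using twisted_scal.
  rewrite wnorm2_plus by assumption. lra.
Qed.

Lemma discriminant_nonpos A B D : 0 <= D ->
  (forall t, 0 <= A + 2 * B * t + D * t ^ 2) -> B ^ 2 <= A * D.
Proof.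
  intros HD Q. destruct (Rle_lt_or_eq_dec 0 D HD) as [Hp|<-].
  - specialize (Q (- B / D)).
    replace (A + 2 * B * (- B / D) + D * (- B / D) ^ 2) with ((A * D - B ^ 2) / D) in Q
      by (field; lra).
    apply Rmult_le_compat_r with (r := D) in Q; [|assumption].
    unfold Rdiv in Q. rewrite Rmult_assoc, Rinv_l in Q by lra. lra.
  - destruct (Req_dec B 0) as [->|HB]; [lra|].
    (* the point where the linear polynomial A + 2 B t takes the value -1 *)
    specialize (Q (- (A + 1) / (2 * B))).
    replace (A + 2 * B * (- (A + 1) / (2 * B)) + 0 * (- (A + 1) / (2 * B)) ^ 2)
      with (-1) in Q by (field; lra). lra.
Qed.

Lemma wip_cauchy_schwarz f g : twisted f -> twisted g ->
  wip f g ^ 2 <= wnorm2 f * wnorm2 g.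
Proof.
  intros Tf Tg. apply discriminant_nonpos; [now apply wnorm2_ge0|].
  intros t.
  pose proof (wnorm2_ge0 _ (twisted_plus _ _ Tf (twisted_scal (RtoC t) _ Tg))) as E.
  rewrite wnorm2_plus, wnorm2_scal, wip_scal_r in E by eauto using twisted_scal. lra.
Qed.

(** ** The operator [twist_inv] *)

(** Conjugation turns the inverse of the Cauchy-Riemann operator into a real
    linear operator that is antisymmetric for the weighted product. Minus its
    square is the inverse of a second-order operator with the same eigenvalues as
    the squared Dirac operator. *)
Definition twist_inv (f : plane -> C) (x : plane) : C := Cconj (dz_inv (weight f) x).

Lemma twisted_twist_inv f : twisted f -> twisted (twist_inv f).
Proof. intros Tf. now apply twisted_conj, twisted_dz_inv, twisted_weight. Qed.

(** Integration by parts for the functions [dz_inv (weight f)] and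
    [dz_inv (weight g)]. *)
Lemma twist_inv_antisym f g : twisted f -> twisted g ->
  wip (twist_inv f) g = - wip f (twist_inv g).
Proof.
  intros Tf Tg.
  pose proof (twisted_weight f Tf) as Wf. pose proof (twisted_weight g Tg) as Wg.
  pose proof (bil_dz _ _ (twisted_dz_inv _ Wf) (twisted_dz_inv _ Wg)) as E.
  rewrite !dz_dz_inv in E by assumption.
  transitivity (bil (dz_inv (weight f)) (weight g)).
  - apply mean_ext. intros x.
    change (Re (RtoC (rho x) * Cconj (dz_inv (weight f) x) * Cconj (g x))%C =
            Re (dz_inv (weight f) x * (RtoC (rho x) * g x))%C).
    generalize (dz_inv (weight f) x) (g x). intros u w. unfold Re, Im; simpl. ring.
  - transitivity (- bil (weight f) (dz_inv (weight g))); [lra|].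
    f_equal. apply mean_ext. intros x. unfold twist_inv. now rewrite Cconj_conj.
Qed.

Lemma dz_inv_plus f g : twisted f -> twisted g ->
  dz_inv (fun x => (f x + g x)%C) = fun x => (dz_inv f x + dz_inv g x)%C.
Proof.
  intros Tf Tg. apply dz_injective; eauto using twisted_plus, twisted_dz_inv.
  pose proof (twisted_dz_inv f Tf) as [Sf _]. pose proof (twisted_dz_inv g Tg) as [Sg _].
  rewrite (dz_plus _ _ Sf Sg), !dz_dz_inv by eauto using twisted_plus. reflexivity.
Qed.

Lemma dz_inv_scal c f : twisted f ->
  dz_inv (fun x => (c * f x)%C) = fun x => (c * dz_inv f x)%C.
Proof.
  intros Tf. apply dz_injective; eauto using twisted_scal, twisted_dz_inv.
  pose proof (twisted_dz_inv f Tf) as [Sf _].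
  rewrite (dz_scal _ _ Sf), !dz_dz_inv by eauto using twisted_scal. reflexivity.
Qed.

Lemma weight_plus f g :
  weight (fun x => (f x + g x)%C) = fun x => (weight f x + weight g x)%C.
Proof. fun_ext x. unfold weight. ring. Qed.

Lemma weight_scal c f :
  weight (fun x => (c * f x)%C) = fun x => (c * weight f x)%C.
Proof. fun_ext x. unfold weight. ring. Qed.

Lemma twist_inv_plus f g : twisted f -> twisted g ->
  twist_inv (fun x => (f x + g x)%C) = fun x => (twist_inv f x + twist_inv g x)%C.
Proof.
  intros Tf Tg. fun_ext x. unfold twist_inv.
  rewrite weight_plus, dz_inv_plus by eauto using twisted_weight. apply Cplus_conj.
Qed.

Lemma twist_inv_cscal c f : twisted f ->
  twist_inv (fun x => (c * f x)%C) = fun x => (Cconj c * twist_inv f x)%C.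
Proof.
  intros Tf. fun_ext x. unfold twist_inv.
  rewrite weight_scal, dz_inv_scal by eauto using twisted_weight. apply Cmult_conj.
Qed.

Lemma Cconj_R a : Cconj (RtoC a) = RtoC a.
Proof. csolve. Qed.

Lemma twist_inv_scal a f : twisted f ->
  twist_inv (fun x => (RtoC a * f x)%C) = fun x => (RtoC a * twist_inv f x)%C.
Proof. intros Tf. rewrite twist_inv_cscal, Cconj_R by assumption. reflexivity. Qed.

Lemma ip_conj f : ip (fun x => Cconj (f x)) (fun x => Cconj (f x)) = ip f f.
Proof. apply mean_ext. intros x. unfold Re, Im; simpl. ring. Qed.

Lemma ip_weight_le : exists M, 0 < M /\ forall f, twisted f ->
  ip (weight f) (weight f) <= M * wnorm2 f.
Proof.
  destruct rho_bounds as [m [M [Hm [HM B]]]]. exists M. split; [assumption|].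
  intros f Tf. unfold wnorm2, wip, ip, bil. rewrite <- mean_scal.
  - apply mean_le.
    + apply cont_Re_mult; [|apply ccont_conj]; now apply ccont_weight.
    + apply cont_mult; [apply cont_const|].
      apply cont_Re_mult; [|apply ccont_conj].
      * now apply ccont_weight.
      * now apply twisted_ccont.
    + intros x. specialize (B x). unfold weight. generalize (f x).
      intros [a b]. unfold Re; simpl. pose proof (rho_pos x).
      replace ((rho x * a - 0 * b) * (rho x * a - 0 * b) -
        (rho x * b + 0 * a) * - (rho x * b + 0 * a)) with
        (rho x * (rho x * (a ^ 2 + b ^ 2))) by ring.
      replace (M * ((rho x * a - 0 * b) * a - (rho x * b + 0 * a) * - b)) with
        (M * (rho x * (a ^ 2 + b ^ 2))) by ring.
      apply Rmult_le_compat_r; [|lra].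
      pose proof (pow2_ge_0 a). pose proof (pow2_ge_0 b). nra.
  - apply cont_Re_mult; [|apply ccont_conj].
    + now apply ccont_weight.
    + now apply twisted_ccont.
Qed.

Lemma twist_inv_bounded : exists B, 0 < B /\ forall f, twisted f ->
  wnorm2 (twist_inv f) <= B * wnorm2 f.
Proof.
  destruct wnorm2_equiv as [m [M [Hm [HM E]]]].
  destruct ip_weight_le as [M1 [HM1 W]].
  destruct dz_inv_bounded as [M2 [HM2 D]].
  exists (M * (M2 * M1)). split; [repeat apply Rmult_lt_0_compat; assumption|].
  intros f Tf.
  pose proof (twisted_weight f Tf) as Wf.
  destruct (E _ (twisted_twist_inv f Tf)) as [_ E2].
  eapply Rle_trans; [exact E2|].
  rewrite Rmult_assoc. apply Rmult_le_compat_l; [lra|].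
  unfold twist_inv. rewrite ip_conj.
  eapply Rle_trans; [now apply D|]. rewrite Rmult_assoc.
  apply Rmult_le_compat_l; [lra|]. now apply W.
Qed.

(** ** The supremum *)

Lemma twist_inv_neq0 f : twisted f -> wnorm2 (twist_inv f) = 0 -> wnorm2 f = 0.
Proof.
  intros Tf E. apply wnorm2_zero in E; [|now apply twisted_twist_inv].
  pose proof (twisted_weight f Tf) as Wf.
  assert (Z : dz_inv (weight f) = fun _ => RtoC 0).
  { fun_ext x.
    rewrite <- (Cconj_conj (dz_inv (weight f) x)).
    change (Cconj (dz_inv (weight f) x)) with (twist_inv f x). rewrite E. csolve. }
  pose proof (dz_dz_inv _ Wf) as D. rewrite Z, dz_const in D.
  unfold wnorm2, wip. rewrite <- D.
  transitivity (mean (fun _ => 0)); [|apply mean_const].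
  apply mean_ext. intros x. unfold Re, Im; simpl. ring.
Qed.

(** [L] is the supremum of the quotient, and [a] a maximising sequence of unit
    vectors. *)
Lemma twist_inv_sup : exists L a, 0 < L /\
  (forall f, twisted f -> wnorm2 (twist_inv f) <= L * wnorm2 f) /\
  (forall n : nat, twisted (a n)) /\ (forall n, wnorm2 (a n) = 1) /\
  is_lim_seq (fun n => wnorm2 (twist_inv (a n))) L.
Proof.
  set (E := fun r => exists f, twisted f /\ wnorm2 f = 1 /\ r = wnorm2 (twist_inv f)).
  destruct twist_inv_bounded as [B [HB HT]].
  assert (N : forall f, twisted f -> 0 < wnorm2 f -> exists g, twisted g /\ wnorm2 g = 1 /\
     wnorm2 (twist_inv g) = wnorm2 (twist_inv f) / wnorm2 f).
  { intros f Tf Hf. set (s := / sqrt (wnorm2 f)).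
    assert (Hs : s ^ 2 = / wnorm2 f).
    { unfold s. rewrite pow_inv, pow2_sqrt by lra. reflexivity. }
    exists (fun x => (RtoC s * f x)%C).
    split; [now apply twisted_scal|]. split.
    - rewrite wnorm2_scal, Hs by assumption. field. lra.
    - rewrite twist_inv_scal, wnorm2_scal, Hs by eauto using twisted_twist_inv.
      field. lra. }
  assert (H0 : 0 < wnorm2 (chr 0)).
  { destruct (wnorm2_ge0 _ (twisted_chr 0)) as [?|E0]; [assumption|].
    symmetry in E0. apply wnorm2_zero in E0; [|apply twisted_chr].
    pose proof (Cmod_chr 0 (0, 0)) as C1. rewrite E0, Cmod_0 in C1. lra. }
  destruct (completeness E) as [L [U1 U2]].
  { exists B. intros r [f [Tf [H1 ->]]]. specialize (HT f Tf).
    rewrite H1 in HT. lra. }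
  { destruct (N _ (twisted_chr 0) H0) as [g [Tg [H1 _]]]. eexists. exists g. eauto. }
  assert (HL : forall f, twisted f -> wnorm2 (twist_inv f) <= L * wnorm2 f).
  { intros f Tf. destruct (wnorm2_ge0 f Tf) as [Hf|Hf].
    - destruct (N f Tf Hf) as [g [Tg [H1 H2]]].
      assert (G : wnorm2 (twist_inv f) / wnorm2 f <= L).
      { apply U1. exists g. auto. }
      apply Rmult_le_reg_r with (/ wnorm2 f); [now apply Rinv_0_lt_compat|].
      rewrite Rmult_assoc, Rinv_r by lra. lra.
    - specialize (HT f Tf). rewrite <- Hf in *. lra. }
  exists L.
  assert (A : forall n, exists f, twisted f /\ wnorm2 f = 1 /\
                L - / INR (S n) < wnorm2 (twist_inv f)).
  { intros n. apply NNPP. intros Hn.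
    assert (L <= L - / INR (S n)).
    { apply U2. intros r [f [Tf [H1 ->]]]. apply Rnot_lt_le. intros Hlt.
      apply Hn. exists f. auto. }
    pose proof (inv_INR_pos n). lra. }
  pose (a := fun n => epsilon (inhabits (chr 0)) (fun f => twisted f /\ wnorm2 f = 1 /\
                L - / INR (S n) < wnorm2 (twist_inv f))).
  assert (Ha : forall n, twisted (a n) /\ wnorm2 (a n) = 1 /\
                L - / INR (S n) < wnorm2 (twist_inv (a n))).
  { intros n. apply (epsilon_spec (inhabits (chr 0)) (fun f => twisted f /\ wnorm2 f = 1 /\
                L - / INR (S n) < wnorm2 (twist_inv f))), A. }
  exists a. split; [|split; [exact HL|split; [apply Ha|split; [apply Ha|]]]].
  - specialize (HL _ (twisted_chr 0)).
    destruct (wnorm2_ge0 _ (twisted_twist_inv _ (twisted_chr 0))) as [G|G]; [nra|].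
    symmetry in G. apply twist_inv_neq0 in G; [|apply twisted_chr]. lra.
  - apply is_lim_seq_spec. intros eps.
    destruct (inv_INR_small 1 eps (cond_pos eps)) as [K HK].
    exists K. intros n Hn. specialize (HK n Hn).
    destruct (Ha n) as [Ta [H1 H2]]. specialize (HL _ Ta). rewrite H1 in HL.
    pose proof (inv_INR_pos n). apply Rabs_def1; [pose proof (cond_pos eps)|]; lra.
Qed.

Definition defect (L : R) (f : plane -> C) (x : plane) : C :=
  (twist_inv (twist_inv f) x + RtoC L * f x)%C.

Lemma twisted_defect L f : twisted f -> twisted (defect L f).
Proof.
  intros Tf. apply twisted_plus; [|now apply twisted_scal].
  now apply twisted_twist_inv, twisted_twist_inv.
Qed.

(** A near maximiser nearly solves the eigenvalue equation: expanding the square,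
    antisymmetry turns the mixed term into [- 2 L] times the squared norm of
    [twist_inv f], and the bound [L] for [twist_inv f] itself disposes of the
    leading term. *)
Lemma defect_small L f :
  (forall f, twisted f -> wnorm2 (twist_inv f) <= L * wnorm2 f) -> twisted f ->
  wnorm2 (defect L f) <= L * (L * wnorm2 f - wnorm2 (twist_inv f)).
Proof.
  intros HL Tf. pose proof (twisted_twist_inv f Tf) as T1.
  pose proof (twisted_twist_inv _ T1) as T2.
  unfold defect. rewrite wnorm2_plus, wnorm2_scal, wip_scal_r by eauto using twisted_scal.
  rewrite (twist_inv_antisym (twist_inv f) f) by assumption.
  fold (wnorm2 (twist_inv f)). specialize (HL _ T1). lra.
Qed.

Lemma wip_defect L f g : twisted f -> twisted g ->
  wip (defect L f) g = wip f (defect L g).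
Proof.
  intros Tf Tg. pose proof (twisted_twist_inv f Tf) as F1.
  pose proof (twisted_twist_inv _ F1) as F2.
  pose proof (twisted_twist_inv g Tg) as G1.
  pose proof (twisted_twist_inv _ G1) as G2.
  pose proof (twisted_scal (RtoC L) _ Tf) as F3.
  pose proof (twisted_scal (RtoC L) _ Tg) as G3.
  unfold defect.
  rewrite (wip_plus_l _ _ _ F2 F3 Tg), (wip_plus_r _ _ _ G2 G3 Tf).
  rewrite (wip_scal_l L f g Tf Tg), (wip_scal_r L g f Tg Tf).
  rewrite (twist_inv_antisym _ g F1 Tg), (twist_inv_antisym f _ Tf G1). lra.
Qed.
End Weighted.

Section Maximiser.
Context {X : spin_torus} {H : conf_factor}.

(** ** Decay of the iterates on characters *)

Fixpoint iter_inv (p : nat) (f : plane -> C) : plane -> C :=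
  match p with O => f | S p => iter_inv p (twist_inv f) end.

Lemma twisted_iter_inv p f : twisted f -> twisted (iter_inv p f).
Proof.
  revert f. induction p as [|p IH]; simpl; intros f Tf; [assumption|].
  now apply IH, twisted_twist_inv.
Qed.

Lemma iter_inv_plus p f g : twisted f -> twisted g ->
  iter_inv p (fun x => (f x + g x)%C) = fun x => (iter_inv p f x + iter_inv p g x)%C.
Proof.
  revert f g. induction p as [|p IH]; simpl; intros f g Tf Tg; [reflexivity|].
  rewrite twist_inv_plus by assumption. now apply IH; apply twisted_twist_inv.
Qed.

Lemma wnorm2_iter_inv_cscal p c f : twisted f ->
  wnorm2 (iter_inv p (fun x => (c * f x)%C)) = Cmod c ^ 2 * wnorm2 (iter_inv p f).
Proof.
  revert c f. induction p as [|p IH]; simpl; intros c f Tf; [now apply wnorm2_cscal|].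
  rewrite twist_inv_cscal, IH, Cmod_conj by auto using twisted_twist_inv. reflexivity.
Qed.

Lemma iter_inv_bounded p : exists B, 0 < B /\ forall f, twisted f ->
  wnorm2 (iter_inv p f) <= B * wnorm2 f.
Proof.
  destruct twist_inv_bounded as [B [HB HT]].
  induction p as [|p [D [HD IH]]]; simpl.
  - exists 1. split; [lra|]. intros; lra.
  - exists (D * B). split; [now apply Rmult_lt_0_compat|]. intros f Tf.
    eapply Rle_trans; [now apply IH, twisted_twist_inv|].
    rewrite Rmult_assoc. apply Rmult_le_compat_l; [lra|]. now apply HT.
Qed.

Definition chr_or_conj (b : bool) (k : nat) (x : plane) : C :=
  if b then chr k x else Cconj (chr k x).
Definition sym_or_opp (b : bool) (k : nat) : C :=
  if b then sym k else (- sym k)%C.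

Lemma twisted_chr_or_conj b k : twisted (chr_or_conj b k).
Proof. destruct b; [|apply twisted_conj]; apply twisted_chr. Qed.

Lemma dz_chr_or_conj b k :
  dz (chr_or_conj b k) = fun x => (sym_or_opp b k * chr_or_conj b k x)%C.
Proof.
  destruct b.
  - fun_ext x. apply dz_chr.
  - apply dz_conj_chr.
Qed.

Lemma sym_or_opp_neq0 b k : sym_or_opp b k <> RtoC 0.
Proof.
  pose proof (sym_neq0 k) as N. destruct b; [exact N|]. simpl. intros E. apply N.
  transitivity (- (- sym k))%C; [ring|]. rewrite E. ring.
Qed.

Lemma Cmod_sym_or_opp b k : Cmod (sym_or_opp b k) ^ 2 = sym2 k.
Proof. destruct b; simpl sym_or_opp; rewrite ?Cmod_opp; apply Cmod_sym_sq. Qed.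

Lemma Cmod_chr_or_conj b k x : Cmod (chr_or_conj b k x) = 1.
Proof. destruct b; simpl; rewrite ?Cmod_conj; apply Cmod_chr. Qed.

(** Inverting [dz] on a modulated character gains a factor [1 / symbol], up to a
    term of the same kind with a differentiated amplitude. *)
Lemma dz_inv_modulated r b k : cperiodic r ->
  dz_inv (fun x => (r x * chr_or_conj b k x)%C) =
  fun x => (Cinv (sym_or_opp b k) *
    (r x * chr_or_conj b k x - dz_inv (fun x => (dz r x * chr_or_conj b k x)%C) x))%C.
Proof.
  intros Pr. pose proof (twisted_chr_or_conj b k) as Te.
  pose proof (twisted_mult _ _ Pr Te) as T1.
  pose proof (twisted_mult _ _ (cperiodic_dz _ Pr) Te) as T2.
  pose proof (twisted_dz_inv _ T2) as T3.
  pose proof (twisted_opp _ T3) as T4.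
  apply dz_injective.
  - now apply twisted_dz_inv.
  - apply twisted_scal. now apply twisted_minus.
  - rewrite dz_dz_inv by assumption.
    rewrite dz_scal by apply (twisted_minus _ _ T1 T3).
    unfold Cminus.
    rewrite (dz_plus _ _ (proj1 T1) (proj1 T4)).
    replace (fun x => (- dz_inv (fun x => (dz r x * chr_or_conj b k x)%C) x)%C)
      with (fun x => (RtoC (-1) * dz_inv (fun x => (dz r x * chr_or_conj b k x)%C) x)%C)
      by (fun_ext x; csolve).
    rewrite dz_scal by apply T3.
    rewrite dz_dz_inv by assumption.
    rewrite (dz_mult _ _ (proj1 Pr) (proj1 Te)).
    rewrite dz_chr_or_conj. fun_ext x.
    replace (RtoC (-1)) with (- RtoC 1)%C by csolve.
    field. apply sym_or_opp_neq0.
Qed.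

Definition weighted_dz (q : plane -> C) (x : plane) : C :=
  (RtoC (/ rho x) * dz (weight q) x)%C.

Lemma cperiodic_weight q : cperiodic q -> cperiodic (weight q).
Proof. apply cperiodic_mult, cperiodic_rho. Qed.

Lemma cperiodic_weighted_dz q : cperiodic q -> cperiodic (weighted_dz q).
Proof.
  intros Pq. apply cperiodic_mult; [apply cperiodic_inv_rho|].
  now apply cperiodic_dz, cperiodic_weight.
Qed.

Lemma rho_inv_cancel x z : (RtoC (rho x) * (RtoC (/ rho x) * z))%C = z.
Proof.
  rewrite Cmult_assoc, <- RtoC_mult, Rinv_r; [ring|].
  pose proof (rho_pos x). lra.
Qed.

Lemma twist_inv_modulated q b k : cperiodic q ->
  twist_inv (fun x => (q x * chr_or_conj b k x)%C) =
  fun x => (Cconj (Cinv (sym_or_opp b k)) *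
    (Cconj (weight q x) * chr_or_conj (negb b) k x +
     RtoC (-1) * twist_inv (fun x => (weighted_dz q x * chr_or_conj b k x)%C) x))%C.
Proof.
  intros Pq. fun_ext x. unfold twist_inv.
  replace (weight (fun x => (q x * chr_or_conj b k x)%C)) with
    (fun x => (weight q x * chr_or_conj b k x)%C)
    by (fun_ext y; unfold weight; ring).
  replace (weight (fun x => (weighted_dz q x * chr_or_conj b k x)%C)) with
    (fun x => (dz (weight q) x * chr_or_conj b k x)%C).
  2: { fun_ext y. unfold weight at 2, weighted_dz.
       now rewrite <- Cmult_assoc, rho_inv_cancel. }
  rewrite dz_inv_modulated by now apply cperiodic_weight.
  rewrite !Cmult_conj, Cminus_conj, !Cmult_conj.
  replace (Cconj (chr_or_conj b k x)) with (chr_or_conj (negb b) k x)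
    by (destruct b; simpl; now rewrite ?Cconj_conj).
  replace (RtoC (-1)) with (- RtoC 1)%C by csolve. ring.
Qed.

(** By [twist_inv_modulated] one iterate is traded for a factor [1 / symbol] in
    front of two terms of the same kind: one with an iterate less, the other with
    a differentiated amplitude. Hence the induction on [j] for all [p] and [q] at
    once. *)
Lemma iter_inv_decay j : forall p q, (j <= p)%nat -> cperiodic q ->
  exists M, 0 <= M /\ forall b k,
    wnorm2 (iter_inv p (fun x => (q x * chr_or_conj b k x)%C)) * sym2 k ^ j <= M.
Proof.
  induction j as [|j IH]; intros p q Hj Pq.
  - destruct (iter_inv_bounded p) as [B [HB HI]].
    destruct wnorm2_equiv as [m [M [Hm [HM E]]]].
    destruct (cperiodic_bounded q Pq) as [Q [HQ BQ]].
    exists (B * (M * Q ^ 2)). split.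
    { pose proof (pow2_ge_0 Q). apply Rmult_le_pos; [lra|]. now apply Rmult_le_pos; [lra|]. }
    intros b k. pose proof (twisted_mult _ _ Pq (twisted_chr_or_conj b k)) as Tf.
    simpl pow. rewrite Rmult_1_r.
    eapply Rle_trans; [now apply HI|]. apply Rmult_le_compat_l; [lra|].
    destruct (E _ Tf) as [_ E2]. eapply Rle_trans; [exact E2|].
    apply Rmult_le_compat_l; [lra|]. apply ip_sup; [now apply twisted_ccont|].
    intros x. rewrite Cmod_mult, Cmod_chr_or_conj, Rmult_1_r. apply BQ.
  - destruct p as [|p]; [lia|].
    destruct (IH p (fun x => Cconj (weight q x))) as [M1 [HM1 B1]]; [lia| |].
    { now apply cperiodic_conj, cperiodic_weight. }
    destruct (IH (S p) (weighted_dz q)) as [M2 [HM2 B2]]; [lia| |].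
    { now apply cperiodic_weighted_dz. }
    exists (2 * M1 + 2 * M2). split; [lra|]. intros b k.
    specialize (B1 (negb b) k). specialize (B2 b k). simpl iter_inv in B2 |- *.
    rewrite twist_inv_modulated by assumption.
    set (f1 := fun x => (Cconj (weight q x) * chr_or_conj (negb b) k x)%C) in *.
    set (f2 := twist_inv (fun x => (weighted_dz q x * chr_or_conj b k x)%C)) in *.
    assert (T1 : twisted f1).
    { apply twisted_mult; [|apply twisted_chr_or_conj].
      now apply cperiodic_conj, cperiodic_weight. }
    assert (T2 : twisted f2).
    { apply twisted_twist_inv, twisted_mult; [|apply twisted_chr_or_conj].
      now apply cperiodic_weighted_dz. }
    pose proof (twisted_scal (RtoC (-1)) _ T2) as T3.
    pose proof (twisted_plus _ _ T1 T3) as T4.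
    change (fun x => (Cconj (Cinv (sym_or_opp b k)) * (f1 x + RtoC (-1) * f2 x))%C) with
      (fun x => (Cconj (Cinv (sym_or_opp b k)) * ((fun x => (f1 x + RtoC (-1) * f2 x)%C) x))%C).
    rewrite wnorm2_iter_inv_cscal by assumption.
    rewrite Cmod_conj, Cmod_inv by apply sym_or_opp_neq0.
    rewrite pow_inv, Cmod_sym_or_opp.
    pose proof (sym2_pos k) as Hs.
    replace (/ sym2 k * wnorm2 (iter_inv p (fun x => (f1 x + RtoC (-1) * f2 x)%C)) *
       sym2 k ^ S j) with
      (wnorm2 (iter_inv p (fun x => (f1 x + RtoC (-1) * f2 x)%C)) * sym2 k ^ j)
      by (simpl; field; lra).
    rewrite iter_inv_plus by assumption.
    pose proof (wnorm2_plus_le _ _ (twisted_iter_inv p _ T1) (twisted_iter_inv p _ T3)) as P.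
    rewrite wnorm2_iter_inv_cscal in P by assumption.
    replace (Cmod (RtoC (-1)) ^ 2) with 1 in P
      by (rewrite Cmod_R, Rabs_left by lra; ring).
    assert (Hp : 0 <= sym2 k ^ j) by (apply pow_le; lra).
    apply Rmult_le_compat_r with (r := sym2 k ^ j) in P; [|assumption].
    lra.
Qed.

(** ** Passing to the limit along a maximising sequence *)

Section Limit.
Variables (L : R) (a : nat -> plane -> C).
Hypothesis HL : 0 < L.
Hypothesis Hsup : forall f, twisted f -> wnorm2 (twist_inv f) <= L * wnorm2 f.
Hypothesis Ha : forall n, twisted (a n).
Hypothesis Hnorm : forall n, wnorm2 (a n) = 1.
Hypothesis Hlim : is_lim_seq (fun n => wnorm2 (twist_inv (a n))) L.

Lemma defect_to_0 e : 0 < e -> exists N, forall n, (N <= n)%nat ->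
  wnorm2 (defect L (a n)) <= e.
Proof.
  intros He. apply is_lim_seq_spec in Hlim.
  assert (He' : 0 < e / L) by now apply Rdiv_lt_0_compat.
  destruct (Hlim (mkposreal _ He')) as [N HN]. exists N. intros n Hn.
  specialize (HN n Hn). simpl in HN. apply Rabs_def2 in HN.
  eapply Rle_trans; [now apply defect_small|]. rewrite Hnorm.
  replace e with (L * (e / L)) by (field; lra).
  apply Rmult_le_compat_l; lra.
Qed.

Lemma wip_defect_to_0 g e : twisted g -> 0 < e -> exists N, forall n, (N <= n)%nat ->
  Rabs (wip (defect L (a n)) g) <= e.
Proof.
  intros Tg He. pose proof (wnorm2_ge0 g Tg) as G.
  assert (He' : 0 < e ^ 2 / (wnorm2 g + 1)).
  { apply Rdiv_lt_0_compat; [now apply pow_lt|lra]. }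
  destruct (defect_to_0 _ He') as [N HN]. exists N. intros n Hn. specialize (HN n Hn).
  pose proof (twisted_defect L _ (Ha n)) as Td.
  pose proof (wip_cauchy_schwarz _ _ Td Tg) as CS.
  apply le_of_sq; [lra|]. rewrite pow2_abs. eapply Rle_trans; [exact CS|].
  apply Rle_trans with (e ^ 2 / (wnorm2 g + 1) * wnorm2 g).
  - now apply Rmult_le_compat_r.
  - apply Rmult_le_reg_r with (wnorm2 g + 1); [lra|].
    replace (e ^ 2 / (wnorm2 g + 1) * wnorm2 g * (wnorm2 g + 1)) with (e ^ 2 * wnorm2 g)
      by (field; lra).
    pose proof (pow2_ge_0 e). nra.
Qed.

(** Each use of the approximate equation moves two operators onto [g]. *)
Lemma wip_iter_bound p : forall g e, twisted g -> 0 < e ->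
  exists N, forall n, (N <= n)%nat ->
    L ^ p * Rabs (wip (a n) g) <= sqrt (wnorm2 (iter_inv (2 * p) g)) + e.
Proof.
  induction p as [|p IH]; intros g e Tg He.
  - exists 0%nat. intros n _. simpl. rewrite Rmult_1_l.
    pose proof (wip_cauchy_schwarz _ _ (Ha n) Tg) as CS. rewrite Hnorm, Rmult_1_l in CS.
    assert (Rabs (wip (a n) g) <= sqrt (wnorm2 g)); [|lra].
    apply le_of_sq; [apply sqrt_pos|].
    now rewrite pow2_abs, pow2_sqrt by now apply wnorm2_ge0.
  - replace (2 * S p)%nat with (S (S (2 * p))) by lia. cbn [iter_inv].
    pose proof (twisted_twist_inv g Tg) as T1. pose proof (twisted_twist_inv _ T1) as T2.
    assert (HLp : 0 < L ^ p) by now apply pow_lt.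
    destruct (IH _ (e / 2) T2) as [N1 H1]; [lra|].
    destruct (wip_defect_to_0 g (e / 2 / L ^ p) Tg) as [N2 H2].
    { apply Rdiv_lt_0_compat; lra. }
    exists (N1 + N2)%nat. intros n Hn.
    specialize (H1 n ltac:(lia)). specialize (H2 n ltac:(lia)).
    rewrite wip_defect in H2 by auto. unfold defect in H2.
    rewrite wip_plus_r, wip_scal_r in H2 by auto using twisted_scal.
    set (x := wip (a n) g) in *. set (y := wip (a n) (twist_inv (twist_inv g))) in *.
    assert (B : L * Rabs x <= Rabs y + e / 2 / L ^ p).
    { replace (L * Rabs x) with (Rabs (L * x)) by (rewrite Rabs_mult, (Rabs_right L); lra).
      replace (L * x) with ((y + L * x) - y) by ring.
      eapply Rle_trans; [apply Rabs_triang|]. rewrite Rabs_Ropp. lra. }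
    replace (L ^ S p * Rabs x) with (L ^ p * (L * Rabs x)) by (simpl; ring).
    apply Rmult_le_compat_l with (r := L ^ p) in B; [|lra].
    replace (L ^ p * (Rabs y + e / 2 / L ^ p)) with (L ^ p * Rabs y + e / 2) in B
      by (field; lra).
    lra.
Qed.

(** Weighted products with the probes are the real and imaginary parts of the
    Fourier coefficients. *)
Definition probe (b : bool) (k : nat) (x : plane) : C :=
  (RtoC (/ rho x) * (if b then RtoC 1 else Ci) * chr k x)%C.

Lemma cperiodic_probe_amplitude (b : bool) :
  cperiodic (fun x => (RtoC (/ rho x) * (if b then RtoC 1 else Ci))%C).
Proof. apply cperiodic_mult; [apply cperiodic_inv_rho|apply cperiodic_const]. Qed.

Lemma twisted_probe b k : twisted (probe b k).
Proof. apply twisted_mult; [apply cperiodic_probe_amplitude|apply twisted_chr]. Qed.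

Lemma wip_probe_Re f k : wip f (probe true k) = Re (coef f k).
Proof.
  apply mean_ext. intros x. unfold weight, probe.
  pose proof (rho_pos x). generalize (f x) (chr k x). intros u w.
  unfold Re, Im; simpl. field. lra.
Qed.

Lemma wip_probe_Im f k : wip f (probe false k) = Im (coef f k).
Proof.
  apply mean_ext. intros x. unfold weight, probe.
  pose proof (rho_pos x). generalize (f x) (chr k x). intros u w.
  unfold Re, Im; simpl. field. lra.
Qed.

Lemma probe_decay b p : exists M, forall k,
  sqrt (wnorm2 (iter_inv (2 * p) (probe b k))) * sym2 k ^ p <= M.
Proof.
  destruct (iter_inv_decay (2 * p) (2 * p) _ (le_n _) (cperiodic_probe_amplitude b))
    as [M [HM B]].
  exists (sqrt M). intros k. specialize (B true k).
  change (fun x => (RtoC (/ rho x) * (if b then RtoC 1 else Ci) *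
    chr_or_conj true k x)%C) with (probe b k) in B.
  pose proof (sym2_pos k) as Hs.
  assert (0 <= sym2 k ^ p) by (apply pow_le; lra).
  apply le_of_sq; [apply sqrt_pos|].
  rewrite pow2_sqrt by assumption. rewrite Rpow_mult_distr, pow2_sqrt.
  - rewrite <- pow_mult, (Nat.mul_comm p 2). exact B.
  - apply wnorm2_ge0, twisted_iter_inv, twisted_probe.
Qed.

(** The limiting coefficients decay rapidly although only the norms of the [a n]
    are controlled: by [wip_iter_bound] a limiting coefficient is at most [L^-p]
    times the norm of an iterate of its probe, which decays like the power [-2p]
    of the frequency. So the limit is a smooth function from the start. *)
Lemma limit_decay (b : bool) (x : nat -> R) :
  (forall k, is_lim_seq (fun n => wip (a n) (probe b k)) (x k)) -> rapid x.
Proof.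
  intros Hx p. destruct (probe_decay b p) as [M HM].
  destruct sym2_lower as [c [Hc Hs]].
  assert (HLp : 0 < L ^ p) by now apply pow_lt.
  assert (Hcp : 0 < c ^ p) by now apply pow_lt.
  exists (/ (L ^ p * c ^ p) * M). intros k.
  set (s := sqrt (wnorm2 (iter_inv (2 * p) (probe b k)))) in *.
  assert (B : L ^ p * Rabs (x k) <= s).
  { apply Rle_plus_epsilon. intros e He.
    destruct (wip_iter_bound p (probe b k) (e / 2) (twisted_probe b k)) as [N1 H1]; [lra|].
    pose proof (Hx k) as Hk. apply is_lim_seq_spec in Hk.
    assert (He' : 0 < e / 2 / L ^ p) by (apply Rdiv_lt_0_compat; lra).
    destruct (Hk (mkposreal _ He')) as [N2 H2]. simpl in H2.
    specialize (H1 (N1 + N2)%nat ltac:(lia)). specialize (H2 (N1 + N2)%nat ltac:(lia)).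
    fold s in H1. set (y := wip (a (N1 + N2)) (probe b k)) in *.
    assert (T : Rabs (x k) <= Rabs y + e / 2 / L ^ p).
    { replace (x k) with (y - (y - x k)) by ring.
      eapply Rle_trans; [apply Rabs_triang|]. rewrite Rabs_Ropp. lra. }
    apply Rmult_le_compat_l with (r := L ^ p) in T; [|lra].
    replace (L ^ p * (Rabs y + e / 2 / L ^ p)) with (L ^ p * Rabs y + e / 2) in T
      by (field; lra).
    lra. }
  assert (S : (c * INR (S k)) ^ p <= sym2 k ^ p).
  { apply pow_incr. split; [|apply Hs]. apply Rmult_le_pos; [lra|apply pos_INR]. }
  rewrite Rpow_mult_distr in S.
  apply Rmult_le_reg_l with (L ^ p * c ^ p); [now apply Rmult_lt_0_compat|].
  rewrite <- (Rmult_assoc (L ^ p * c ^ p) (/ _)), Rinv_r, Rmult_1_l by nra.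
  eapply Rle_trans; [|apply (HM k)].
  replace (L ^ p * c ^ p * (Rabs (x k) * INR (Datatypes.S k) ^ p)) with
    (L ^ p * Rabs (x k) * (c ^ p * INR (Datatypes.S k) ^ p)) by ring.
  apply Rmult_le_compat; try assumption.
  - apply Rmult_le_pos; [lra|apply Rabs_pos].
  - apply Rmult_le_pos; [lra|apply pow_le, pos_INR].
Qed.

Hypothesis Hcoef : forall b k, exists x : R, is_lim_seq (fun n => wip (a n) (probe b k)) x.

Definition limit_coef (b : bool) (k : nat) : R :=
  real (Lim_seq (fun n => wip (a n) (probe b k))).

Lemma limit_coef_spec b k : is_lim_seq (fun n => wip (a n) (probe b k)) (limit_coef b k).
Proof.
  destruct (Hcoef b k) as [x Hx]. unfold limit_coef.
  now rewrite (is_lim_seq_unique _ _ Hx).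
Qed.

Definition climit (k : nat) : C := (limit_coef true k, limit_coef false k).

Lemma crapid_climit : crapid climit.
Proof.
  intros p. destruct (limit_decay true _ (limit_coef_spec true) p) as [M1 H1].
  destruct (limit_decay false _ (limit_coef_spec false) p) as [M2 H2].
  exists (M1 + M2). intros k. specialize (H1 k). specialize (H2 k).
  assert (0 <= INR (S k) ^ p) by apply pow_le, pos_INR.
  pose proof (Cmod_le_Re_Im (climit k)) as B. simpl in B.
  apply Rmult_le_compat_r with (r := INR (S k) ^ p) in B; [|assumption]. lra.
Qed.

Definition max_limit : plane -> C := fourier climit.
Definition gap (n : nat) (x : plane) : C := (a n x - max_limit x)%C.

Lemma twisted_max_limit : twisted max_limit.
Proof. apply twisted_fourier, crapid_climit. Qed.

Lemma twisted_gap n : twisted (gap n).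
Proof. apply twisted_minus; [apply Ha|apply twisted_max_limit]. Qed.

Lemma coef_gap_to_0 k e : 0 < e -> exists N, forall n, (N <= n)%nat ->
  Cmod (coef (gap n) k) <= e.
Proof.
  intros He.
  pose proof (limit_coef_spec true k) as L1. pose proof (limit_coef_spec false k) as L2.
  apply is_lim_seq_spec in L1. apply is_lim_seq_spec in L2.
  assert (He' : 0 < e / 2) by lra.
  destruct (L1 (mkposreal _ He')) as [N1 H1]. destruct (L2 (mkposreal _ He')) as [N2 H2].
  simpl in H1, H2.
  exists (N1 + N2)%nat. intros n Hn.
  specialize (H1 n ltac:(lia)). specialize (H2 n ltac:(lia)).
  rewrite wip_probe_Re in H1. rewrite wip_probe_Im in H2.
  eapply Rle_trans; [apply Cmod_le_Re_Im|].
  unfold gap. rewrite coef_minus by (apply twisted_ccont; auto using twisted_max_limit).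
  unfold max_limit. rewrite coef_fourier by apply crapid_climit.
  change (Re (coef (a n) k - climit k)%C) with (Re (coef (a n) k) - limit_coef true k).
  change (Im (coef (a n) k - climit k)%C) with (Im (coef (a n) k) - limit_coef false k).
  lra.
Qed.

Lemma gap_bounded : exists D, 0 < D /\ forall n, ip (gap n) (gap n) <= D.
Proof.
  destruct wnorm2_equiv as [m [M [Hm [HM E]]]].
  pose proof twisted_max_limit as Tu. pose proof (wnorm2_ge0 _ Tu) as Gu.
  exists ((2 + 2 * wnorm2 max_limit) / m). split; [apply Rdiv_lt_0_compat; lra|].
  intros n. destruct (E _ (twisted_gap n)) as [E1 _].
  assert (G : wnorm2 (gap n) <= 2 + 2 * wnorm2 max_limit).
  { replace (gap n) with (fun x => (a n x + RtoC (-1) * max_limit x)%C).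
    - eapply Rle_trans; [apply wnorm2_plus_le; auto using twisted_scal|].
      rewrite Hnorm, wnorm2_scal by assumption. lra.
    - fun_ext x. unfold gap. csolve. }
  apply Rmult_le_reg_l with m; [assumption|].
  replace (m * ((2 + 2 * wnorm2 max_limit) / m)) with (2 + 2 * wnorm2 max_limit)
    by (field; lra). lra.
Qed.

Lemma ip_cauchy_schwarz f g : ccont f -> ccont g -> ip f g ^ 2 <= ip f f * ip g g.
Proof.
  intros Cf Cg. apply discriminant_nonpos; [now apply ip_ge0|].
  intros t. pose proof (ccont_scal (RtoC t) g Cg) as Ct.
  pose proof (ip_ge0 _ (ccont_plus _ _ Cf Ct)) as E.
  rewrite ip_plus_l, !ip_plus_r, !ip_scal_l, !ip_scal_r in E by auto using ccont_plus.
  rewrite (ip_sym g f) in E. lra.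
Qed.

Lemma ip_chr f c k : ccont f ->
  Rabs (ip f (fun x => (c * chr k x)%C)) <= Cmod c * Cmod (coef f k).
Proof.
  intros Cf.
  replace (ip f (fun x => (c * chr k x)%C)) with (Re (Cconj c * coef f k)%C).
  - eapply Rle_trans; [apply re_le_Cmod|]. rewrite Cmod_mult, Cmod_conj. lra.
  - unfold coef. rewrite <- cmean_scal by now apply ccont_pair.
    apply mean_ext. intros x. rewrite Cmult_conj. f_equal. ring.
Qed.

Lemma ip_gap_psum_to_0 c K e : 0 < e -> exists N, forall n, (N <= n)%nat ->
  Rabs (ip (gap n) (psum c K)) <= e.
Proof.
  revert e. induction K as [|K IH]; intros e He.
  - exists 0%nat. intros n _.
    replace (ip (gap n) (psum c 0)) with 0; [rewrite Rabs_R0; lra|].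
    rewrite <- (mean_const 0). apply mean_ext. intros x. unfold Re, Im; simpl. ring.
  - destruct (IH (e / 2)) as [N1 H1]; [lra|].
    pose proof (Cmod_ge_0 (c K)) as Hc.
    destruct (coef_gap_to_0 K (e / 2 / (Cmod (c K) + 1))) as [N2 H2].
    { apply Rdiv_lt_0_compat; lra. }
    exists (N1 + N2)%nat. intros n Hn.
    specialize (H1 n ltac:(lia)). specialize (H2 n ltac:(lia)).
    pose proof (twisted_ccont _ (twisted_gap n)) as Cg.
    change (psum c (S K)) with (fun x => (psum c K x + c K * chr K x)%C).
    rewrite ip_plus_r by auto using ccont_psum, ccont_scal, ccont_chr.
    eapply Rle_trans; [apply Rabs_triang|].
    pose proof (ip_chr (gap n) (c K) K Cg) as B.
    assert (Cmod (c K) * Cmod (coef (gap n) K) <= e / 2); [|lra].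
    apply Rle_trans with ((Cmod (c K) + 1) * (e / 2 / (Cmod (c K) + 1))).
    + apply Rmult_le_compat; auto using Cmod_ge_0; lra.
    + right. field. lra.
Qed.

Lemma ip_gap_to_0 g e : twisted g -> 0 < e -> exists N, forall n, (N <= n)%nat ->
  Rabs (ip (gap n) g) <= e.
Proof.
  intros Tg He. destruct gap_bounded as [D [HD B]].
  assert (He' : 0 < (e / 2) ^ 2 / D).
  { apply Rdiv_lt_0_compat; [apply pow_lt; lra|assumption]. }
  destruct (ip_resid_small g _ Tg He') as [K HK]. specialize (HK K (le_n K)).
  destruct (ip_gap_psum_to_0 (coef g) K (e / 2)) as [N HN]; [lra|].
  exists N. intros n Hn. specialize (HN n Hn). specialize (B n).
  pose proof (twisted_ccont _ (twisted_gap n)) as Cg.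
  pose proof (ccont_resid g K (twisted_ccont g Tg)) as Cr.
  replace (ip (gap n) g) with (ip (gap n) (psum (coef g) K) + ip (gap n) (resid g K)).
  2: { rewrite <- ip_plus_r by auto using ccont_psum. f_equal.
       fun_ext x. unfold resid. ring. }
  eapply Rle_trans; [apply Rabs_triang|].
  assert (Rabs (ip (gap n) (resid g K)) <= e / 2); [|lra].
  apply le_of_sq; [lra|]. rewrite pow2_abs.
  eapply Rle_trans; [now apply ip_cauchy_schwarz|].
  replace ((e / 2) ^ 2) with (D * ((e / 2) ^ 2 / D)) by (field; lra).
  apply Rmult_le_compat; auto; now apply ip_ge0.
Qed.

Lemma sum_to_0 (v : nat -> nat -> R) K e :
  (forall k e, 0 < e -> exists N, forall n, (N <= n)%nat -> v n k <= e) ->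
  0 < e -> exists N, forall n, (N <= n)%nat -> sum_n (v n) K <= e.
Proof.
  intros Hv. revert e. induction K as [|K IH]; intros e He.
  - destruct (Hv 0%nat e He) as [N HN]. exists N. intros n Hn. rewrite sum_O. auto.
  - destruct (IH (e / 2)) as [N1 H1]; [lra|].
    destruct (Hv (S K) (e / 2)) as [N2 H2]; [lra|].
    exists (N1 + N2)%nat. intros n Hn. rewrite sum_Sn.
    specialize (H1 n ltac:(lia)). specialize (H2 n ltac:(lia)).
    unfold plus; simpl. lra.
Qed.

(** Weak convergence becomes strong under the compact operator [twist_inv]. *)
Lemma twist_inv_gap_to_0 e : 0 < e -> exists N, forall n, (N <= n)%nat ->
  wnorm2 (twist_inv (gap n)) <= e.
Proof.
  intros He.
  destruct wnorm2_equiv as [m [M [Hm [HM E]]]].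
  destruct ip_weight_le as [W [HW BW]].
  destruct gap_bounded as [D [HD B]].
  assert (He1 : 0 < e / 2 / (M * (W * (M * D)))).
  { apply Rdiv_lt_0_compat; [lra|]. repeat apply Rmult_lt_0_compat; assumption. }
  destruct (dz_inv_compact _ He1) as [A [K [HA C]]].
  destruct (sum_to_0 (fun n k => Cmod (coef (weight (gap n)) k) ^ 2) K (e / 2 / (M * A)))
    as [N HN].
  { intros k d Hd.
    assert (Hd' : 0 < sqrt d / 2) by (pose proof (sqrt_lt_R0 d Hd); lra).
    pose proof (twisted_weight _ (twisted_chr k)) as T1.
    pose proof (twisted_weight _ (twisted_scal Ci _ (twisted_chr k))) as T2.
    destruct (ip_gap_to_0 _ _ T1 Hd') as [N1 H1].
    destruct (ip_gap_to_0 _ _ T2 Hd') as [N2 H2].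
    exists (N1 + N2)%nat. intros n Hn.
    specialize (H1 n ltac:(lia)). specialize (H2 n ltac:(lia)).
    replace d with (sqrt d ^ 2) by (apply pow2_sqrt; lra).
    apply pow_incr. split; [apply Cmod_ge_0|].
    eapply Rle_trans; [apply Cmod_le_Re_Im|].
    replace (Re (coef (weight (gap n)) k)) with (ip (gap n) (weight (chr k))).
    2: { apply mean_ext. intros x. unfold weight. generalize (gap n x) (chr k x).
         intros u w. unfold Re, Im; simpl. ring. }
    replace (Im (coef (weight (gap n)) k)) with
      (ip (gap n) (weight (fun x => (Ci * chr k x)%C))).
    2: { apply mean_ext. intros x. unfold weight. generalize (gap n x) (chr k x).
         intros u w. unfold Re, Im; simpl. ring. }
    lra. }
  { apply Rdiv_lt_0_compat; [lra|]. now apply Rmult_lt_0_compat. }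
  exists N. intros n Hn. specialize (HN n Hn). specialize (B n).
  pose proof (twisted_gap n) as Tg. pose proof (twisted_weight _ Tg) as Tw.
  specialize (C _ Tw).
  destruct (E _ (twisted_twist_inv _ Tg)) as [_ E1].
  destruct (E _ Tg) as [_ E2]. specialize (BW _ Tg).
  eapply Rle_trans; [exact E1|].
  replace (ip (twist_inv (gap n)) (twist_inv (gap n))) with
    (ip (dz_inv (weight (gap n))) (dz_inv (weight (gap n))))
    by (symmetry; apply ip_conj).
  assert (I1 : ip (weight (gap n)) (weight (gap n)) <= W * (M * D)).
  { eapply Rle_trans; [exact BW|]. apply Rmult_le_compat_l; [lra|].
    eapply Rle_trans; [exact E2|]. apply Rmult_le_compat_l; lra. }
  apply Rle_trans with (M * (e / 2 / (M * (W * (M * D))) * (W * (M * D)) +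
                             A * (e / 2 / (M * A)))).
  - apply Rmult_le_compat_l; [lra|]. eapply Rle_trans; [exact C|].
    apply Rplus_le_compat; apply Rmult_le_compat_l; lra.
  - right. field. repeat split; lra.
Qed.

(** If the limit vanished, compactness would drive the norms of
    [twist_inv (a n)] to zero, while their squares tend to [L]. *)
Lemma max_limit_neq0 : exists x, max_limit x <> RtoC 0.
Proof.
  apply NNPP. intros Hno.
  assert (Z : forall x, max_limit x = RtoC 0).
  { intros x. apply NNPP. intros Hx. apply Hno. now exists x. }
  assert (G : forall n, gap n = a n).
  { intros n. fun_ext x. unfold gap.
    rewrite Z. ring. }
  destruct (twist_inv_gap_to_0 (L / 4)) as [N1 H1]; [lra|].
  pose proof Hlim as Hl. apply is_lim_seq_spec in Hl.
  assert (HL4 : 0 < L / 4) by lra.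
  destruct (Hl (mkposreal _ HL4)) as [N2 H2]. simpl in H2.
  specialize (H1 (N1 + N2)%nat ltac:(lia)). specialize (H2 (N1 + N2)%nat ltac:(lia)).
  rewrite G in H1. apply Rabs_def2 in H2. lra.
Qed.

(** The equation holds weakly in the limit because [defect] is symmetric, and the
    limit being smooth it may be tested against its own defect. *)
Lemma max_limit_eq x : defect L max_limit x = RtoC 0.
Proof.
  pose proof twisted_max_limit as Tu.
  pose proof (twisted_defect L _ Tu) as Td. pose proof (twisted_defect L _ Td) as Tdd.
  assert (E : wnorm2 (defect L max_limit) = 0).
  { apply Rabs_eq_0. apply Rle_antisym; [|apply Rabs_pos].
    apply Rle_plus_epsilon. intros e He. rewrite Rplus_0_l.
    destruct (wip_defect_to_0 _ (e / 2) Td) as [N1 H1]; [lra|].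
    destruct (ip_gap_to_0 _ (e / 2) (twisted_weight _ Tdd)) as [N2 H2]; [lra|].
    specialize (H1 (N1 + N2)%nat ltac:(lia)). specialize (H2 (N1 + N2)%nat ltac:(lia)).
    rewrite wip_defect in H1 by auto. rewrite <- wip_ip in H2.
    set (n := (N1 + N2)%nat) in *.
    assert (S : wip (a n) (defect L (defect L max_limit)) =
       wip (gap n) (defect L (defect L max_limit)) +
       wip max_limit (defect L (defect L max_limit))).
    { rewrite <- wip_plus_l by auto using twisted_gap. f_equal.
      fun_ext y. unfold gap. ring. }
    rewrite <- (wip_defect L max_limit) in S by assumption.
    fold (wnorm2 (defect L max_limit)) in S.
    replace (wnorm2 (defect L max_limit)) with
      (wip (a n) (defect L (defect L max_limit)) -
       wip (gap n) (defect L (defect L max_limit))) by lra.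
    eapply Rle_trans; [apply Rabs_triang|]. rewrite Rabs_Ropp. lra. }
  now rewrite (wnorm2_zero _ Td E).
Qed.
End Limit.

Theorem twist_inv_maximiser : exists L u, 0 < L /\
  (forall f, twisted f -> wnorm2 (twist_inv f) <= L * wnorm2 f) /\
  twisted u /\ (exists x, u x <> RtoC 0) /\
  forall x, twist_inv (twist_inv u) x = (RtoC (- L) * u x)%C.
Proof.
  destruct twist_inv_sup as [L [a [HL [Hs [Ha [Hn Hl]]]]]].
  destruct wnorm2_equiv as [m [M [Hm [HM E]]]].
  assert (Bd : forall n k, Cmod (coef (a n) k) <= sqrt (/ m)).
  { intros n k. pose proof (coef_bound (a n) k (twisted_ccont _ (Ha n))) as B.
    destruct (E _ (Ha n)) as [E1 _]. rewrite Hn in E1.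
    apply le_of_sq; [apply sqrt_pos|].
    pose proof (Rinv_0_lt_compat m Hm).
    rewrite pow2_sqrt by lra. eapply Rle_trans; [exact B|].
    apply Rmult_le_reg_l with m; [assumption|]. rewrite Rinv_r; lra. }
  destruct (extraction (fun n k => Re (coef (a n) k)) (sqrt (/ m))) as [f1 [c1 [F1 C1]]].
  { intros n k. eapply Rle_trans; [apply re_le_Cmod|apply Bd]. }
  destruct (extraction (fun n k => Im (coef (a (f1 n)) k)) (sqrt (/ m))) as [f2 [c2 [F2 C2]]].
  { intros n k. eapply Rle_trans; [apply Im_le_Cmod|apply Bd]. }
  set (b := fun n => a (f1 (f2 n))).
  assert (Hb : forall n, twisted (b n)) by (intros; apply Ha).
  assert (Hbn : forall n, wnorm2 (b n) = 1) by (intros; apply Hn).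
  assert (Hbl : is_lim_seq (fun n => wnorm2 (twist_inv (b n))) L).
  { apply (is_lim_seq_extract (fun n => wnorm2 (twist_inv (a n))) L (fun n => f1 (f2 n)));
      [|exact Hl].
    intros n. specialize (F2 n). specialize (F1 (f2 n)). lia. }
  assert (Hc : forall d k, exists x : R, is_lim_seq (fun n => wip (b n) (probe d k)) x).
  { intros [|] k.
    - exists (c1 k).
      apply is_lim_seq_ext with (fun n => Re (coef (a (f1 (f2 n))) k)).
      + intros n. symmetry. apply wip_probe_Re.
      + apply (is_lim_seq_extract (fun n => Re (coef (a (f1 n)) k))); [exact F2|apply C1].
    - exists (c2 k).
      apply is_lim_seq_ext with (fun n => Im (coef (a (f1 (f2 n))) k)).
      + intros n. symmetry. apply wip_probe_Im.
      + apply C2. }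
  exists L, (max_limit b). split; [assumption|]. split; [assumption|].
  split; [now apply (twisted_max_limit L b)|].
  split; [now apply (max_limit_neq0 L b)|].
  intros x. pose proof (max_limit_eq L b HL Hs Hb Hbn Hbl Hc x) as D.
  unfold defect in D. rewrite RtoC_opp.
  transitivity (twist_inv (twist_inv (max_limit b)) x + RtoC L * max_limit b x -
    RtoC L * max_limit b x)%C; [ring|].
  rewrite D. ring.
Qed.
End Maximiser.

(** * The Dirac operator in a conformal metric *)

Definition dzbar (f : plane -> C) (x : plane) : C :=
  (Ci * cpd i1 f x - cpd i2 f x)%C.

Lemma cpd_conj i f x : cpd i (fun y => Cconj (f y)) x = Cconj (cpd i f x).
Proof.
  unfold cpd, Cconj; simpl. f_equal.
  change (fun y => Im (Cconj (f y))) with (fun y => - Im (f y)). now rewrite pd_opp.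
Qed.

Lemma dzbar_conj f x : dzbar (fun y => Cconj (f y)) x = (- Cconj (dz f x))%C.
Proof. unfold dzbar, dz. rewrite !cpd_conj. csolve. Qed.

Lemma dz_conj f x : dz (fun y => Cconj (f y)) x = (- Cconj (dzbar f x))%C.
Proof. unfold dzbar, dz. rewrite !cpd_conj. csolve. Qed.

Section ConformalDirac.
Variable h : plane -> R.
Hypothesis Hs : smooth h.
Hypothesis Hpos : forall x, 0 < h x.

Lemma smooth_pow n : smooth (fun x => h x ^ n).
Proof.
  induction n as [|n IH]; simpl; [apply smooth_const|]. now apply smooth_mult.
Qed.

Lemma pd_pow n i x : pd i (fun x => h x ^ S n) x = INR (S n) * h x ^ n * pd i h x.
Proof.
  induction n as [|n IH].
  - replace (fun x => h x ^ 1) with h; [simpl; ring|].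
    fun_ext y; ring.
  - change (fun x => h x ^ S (S n)) with (fun x => h x * h x ^ S n).
    rewrite pd_mult by (apply smooth_ex_pd; auto using smooth_pow).
    rewrite IH, (S_INR (S n)). simpl pow. ring.
Qed.

Lemma pd_conf_metric i j k x :
  pd k (conf_metric h i j) x = 4 * h x ^ 3 * pd k h x * kron i j.
Proof.
  change (conf_metric h i j) with (fun x => h x ^ 4 * kron i j).
  rewrite pd_mult; try (apply smooth_ex_pd; auto using smooth_pow, smooth_const).
  rewrite pd_const, pd_pow. simpl INR. ring.
Qed.

Lemma pd_conf_frame a i k x :
  pd i (conf_frame h a k) x = - 2 * / h x ^ 3 * pd i h x * kron a k.
Proof.
  assert (N : forall y, h y ^ 2 <> 0)
    by (intros y; apply pow_nonzero; specialize (Hpos y); lra).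
  change (conf_frame h a k) with (fun x => / h x ^ 2 * kron a k).
  rewrite pd_mult;
    try (apply smooth_ex_pd; auto using smooth_pow, smooth_const, smooth_inv).
  rewrite pd_const, (pd_inv (fun x => h x ^ 2)), pd_pow;
    [|apply smooth_ex_pd, smooth_pow|exact N].
  specialize (Hpos x). simpl INR. field. lra.
Qed.

(** For [e^(2w)] times the flat metric the form is [- dw(e_2)], [dw(e_1)] in the
    flat coordinates; here [w = 2 ln h]. *)
Lemma connection_conf i x :
  connection_form (conf_metric h) (conf_frame h) i x =
  match i with i1 => - 2 * (pd i2 h x / h x) | i2 => 2 * (pd i1 h x / h x) end.
Proof.
  unfold connection_form, levi_civita, christoffel, sum2.
  rewrite !pd_conf_frame, !pd_conf_metric.
  unfold inv_metric, det_metric, conf_metric, conf_frame, flat_metric, flat_frame.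
  specialize (Hpos x).
  destruct i; unfold kron; field; repeat split; try lra;
    apply Rgt_not_eq; ring_simplify; try (apply pow_lt; lra).
Qed.

(** The conformal Dirac operator is the flat one conjugated by powers of [h];
    in the trivialisation at hand it acts componentwise through [dz], [dzbar]. *)
Lemma dirac_conf_eq psi x : smooth_spinor psi ->
  dirac_conf h psi x =
  sscal (/ h x ^ 3) (dzbar (fun y => (RtoC (h y) * snd (psi y))%C) x,
                     dz (fun y => (RtoC (h y) * fst (psi y))%C) x).
Proof.
  intros [S1 [S2 [S3 S4]]].
  assert (C1 : csmooth (fun y => fst (psi y))) by now split.
  assert (C2 : csmooth (fun y => snd (psi y))) by now split.
  assert (C3 : csmooth (fun y => RtoC (h y))) by now apply csmooth_real.
  unfold dirac_conf, dirac, spin_connection, dzbar, dz.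
  rewrite !(cpd_mult _ (fun y => RtoC (h y))) by assumption.
  rewrite !connection_conf. unfold spd.
  assert (E : forall i, cpd i (fun y => RtoC (h y)) x = RtoC (pd i h x)).
  { intros i. unfold cpd. change (fun y => Re (RtoC (h y))) with h.
    change (fun y => Im (RtoC (h y))) with (fun _ : plane => 0).
    now rewrite pd_const. }
  rewrite !E.
  generalize (cpd i1 (fun y => fst (psi y)) x) (cpd i2 (fun y => fst (psi y)) x)
    (cpd i1 (fun y => snd (psi y)) x) (cpd i2 (fun y => snd (psi y)) x).
  specialize (Hpos x).
  unfold conf_frame, flat_frame. destruct (psi x) as [[p1 p2] [q1 q2]].
  intros [a1 a2] [b1 b2] [c1 c2] [d1 d2].
  unfold splus, sscal, clifford, kron.
  apply injective_projections; apply injective_projections; simpl; field; lra.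
Qed.
End ConformalDirac.

Lemma dirac_flat_conf : dirac_flat = dirac_conf (fun _ => 1).
Proof.
  unfold dirac_flat, dirac_conf. f_equal.
  - unfold conf_metric. fun_ext i; fun_ext j; fun_ext x. ring.
  - unfold conf_frame. fun_ext i; fun_ext j; fun_ext x. field.
Qed.

Section Spectrum.
Context {X : spin_torus} {H : conf_factor}.

Lemma spinor_field_components psi :
  spinor_field per1 per2 spin1 spin2 psi <->
  twisted (fun x => fst (psi x)) /\ twisted (fun x => snd (psi x)).
Proof.
  split.
  - intros [[S1 [S2 [S3 S4]]] P]. split; (split; [now split|]); intros x;
      destruct (P x) as [P1 P2]; rewrite P1, P2; auto.
  - intros [[[S1 S2] P1] [[S3 S4] P2]]. split; [repeat split; assumption|].
    intros x. destruct (P1 x) as [E1 E2], (P2 x) as [E3 E4].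
    split; apply injective_projections; assumption.
Qed.

Lemma cperiodic_factor : cperiodic (fun x => RtoC (factor x)).
Proof. apply cperiodic_real; [apply factor_smooth|apply factor_periodic]. Qed.

Lemma cperiodic_inv_factor : cperiodic (fun x => RtoC (/ factor x)).
Proof.
  apply cperiodic_real.
  - apply smooth_inv; [apply factor_smooth|]. intros x. pose proof (factor_pos x). lra.
  - intros x. destruct (factor_periodic x) as [-> ->]. auto.
Qed.

Definition rescale (f : plane -> C) (x : plane) : C := (RtoC (factor x) * f x)%C.
Definition unweight (f : plane -> C) (x : plane) : C := (RtoC (/ rho x) * f x)%C.

Lemma twisted_rescale f : twisted f -> twisted (rescale f).
Proof. apply twisted_mult, cperiodic_factor. Qed.

Lemma twisted_unweight f : twisted f -> twisted (unweight f).
Proof. apply twisted_mult, cperiodic_inv_rho. Qed.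

Lemma dzbar_eq f : dzbar f = fun x => (- Cconj (dz (fun y => Cconj (f y)) x))%C.
Proof.
  fun_ext x. rewrite dz_conj. csolve.
Qed.

Lemma twisted_dzbar f : twisted f -> twisted (dzbar f).
Proof.
  intros Tf. rewrite dzbar_eq.
  now apply twisted_opp, twisted_conj, twisted_dz, twisted_conj.
Qed.

Lemma dirac_components psi : spinor_field per1 per2 spin1 spin2 psi ->
  rescale (fun x => fst (dirac_conf factor psi x)) =
    unweight (dzbar (rescale (fun x => snd (psi x)))) /\
  rescale (fun x => snd (dirac_conf factor psi x)) =
    unweight (dz (rescale (fun x => fst (psi x)))).
Proof.
  intros [Sp _].
  split; fun_ext x; unfold rescale, unweight;
    rewrite dirac_conf_eq by auto using factor_smooth, factor_pos;
    unfold sscal; cbn [fst snd]; rewrite Cmult_assoc, <- RtoC_mult;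
    f_equal; f_equal; unfold rho; pose proof (factor_pos x); field; lra.
Qed.

Lemma rescale_inj f g : rescale f = rescale g -> f = g.
Proof.
  intros E. fun_ext x.
  pose proof (equal_f E x) as Ex. unfold rescale in Ex.
  assert (A : forall z, z = (RtoC (/ factor x) * (RtoC (factor x) * z))%C).
  { intros z. rewrite Cmult_assoc, <- RtoC_mult, Rinv_l; [ring|].
    pose proof (factor_pos x). lra. }
  rewrite (A (f x)), (A (g x)). now rewrite Ex.
Qed.

Lemma spinor_field_dirac psi : spinor_field per1 per2 spin1 spin2 psi ->
  spinor_field per1 per2 spin1 spin2 (dirac_conf factor psi).
Proof.
  intros Sp. destruct (dirac_components psi Sp) as [E1 E2].
  apply spinor_field_components in Sp. destruct Sp as [T1 T2].
  assert (A : forall f g, rescale f = g -> twisted g -> twisted f).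
  { intros f g E Tg.
    replace f with (fun x => (RtoC (/ factor x) * g x)%C).
    - apply twisted_mult; [apply cperiodic_inv_factor|assumption].
    - rewrite <- E. fun_ext x. unfold rescale.
      rewrite Cmult_assoc, <- RtoC_mult, Rinv_l; [ring|].
      pose proof (factor_pos x). lra. }
  apply spinor_field_components. split.
  - apply (A _ _ E1). now apply twisted_unweight, twisted_dzbar, twisted_rescale.
  - apply (A _ _ E2). now apply twisted_unweight, twisted_dz, twisted_rescale.
Qed.

(** The equation of the first component of an eigenspinor of the squared
    operator, rescaled by the conformal factor; the conjugate of the rescaled
    second component solves the same equation. *)
Definition scalar_eigen (mu : R) (f : plane -> C) : Prop :=
  dzbar (unweight (dz f)) = fun x => (RtoC mu * weight f x)%C.

Lemma unweight_eq_iff f g : unweight f = g <-> f = weight g.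
Proof.
  split; [intros <-|intros ->]; fun_ext x;
    unfold unweight, weight; rewrite Cmult_assoc, <- RtoC_mult, ?Rinv_r, ?Rinv_l;
    try ring; pose proof (rho_pos x); lra.
Qed.

Lemma unweight_conj f : unweight (fun x => Cconj (f x)) = fun x => Cconj (unweight f x).
Proof.
  fun_ext x. unfold unweight. csolve.
Qed.

Lemma rescale_sscal_fst a psi :
  rescale (fun x => fst (sscal a (psi x))) =
  fun x => (RtoC a * rescale (fun x => fst (psi x)) x)%C.
Proof. fun_ext x. unfold rescale; simpl. ring. Qed.

Lemma rescale_sscal_snd a psi :
  rescale (fun x => snd (sscal a (psi x))) =
  fun x => (RtoC a * rescale (fun x => snd (psi x)) x)%C.
Proof. fun_ext x. unfold rescale; simpl. ring. Qed.

Lemma square_eigen_scalar psi mu : spinor_field per1 per2 spin1 spin2 psi ->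
  (forall x, square (dirac_conf factor) psi x = sscal mu (psi x)) ->
  scalar_eigen mu (rescale (fun x => fst (psi x))) /\
  scalar_eigen mu (fun x => Cconj (rescale (fun x => snd (psi x)) x)).
Proof.
  intros Sp E. apply functional_extensionality in E.
  pose proof (spinor_field_dirac psi Sp) as Sd.
  destruct (dirac_components psi Sp) as [A1 A2].
  destruct (dirac_components _ Sd) as [B1 B2].
  change (dirac_conf factor (dirac_conf factor psi)) with
    (square (dirac_conf factor) psi) in B1, B2.
  rewrite E in B1, B2. rewrite A2, rescale_sscal_fst in B1.
  rewrite A1, rescale_sscal_snd in B2.
  set (a := rescale (fun x => fst (psi x))) in *.
  set (b := rescale (fun x => snd (psi x))) in *.
  symmetry in B1, B2. apply unweight_eq_iff in B1. apply unweight_eq_iff in B2.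
  rewrite weight_scal in B1, B2.
  split; [exact B1|]. unfold scalar_eigen.
  replace (dz (fun x => Cconj (b x))) with (fun x => Cconj (- dzbar b x)%C).
  2: { fun_ext x. rewrite dz_conj. csolve. }
  rewrite unweight_conj. fun_ext x.
  rewrite dzbar_conj.
  replace (unweight (fun x => (- dzbar b x)%C)) with
    (fun x => (RtoC (-1) * unweight (dzbar b) x)%C)
    by (fun_ext y; unfold unweight; csolve).
  apply spinor_field_components in Sp. destruct Sp as [_ T2].
  rewrite dz_scal by now apply twisted_unweight, twisted_dzbar, twisted_rescale.
  rewrite B2. unfold weight. csolve.
Qed.

Lemma scalar_eigen_square mu f : twisted f -> (exists x, f x <> RtoC 0) ->
  scalar_eigen mu f ->
  eigenvalue per1 per2 spin1 spin2 (square (dirac_conf factor)) mu.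
Proof.
  intros Tf [x0 Hx0] Ef.
  set (g := fun x => (RtoC (/ factor x) * f x)%C).
  assert (Tg : twisted g)
    by (apply twisted_mult; [apply cperiodic_inv_factor|assumption]).
  assert (T0 : twisted (fun _ => RtoC 0)).
  { split; [apply csmooth_const|]. intros x. split; ring. }
  assert (Eg : rescale g = f).
  { fun_ext x. unfold rescale, g.
    rewrite Cmult_assoc, <- RtoC_mult, Rinv_r; [ring|]. pose proof (factor_pos x). lra. }
  exists (fun x => (g x, RtoC 0)).
  assert (Sp : spinor_field per1 per2 spin1 spin2 (fun x => (g x, RtoC 0))).
  { apply spinor_field_components. now split. }
  split; [exact Sp|]. split.
  { exists x0. intros E. apply Hx0. apply (f_equal fst) in E. simpl in E.
    rewrite <- Eg. unfold rescale. rewrite E. ring. }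
  pose proof (spinor_field_dirac _ Sp) as Sd.
  destruct (dirac_components _ Sp) as [A1 A2].
  destruct (dirac_components _ Sd) as [B1 B2].
  cbn [fst snd] in A1, A2.
  change (fun x => g x) with g in A2. rewrite Eg in A2.
  rewrite A2, Ef in B1. rewrite A1 in B2.
  assert (Z : rescale (fun _ => RtoC 0) = fun _ => RtoC 0).
  { fun_ext x. unfold rescale. ring. }
  rewrite Z in B2.
  assert (Z1 : dzbar (fun _ => RtoC 0) = fun _ => RtoC 0).
  { rewrite dzbar_eq. replace (fun y => Cconj (RtoC 0)) with (fun _ : plane => RtoC 0)
      by (fun_ext x; csolve).
    rewrite dz_const. fun_ext x. csolve. }
  assert (Z2 : unweight (fun _ => RtoC 0) = fun _ => RtoC 0).
  { fun_ext x. unfold unweight. ring. }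
  rewrite Z1, Z2, dz_const, Z2, <- Z in B2. apply rescale_inj in B2.
  rewrite <- weight_scal in B1.
  assert (W : unweight (weight (fun x => (RtoC mu * f x)%C)) =
              rescale (fun x => (RtoC mu * g x)%C)).
  { rewrite (proj2 (unweight_eq_iff _ _) eq_refl).
    fun_ext x. rewrite <- Eg. unfold rescale. ring. }
  rewrite W in B1. apply rescale_inj in B1.
  intros x. apply injective_projections.
  - exact (equal_f B1 x).
  - transitivity (RtoC 0); [exact (equal_f B2 x)|simpl; ring].
Qed.

(** ** The variational characterisation *)

Definition energy (f : plane -> C) : R := ip (unweight (dz f)) (dz f).

Lemma scalar_eigen_energy mu f : twisted f -> scalar_eigen mu f ->
  energy f = mu * wnorm2 f.
Proof.
  intros Tf E. pose proof (twisted_dz f Tf) as T1.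
  pose proof (twisted_unweight _ T1) as T2. pose proof (twisted_conj _ T2) as T3.
  pose proof (bil_dz f _ Tf T3) as P.
  transitivity (bil (dz f) (fun x => Cconj (unweight (dz f) x))).
  { apply mean_ext. intros x. unfold unweight. generalize (dz f x). intros z.
    unfold Re, Im; simpl. ring. }
  rewrite P.
  replace (dz (fun x => Cconj (unweight (dz f) x))) with
    (fun x => (RtoC (- mu) * Cconj (weight f x))%C).
  2: { fun_ext x. rewrite dz_conj, E. csolve. }
  unfold wnorm2, wip, ip. rewrite !(bil_sym _ (fun x => Cconj _)), (bil_sym f).
  rewrite bil_scal_l.
  - rewrite (bil_sym _ f).
    replace (bil f (fun x => Cconj (weight f x)))
      with (bil (fun x => Cconj (f x)) (weight f)).
    + ring.
    + apply mean_ext. intros x. unfold weight. generalize (f x). intros z.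
      unfold Re, Im; simpl. ring.
  - now apply ccont_conj, ccont_weight.
  - now apply twisted_ccont.
Qed.

Lemma wnorm2_conj f : wnorm2 (fun x => Cconj (f x)) = wnorm2 f.
Proof.
  apply mean_ext. intros x. unfold weight. generalize (f x). intros z.
  unfold Re, Im; simpl. ring.
Qed.

(** Up to conjugation, [f] is the image of [unweight (dz f)] under [twist_inv]. *)
Lemma wnorm2_le_energy L f :
  (forall f, twisted f -> wnorm2 (twist_inv f) <= L * wnorm2 f) -> twisted f ->
  wnorm2 f <= L * energy f.
Proof.
  intros HL Tf. pose proof (twisted_dz f Tf) as T1.
  pose proof (twisted_unweight _ T1) as T2. specialize (HL _ T2).
  assert (W : weight (unweight (dz f)) = dz f).
  { symmetry. now apply unweight_eq_iff. }
  replace (twist_inv (unweight (dz f))) with (fun x => Cconj (f x)) in HL.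
  - rewrite wnorm2_conj in HL. unfold wnorm2 at 2, wip in HL. rewrite W in HL.
    rewrite ip_sym in HL. exact HL.
  - fun_ext x. unfold twist_inv.
    now rewrite W, dz_inv_dz.
Qed.

Lemma wnorm2_pos f : twisted f -> (exists x, f x <> RtoC 0) -> 0 < wnorm2 f.
Proof.
  intros Tf [x Hx]. destruct (wnorm2_ge0 f Tf) as [?|E]; [assumption|].
  exfalso. apply Hx. symmetry in E. now rewrite (wnorm2_zero f Tf E).
Qed.

(** The eigenfunction is [dz_inv (weight u)], the conjugate of [twist_inv u]. *)
Lemma scalar_eigen_of_maximiser L u : 0 < L -> twisted u -> (exists x, u x <> RtoC 0) ->
  (forall x, twist_inv (twist_inv u) x = (RtoC (- L) * u x)%C) ->
  exists p, twisted p /\ (exists x, p x <> RtoC 0) /\ scalar_eigen (/ L) p.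
Proof.
  intros HL Tu [x0 Hx0] E.
  pose proof (twisted_weight u Tu) as Wu.
  set (p := dz_inv (weight u)).
  assert (Tp : twisted p) by now apply twisted_dz_inv.
  assert (Dp : dz p = weight u) by now apply dz_dz_inv.
  assert (Up : unweight (dz p) = u) by now apply unweight_eq_iff.
  exists p. split; [exact Tp|]. split.
  { apply NNPP. intros Hno. apply Hx0.
    assert (Z : p = fun _ => RtoC 0).
    { fun_ext x. apply NNPP. intros Hx.
      apply Hno. now exists x. }
    rewrite <- Up, Z, dz_const. unfold unweight. ring. }
  unfold scalar_eigen. rewrite Up.
  set (q := twist_inv u). fold q in E.
  assert (Tq : twisted q) by now apply twisted_twist_inv.
  assert (D : dz_inv (weight q) = fun x => (RtoC (- L) * Cconj (u x))%C).
  { fun_ext x.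
    rewrite <- (Cconj_conj (dz_inv (weight q) x)).
    change (Cconj (dz_inv (weight q) x)) with (twist_inv q x). rewrite E. csolve. }
  pose proof (dz_dz_inv _ (twisted_weight q Tq)) as F. rewrite D in F.
  rewrite dz_scal in F by now apply twisted_conj.
  fun_ext x.
  apply (f_equal (fun G => G x)) in F. cbn beta in F. rewrite dz_conj in F.
  unfold weight in F |- *. unfold q, twist_inv in F. fold p in F.
  assert (G : (RtoC L * Cconj (dzbar u x))%C = (RtoC (rho x) * Cconj (p x))%C).
  { rewrite <- F. csolve. }
  apply (f_equal Cconj) in G. rewrite !Cmult_conj, !Cconj_conj, !Cconj_R in G.
  rewrite <- G, Cmult_assoc, <- RtoC_mult, Rinv_l by lra. ring.
Qed.

Lemma eigenvalue_ge_rayleigh lam :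
  (forall f, twisted f -> lam * wnorm2 f <= energy f) ->
  forall mu, eigenvalue per1 per2 spin1 spin2 (square (dirac_conf factor)) mu ->
  lam <= mu.
Proof.
  intros V mu [psi [Sp [[x Hx] Ep]]].
  assert (B : forall f, twisted f -> (exists x, f x <> RtoC 0) ->
     scalar_eigen mu f -> lam <= mu).
  { intros f Tf Nf Ef. pose proof (V f Tf) as W.
    rewrite (scalar_eigen_energy mu f Tf Ef) in W.
    pose proof (wnorm2_pos f Tf Nf).
    apply Rmult_le_reg_r with (wnorm2 f); assumption. }
  destruct (square_eigen_scalar psi mu Sp Ep) as [E1 E2].
  apply spinor_field_components in Sp. destruct Sp as [T1 T2].
  assert (R : forall z, z <> RtoC 0 -> (RtoC (factor x) * z)%C <> RtoC 0).
  { intros z Hz. apply Cmult_neq_0; [|assumption].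
    intros F. apply RtoC_inj in F. pose proof (factor_pos x). lra. }
  destruct (classic (fst (psi x) = RtoC 0)) as [Z1|Z1].
  - apply (B (fun x => Cconj (rescale (fun x => snd (psi x)) x))).
    + now apply twisted_conj, twisted_rescale.
    + exists x. intros F. apply Hx. apply injective_projections; [exact Z1|].
      apply NNPP. intros Z2. apply (R _ Z2).
      rewrite <- (Cconj_conj (_ * _)%C).
      change (RtoC (factor x) * snd (psi x))%C with
        (rescale (fun x => snd (psi x)) x). rewrite F. csolve.
    + exact E2.
  - apply (B (rescale (fun x => fst (psi x)))).
    + now apply twisted_rescale.
    + exists x. now apply R.
    + exact E1.
Qed.

Theorem first_eigenvalue_exists : exists lam,
  first_eigenvalue per1 per2 spin1 spin2 (square (dirac_conf factor)) lam /\
  forall f, twisted f -> lam * wnorm2 f <= energy f.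
Proof.
  destruct twist_inv_maximiser as [L [u [HL [Hs [Tu [Nu E]]]]]].
  exists (/ L).
  assert (V : forall f, twisted f -> / L * wnorm2 f <= energy f).
  { intros f Tf. apply Rmult_le_reg_l with L; [assumption|].
    rewrite <- Rmult_assoc, Rinv_r, Rmult_1_l by lra. now apply wnorm2_le_energy. }
  split; [|exact V]. split; [|now apply eigenvalue_ge_rayleigh].
  destruct (scalar_eigen_of_maximiser L u HL Tu Nu E) as [p [Tp [Np Ep]]].
  now apply (scalar_eigen_square _ p).
Qed.

Theorem dirac_conf_kernel :
  trivial_kernel per1 per2 spin1 spin2 (dirac_conf factor).
Proof.
  intros psi Sp E x.
  destruct (dirac_components psi Sp) as [A1 A2].
  assert (E' : dirac_conf factor psi = fun _ => spinor0)
    by now apply functional_extensionality.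
  rewrite E' in A1, A2. cbn [fst snd spinor0] in A1, A2.
  apply spinor_field_components in Sp. destruct Sp as [T1 T2].
  assert (Z : forall f, rescale (fun _ => RtoC 0) = unweight f -> f = fun _ => RtoC 0).
  { intros f F. symmetry in F. apply unweight_eq_iff in F. rewrite F.
    fun_ext y. unfold weight, rescale. ring. }
  apply Z in A1. apply Z in A2.
  assert (T0 : twisted (fun _ => RtoC 0)).
  { split; [apply csmooth_const|]. intros y. split; ring. }
  assert (Z' : rescale (fun _ => RtoC 0) = fun _ => RtoC 0).
  { fun_ext y. unfold rescale. ring. }
  assert (K : forall f, twisted f -> dz f = (fun _ => RtoC 0) -> f = fun _ => RtoC 0).
  { intros f Tf F. apply dz_injective; try assumption. now rewrite dz_const. }
  pose proof (K _ (twisted_rescale _ T1) A2) as F1. rewrite <- Z' in F1.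
  apply rescale_inj in F1.
  assert (D : dz (fun y => Cconj (rescale (fun x => snd (psi x)) y)) = fun _ => RtoC 0).
  { fun_ext y. rewrite dz_conj, A1. csolve. }
  pose proof (K _ (twisted_conj _ (twisted_rescale _ T2)) D) as F2.
  assert (F3 : rescale (fun x => snd (psi x)) = rescale (fun _ => RtoC 0)).
  { rewrite Z'. fun_ext y.
    rewrite <- (Cconj_conj (rescale _ y)). rewrite (equal_f F2 y). csolve. }
  apply rescale_inj in F3.
  apply injective_projections; [exact (equal_f F1 x)|exact (equal_f F3 x)].
Qed.
End Spectrum.

(** * Test functions and the flat torus *)

Section Bounds.
Context {X : spin_torus} {H : conf_factor}.

Definition area : R := Rabs (fst per1 * snd per2 - snd per1 * fst per2).

Lemma torus_int_mean f : torus_int per1 per2 f = area * mean f.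
Proof. reflexivity. Qed.

Lemma area_pos : 0 < area.
Proof.
  apply Rabs_pos_lt. intros E. pose proof det_periods as D. rewrite E in D. lra.
Qed.

Lemma volume_conf :
  volume per1 per2 (conf_metric factor) = area * mean (fun x => factor x ^ 4).
Proof.
  unfold volume. rewrite torus_int_mean. f_equal. apply mean_ext. intros x.
  unfold det_metric, conf_metric, flat_metric, kron.
  replace (factor x ^ 4 * 1 * (factor x ^ 4 * 1) - factor x ^ 4 * 0 * (factor x ^ 4 * 0))
    with ((factor x ^ 4) ^ 2) by ring.
  rewrite sqrt_pow2; [reflexivity|]. left. apply pow_lt, factor_pos.
Qed.

Lemma volume_flat : volume per1 per2 flat_metric = area.
Proof.
  unfold volume. rewrite torus_int_mean.
  rewrite (mean_ext _ (fun _ => 1)), mean_const; [ring|].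
  intros x. unfold det_metric, flat_metric, kron.
  replace (1 * 1 - 0 * 0) with 1 by ring. apply sqrt_1.
Qed.

Lemma cont_inv_rho : cont (fun x => / rho x).
Proof.
  destruct cperiodic_inv_rho as [[S _] _]. exact (smooth_cont _ S).
Qed.

(** ** Modulated characters *)

(** [dz] of a character with amplitude [g], divided by the character. *)
Definition modulated_dz (g : plane -> R) (b : bool) (k : nat) (x : plane) : C :=
  (dz (fun y => RtoC (g y)) x + sym_or_opp b k * RtoC (g x))%C.

Lemma energy_modulated g b k : smooth g -> periodic per1 per2 g ->
  energy (fun x => (RtoC (g x) * chr_or_conj b k x)%C) =
  mean (fun x => / rho x * Cmod (modulated_dz g b k x) ^ 2).
Proof.
  intros Sg Pg. unfold energy.
  pose proof (cperiodic_real g Sg Pg) as [Cg _].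
  pose proof (twisted_chr_or_conj b k) as [Ce _].
  rewrite (dz_mult _ _ Cg Ce), dz_chr_or_conj.
  apply mean_ext. intros x. unfold unweight.
  pose proof (Cmod_chr_or_conj b k x) as M.
  set (z := modulated_dz g b k x).
  replace (dz (fun y => RtoC (g y)) x * chr_or_conj b k x +
           RtoC (g x) * (sym_or_opp b k * chr_or_conj b k x))%C with
    (z * chr_or_conj b k x)%C by (unfold z, modulated_dz; ring).
  replace (Cmod z ^ 2) with (Cmod (z * chr_or_conj b k x)%C ^ 2)
    by (rewrite Cmod_mult, M; ring).
  rewrite Cmod2_alt. generalize (z * chr_or_conj b k x)%C. intros w.
  unfold Re, Im; simpl. ring.
Qed.

Lemma wnorm2_modulated g b k :
  wnorm2 (fun x => (RtoC (g x) * chr_or_conj b k x)%C) =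
  mean (fun x => rho x * g x ^ 2).
Proof.
  apply mean_ext. intros x. unfold weight.
  pose proof (Cmod_chr_or_conj b k x) as M.
  pose proof (Cmod2_alt (chr_or_conj b k x)) as E. rewrite M in E.
  replace (rho x * g x ^ 2) with (rho x * g x ^ 2 * 1 ^ 2) by ring. rewrite E.
  generalize (chr_or_conj b k x). intros w. unfold Re, Im; simpl. ring.
Qed.

Lemma twisted_modulated g b k : smooth g -> periodic per1 per2 g ->
  twisted (fun x => (RtoC (g x) * chr_or_conj b k x)%C).
Proof.
  intros Sg Pg. apply twisted_mult; [now apply cperiodic_real|apply twisted_chr_or_conj].
Qed.

Lemma dz_real g x : dz (fun y => RtoC (g y)) x = (pd i2 g x, pd i1 g x).
Proof.
  unfold dz, cpd. change (fun y => Re (RtoC (g y))) with g.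
  change (fun y => Im (RtoC (g y))) with (fun _ : plane => 0).
  rewrite !pd_const. csolve.
Qed.

(** The character has constant modulus, and so has its [dz]. *)
Lemma rayleigh_character lam k :
  (forall f, twisted f -> lam * wnorm2 f <= energy f) ->
  lam * mean rho <= sym2 k * mean (fun x => / rho x).
Proof.
  intros V.
  assert (P1 : periodic per1 per2 (fun _ => 1)) by (intros x; auto).
  specialize (V _ (twisted_modulated (fun _ => 1) true k (smooth_const 1) P1)).
  rewrite wnorm2_modulated, energy_modulated in V by (auto using smooth_const).
  rewrite (mean_ext _ rho) in V by (intros; ring).
  rewrite <- (mean_scal (sym2 k)) by apply cont_inv_rho.
  eapply Rle_trans; [exact V|]. right. apply mean_ext. intros x.
  unfold modulated_dz. rewrite dz_const. simpl sym_or_opp. rewrite <- Cmod_sym_sq.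
  replace (RtoC 0 + sym k * RtoC 1)%C with (sym k) by ring. ring.
Qed.

(** With the amplitude [h], averaging over a character and its conjugate cancels
    the term linear in the gradient. *)
Lemma rayleigh_factor lam k :
  (forall f, twisted f -> lam * wnorm2 f <= energy f) ->
  lam * mean (fun x => factor x ^ 4) <=
  sym2 k + mean (fun x => grad_normsq factor x / factor x ^ 2).
Proof.
  intros V.
  pose proof factor_smooth as Sh. pose proof factor_periodic as Ph.
  pose proof (V _ (twisted_modulated factor true k Sh Ph)) as V1.
  pose proof (V _ (twisted_modulated factor false k Sh Ph)) as V2.
  rewrite wnorm2_modulated, energy_modulated in V1, V2 by assumption.
  rewrite (mean_ext _ (fun x => factor x ^ 4)) in V1, V2
    by (intros; unfold rho; ring).
  assert (Cb : forall b, cont (fun x => / rho x * Cmod (modulated_dz factor b k x) ^ 2)).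
  { intros b.
    pose proof (csmooth_plus _ _ (csmooth_dz _ (csmooth_real _ Sh))
      (csmooth_scal (sym_or_opp b k) _ (csmooth_real _ Sh))) as [A B].
    apply cont_mult; [apply cont_inv_rho|].
    apply smooth_cont. apply smooth_eq with (fun x =>
      Re (modulated_dz factor b k x) * Re (modulated_dz factor b k x) +
      Im (modulated_dz factor b k x) * Im (modulated_dz factor b k x)).
    - apply smooth_plus; now apply smooth_mult.
    - intros x. rewrite Cmod2_alt. ring. }
  assert (Cg : cont (fun x => grad_normsq factor x / factor x ^ 2)).
  { unfold grad_normsq, Rdiv. apply cont_mult; [|apply cont_inv_rho].
    apply smooth_cont. apply smooth_eq with
      (fun x => pd i1 factor x * pd i1 factor x + pd i2 factor x * pd i2 factor x).
    - apply smooth_plus; apply smooth_mult; now apply smooth_pd.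
    - intros x. ring. }
  assert (S : mean (fun x => / rho x * Cmod (modulated_dz factor true k x) ^ 2) +
              mean (fun x => / rho x * Cmod (modulated_dz factor false k x) ^ 2) =
              2 * (sym2 k + mean (fun x => grad_normsq factor x / factor x ^ 2))).
  { rewrite <- mean_plus by apply Cb.
    rewrite <- (mean_const (sym2 k)), <- mean_plus by auto using cont_const.
    rewrite <- mean_scal by (apply cont_plus; auto using cont_const).
    apply mean_ext. intros x. unfold modulated_dz. rewrite !dz_real, !Cmod2_alt.
    rewrite <- (Cmod_sym_sq k), Cmod2_alt. simpl sym_or_opp.
    generalize (sym k). intros z. unfold grad_normsq, rho, Re, Im; simpl.
    pose proof (factor_pos x). field. lra. }
  lra.
Qed.
End Bounds.

Section Flat.
Context {X : spin_torus}.

(** The flat torus as the case [h = 1]. *)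
Instance flat_factor : conf_factor.
Proof.
  refine (ConfFactor X (fun _ => 1) (smooth_const 1) _ _).
  - intros x; auto.
  - intros x; lra.
Defined.

Lemma rho_flat x : rho x = 1.
Proof. unfold rho; simpl. ring. Qed.

Lemma weight_flat f : weight f = f.
Proof.
  fun_ext x. unfold weight. rewrite rho_flat. ring.
Qed.

Lemma unweight_flat f : unweight f = f.
Proof.
  fun_ext x. unfold unweight.
  rewrite rho_flat, Rinv_1. ring.
Qed.

Lemma sym2_min : exists k, forall n, sym2 k <= sym2 n.
Proof.
  destruct sym2_lower as [c [Hc B]].
  assert (M : forall N, exists k, forall n, (n <= N)%nat -> sym2 k <= sym2 n).
  { induction N as [|N [k IH]].
    - exists 0%nat. intros n Hn. replace n with 0%nat by lia. lra.
    - destruct (Rle_dec (sym2 k) (sym2 (S N))) as [L|L].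
      + exists k. intros n Hn. destruct (Nat.eq_dec n (S N)) as [->|]; [assumption|].
        apply IH. lia.
      + exists (S N). intros n Hn. destruct (Nat.eq_dec n (S N)) as [->|]; [lra|].
        specialize (IH n ltac:(lia)). lra. }
  destruct (nfloor_ex (sym2 0 / c)) as [N [_ HN]].
  { apply Rdiv_le_0_compat; [|assumption]. left. apply sym2_pos. }
  destruct (M N) as [k Hk]. exists k. intros n.
  destruct (le_lt_dec n N) as [L|L]; [auto|].
  apply Rle_trans with (sym2 0); [apply Hk; lia|].
  eapply Rle_trans; [|apply B].
  assert (INR N + 1 <= INR (S n)) by (rewrite <- S_INR; apply le_INR; lia).
  apply Rmult_le_reg_r with (/ c); [now apply Rinv_0_lt_compat|].
  replace (c * INR (S n) * / c) with (INR (S n)) by (field; lra).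
  unfold Rdiv in HN. lra.
Qed.

Lemma scalar_eigen_chr k : scalar_eigen (sym2 k) (chr k).
Proof.
  unfold scalar_eigen. rewrite unweight_flat, weight_flat.
  replace (dz (chr k)) with (fun x => (sym k * chr k x)%C)
    by (fun_ext x; now rewrite dz_chr).
  fun_ext x.
  replace (fun x => (sym k * chr k x)%C) with
    (fun x => Cconj (Cconj (sym k) * Cconj (chr k x))%C)
    by (fun_ext y; now rewrite Cmult_conj, !Cconj_conj).
  rewrite dzbar_conj, dz_scal by (apply csmooth_conj, csmooth_charac).
  rewrite dz_conj_chr, <- sym_sq, !Cmult_conj, !Cconj_conj, Copp_conj. ring.
Qed.

(** Characters are eigenfunctions, and by Parseval the least symbol bounds the
    energy of every function from below. *)
Theorem flat_first_eigenvalue k : (forall n, sym2 k <= sym2 n) ->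
  first_eigenvalue per1 per2 spin1 spin2 (square dirac_flat) (sym2 k).
Proof.
  intros Hk. rewrite dirac_flat_conf.
  change (fun _ : plane => 1) with (@factor X flat_factor).
  split.
  - apply (scalar_eigen_square _ (chr k)); [apply twisted_chr| |apply scalar_eigen_chr].
    exists (0, 0). intros E. pose proof (Cmod_chr k (0, 0)) as C1.
    rewrite E, Cmod_0 in C1. lra.
  - apply eigenvalue_ge_rayleigh. intros f Tf.
    unfold energy, wnorm2, wip. rewrite unweight_flat, weight_flat.
    pose proof (parseval f Tf) as S1. pose proof (parseval _ (twisted_dz f Tf)) as S2.
    rewrite <- (is_series_unique _ _ S1), <- (is_series_unique _ _ S2).
    rewrite <- Series_scal_l. apply Series_le; [|now exists (ip (dz f) (dz f))].
    intros n. pose proof (sym2_pos k). pose proof (pow2_ge_0 (Cmod (coef f n))).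
    split; [apply Rmult_le_pos; lra|].
    rewrite coef_dz, Cmod_mult, Rpow_mult_distr, Cmod_sym_sq by assumption.
    now apply Rmult_le_compat_r.
Qed.
End Flat.

Section Covector.
Context {X : spin_torus}.

(** The frequencies run through [pi] times the class of the spin covector modulo
    twice the dual lattice. *)
Lemma normsq_freqZ k1 k2 :
  normsq (freqZ k1 k2) =
  PI ^ 2 * normsq (vadd (spin_covector spin1 spin2 dual1 dual2)
             (vscal 2 (vadd (vscal (IZR k1) dual1) (vscal (IZR k2) dual2)))).
Proof.
  unfold freqZ. rewrite !odd_part_IZR.
  unfold normsq, dot, spin_covector, vadd, vscal; simpl. ring.
Qed.

Lemma sym2_spin_covector : exists k,
  sym2 k = PI ^ 2 * normsq (spin_covector spin1 spin2 dual1 dual2).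
Proof.
  destruct (index_surj 0 0) as [k [E1 E2]]. exists k.
  unfold sym2, freq. rewrite E1, E2, normsq_freqZ. do 2 f_equal.
  unfold vadd, vscal. destruct (spin_covector spin1 spin2 dual1 dual2) as [a b]; simpl.
  f_equal; ring.
Qed.

Lemma shortest_sym2 k :
  shortest_spin_covector spin1 spin2 dual1 dual2 ->
  PI ^ 2 * normsq (spin_covector spin1 spin2 dual1 dual2) <= sym2 k.
Proof.
  intros S. unfold sym2, freq. rewrite normsq_freqZ.
  apply Rmult_le_compat_l; [apply pow2_ge_0|apply S].
Qed.

Lemma area_dual :
  sqrt (normsq dual1 * normsq dual2 - dot dual1 dual2 ^ 2) = / area.
Proof.
  pose proof det_periods as D.
  set (d := fst dual1 * snd dual2 - snd dual1 * fst dual2) in *.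
  replace (normsq dual1 * normsq dual2 - dot dual1 dual2 ^ 2) with (Rsqr d)
    by (unfold Rsqr, d, normsq, dot; ring).
  rewrite sqrt_Rsqr_abs. pose proof area_pos as A.
  apply Rmult_eq_reg_l with area; [|lra]. rewrite Rinv_r by lra.
  unfold area. rewrite <- Rabs_mult, D. apply Rabs_R1.
Qed.
End Covector.

Theorem theorem4
  (v1 v2 w1 w2 : plane)
  (Hbasis : basis v1 v2)
  (Hdual : dual_basis v1 v2 w1 w2)
  (h : plane -> R)
  (Hsmooth : smooth h)
  (Hper : periodic v1 v2 h)
  (Hpos : forall x, 0 < h x)
  (e1 e2 : bool)
  (Hspin : (e1, e2) <> (false, false)) :
  trivial_kernel v1 v2 e1 e2 (dirac_conf h) /\
  exists lam lam0 : R,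
    first_eigenvalue v1 v2 e1 e2 (square (dirac_conf h)) lam /\
    first_eigenvalue v1 v2 e1 e2 (square dirac_flat) lam0 /\
    lam <= PI ^ 2 * normsq (spin_covector e1 e2 w1 w2) *
           (torus_int v1 v2 (fun x => 1 / h x ^ 2) /
            torus_int v1 v2 (fun x => h x ^ 2)) /\
    lam * volume v1 v2 (conf_metric h) <=
      lam0 * volume v1 v2 flat_metric +
      torus_int v1 v2 (fun x => grad_normsq h x / h x ^ 2) /\
    (shortest_spin_covector e1 e2 w1 w2 ->
     lam0 * volume v1 v2 flat_metric =
       PI ^ 2 * (normsq (spin_covector e1 e2 w1 w2) /
                 sqrt (normsq w1 * normsq w2 - dot w1 w2 ^ 2))).
Proof.
  pose (X := SpinTorus v1 v2 w1 w2 e1 e2 Hdual Hspin).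
  pose (H := @ConfFactor X h Hsmooth Hper Hpos).
  split; [exact (@dirac_conf_kernel X H)|].
  destruct (@first_eigenvalue_exists X H) as [lam [E V]].
  destruct (@sym2_min X) as [k Hk].
  destruct (@sym2_spin_covector X) as [k0 E0].
  exists lam, (@sym2 X k).
  pose proof (@area_pos X) as A.
  split; [exact E|]. split; [exact (@flat_first_eigenvalue X k Hk)|].
  split; [|split].
  - pose proof (@rayleigh_character X H lam k0 V) as B. rewrite E0 in B.
    change (lam <= PI ^ 2 * normsq (spin_covector e1 e2 w1 w2) *
      ((@area X * @mean X (fun x => 1 / h x ^ 2)) / (@area X * @mean X (@rho X H)))).
    rewrite (@mean_ext X (fun x => 1 / h x ^ 2) (fun x => / @rho X H x))
      by (intros x; apply Rmult_1_l).
    assert (P : 0 < @mean X (@rho X H)).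
    { apply mean_pos; [apply smooth_cont, smooth_rho|apply rho_pos]. }
    apply Rmult_le_reg_r with (@mean X (@rho X H)); [exact P|].
    eapply Rle_trans; [exact B|]. right. cbn [spin1 spin2 dual1 dual2 X].
    field. split; lra.
  - rewrite (@volume_conf X H : volume v1 v2 (conf_metric h) = _).
    rewrite (@volume_flat X : volume v1 v2 flat_metric = _).
    rewrite (@torus_int_mean X _ : torus_int v1 v2 _ = _).
    pose proof (@rayleigh_factor X H lam k V) as B.
    apply Rmult_le_compat_l with (r := @area X) in B; [|lra].
    cbn [factor H] in B |- *. lra.
  - intros S. rewrite (@volume_flat X : volume v1 v2 flat_metric = _).
    rewrite (@area_dual X : sqrt (normsq w1 * normsq w2 - dot w1 w2 ^ 2) = _).
    assert (Ek : @sym2 X k = PI ^ 2 * normsq (spin_covector e1 e2 w1 w2)).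
    { apply Rle_antisym; [|exact (@shortest_sym2 X k S)].
      eapply Rle_trans; [apply (Hk k0)|]. right. exact E0. }
    rewrite Ek. field. lra.
Qed.
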